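(* Let $M$ be an $m$-dimensional indefinite minimal submanifold of $R_n^N$ with index $0<k<m$. Then for any domain on $M$, there exists a smooth variation with fixed boundary that increases the volume, and there exists a smooth variation that decreases the volume.
   Context: $R_n^N$ is $\mathbb{R}^N$ with the metric $-\sum_{j=1}^ndx_j^2+\sum_{j=n+1}^Ndx_j^2$. An indefinite submanifold is one whose induced metric $g$ is non-degenerate; the index $k$ of $M$ is the index (number of negative directions) of the induced pseudo-Riemannian metric $g$. $M$ is minimal if its mean curvature vector $H$ (the $g$-trace of the second fundamental form) vanishes identically. For an immersion $\varphi:M\to R_n^N$ with induced metric $g=g_{ij}du^idu^j$ of index $k$, the volume functional is $V(\varphi)=\int_M\sqrt{(-1)^k\det(g_{ij})}\,du^1\wedge\cdots\wedge du^m$. Variations $\varphi_t$ of the immersion $\varphi_0=\varphi$ are considered, and ''increases'' (resp. ''decreases'') the volume refers to the behaviour of $V(\varphi_t)$ compared with $V(\varphi_0)$ for small $t\neq 0$.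
   Formalization: The submanifold is assumed of positive codimension (m < N), as the claim fails for m = N; where the domain has infinite volume, volumes are compared on open subsets of finite volume containing the moved compact set. *)

(* Defs.v *)
From HB Require Import structures.
From mathcomp Require Import all_boot all_order all_algebra.
From mathcomp Require Import all_classical all_reals all_analysis.

Set Implicit Arguments.
Unset Strict Implicit.
Unset Printing Implicit Defensive.

Import Order.TTheory GRing.Theory Num.Theory.
Import numFieldNormedType.Exports.

Local Open Scope classical_set_scope.
Local Open Scope ring_scope.

Definition iter_derive (R : realType) (V W : normedModType R) (s : seq V)
  (f : V -> W) : V -> W := foldr (fun v g => 'D_v g) f s.

(* C^infinity on U (meant for open U and finite-dimensional V): all iterated
   directional derivatives, including f itself, are Frechet differentiable at
   every point of U. *)
Definition smooth_on (R : realType) (V W : normedModType R) (U : set V)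
  (f : V -> W) : Prop :=
  forall (s : seq V) (x : V), U x -> differentiable (iter_derive s f) x.

(* A Hausdorff smooth m-manifold structure on M, without boundary, given by a
   countable atlas. Second countability of M follows from the countability of
   the atlas, and conversely every second countable manifold has a countable
   atlas; chart domains may be empty. coord i and param i are total functions,
   meaningful on chart_dom i and on chart_img i respectively. *)
Record smooth_atlas (R : realType) (m : nat) (M : topologicalType) :=
  SmoothAtlas {
  chart_dom : nat -> set M ;
  coord : nat -> M -> 'rV[R]_m ;
  param : nat -> 'rV[R]_m -> M ;
  atlas_hausdorff : hausdorff_space M ;
  chart_dom_open : forall i, open (chart_dom i) ;
  chart_img_open : forall i, open (coord i @` chart_dom i) ;
  chart_cover : \bigcup_i chart_dom i = setT ;
  coordK : forall i p, chart_dom i p -> param i (coord i p) = p ;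
  coord_continuous : forall i p, chart_dom i p -> {for p, continuous (coord i)} ;
  param_continuous : forall i x, (coord i @` chart_dom i) x ->
    {for x, continuous (param i)} ;
  transition_smooth : forall i j,
    smooth_on (coord i @` (chart_dom i `&` chart_dom j)) (coord j \o param i) }.

Section Submanifold.
Context (R : realType) (m n N : nat) (M : topologicalType).
Variable A : smooth_atlas R m M.
Implicit Types (phi : M -> 'rV[R]_N) (psi : 'rV[R]_m -> 'rV[R]_N).

Definition chart_img (i : nat) : set 'rV[R]_m := coord A i @` chart_dom A i.

Definition smooth_map phi : Prop :=
  forall i, smooth_on (chart_img i) (phi \o param A i).

(* The Gram matrix of the metric of R_n^N. *)
Definition eta : 'M[R]_N := diag_mx (\row_(j < N) if (j < n)%N then -1 else 1).

(* (g_ij) = <d_i psi, d_j psi>; the i-th row of 'J psi x is d_i psi (x). *)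
Definition induced_metric psi (x : 'rV[R]_m) : 'M[R]_m :=
  'J psi x *m eta *m ('J psi x)^T.

(* The form g is negative definite on the r-dimensional span of the rows of B
   (which are then automatically linearly independent). *)
Definition negdef_on (g : 'M[R]_m) (r : nat) (B : 'M[R]_(r, m)) : Prop :=
  forall v : 'rV[R]_r, v != 0 -> (v *m B *m g *m (v *m B)^T) 0 0 < 0.

(* k is the largest dimension of a subspace on which g is negative definite. *)
Definition has_index (g : 'M[R]_m) (k : nat) : Prop :=
  (exists B : 'M[R]_(k, m), negdef_on g B) /\
  (forall (r : nat) (B : 'M[R]_(r, m)), negdef_on g B -> (r <= k)%N).

(* A smooth map into R_n^N whose induced metric is non-degenerate of index k.
   Non-degeneracy makes the differential injective, so that phi is an
   immersion. *)
Definition indefinite_immersion (k : nat) phi : Prop :=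
  smooth_map phi /\
  forall i x, chart_img i x ->
    let g := induced_metric (phi \o param A i) x in
    g \in unitmx /\ has_index g k.

(* The component of w orthogonal to the tangent space:
   w - g^{ab} <w, d_a psi> d_b psi. *)
Definition normal_part psi (x : 'rV[R]_m) (w : 'rV[R]_N) : 'rV[R]_N :=
  w - w *m eta *m ('J psi x)^T *m invmx (induced_metric psi x) *m 'J psi x.

(* h(d_i, d_j) = (d_i d_j psi)^perp, the ambient connection being flat. *)
Definition second_fundamental_form psi (x : 'rV[R]_m) (i j : 'I_m) :
    'rV[R]_N :=
  normal_part psi x ('D_(delta_mx 0 i) ('D_(delta_mx 0 j) psi) x).

Definition mean_curvature psi (x : 'rV[R]_m) : 'rV[R]_N :=
  \sum_i \sum_j
    invmx (induced_metric psi x) i j *: second_fundamental_form psi x i j.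

Definition minimal phi : Prop :=
  forall i x, chart_img i x -> mean_curvature (phi \o param A i) x = 0.

(* The Lebesgue integral over R^d of a nonnegative Borel function, written as
   an iterated integral (Tonelli). *)
Fixpoint integral_rV (d : nat) : ('rV[R]_d -> \bar R) -> \bar R :=
  match d return ('rV[R]_d -> \bar R) -> \bar R with
  | 0 => fun f => f 0
  | d'.+1 => fun f =>
      (\int[lebesgue_measure]_(t in [set: R])
         integral_rV (fun y : 'rV[R]_d' =>
           f (row_mx (t%:M : 'rV[R]_1) y : 'rV[R]_d'.+1)))%E
  end.

(* The points of chart i lying in no earlier chart; these Borel sets partition
   M. *)
Definition chart_piece (i : nat) : set M :=
  chart_dom A i `\` \bigcup_(j in [set j | (j < i)%N]) chart_dom A j.

(* The volume of the open set O for the metric induced by phi, namely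
   \int_O sqrt((-1)^k det(g_ij)) du^1...du^m, computed chart by chart on the
   above partition. By the change of variables formula it does not depend on
   the atlas. *)
Definition volume (k : nat) phi (O : set M) : \bar R :=
  (\sum_(0 <= i <oo) integral_rV (fun x : 'rV[R]_m =>
     (Num.sqrt ((-1) ^+ k * \det (induced_metric (phi \o param A i) x))
      * \1_(coord A i @` (O `&` chart_piece i)) x)%:E))%E.

(* A smooth variation of phi, through immersions of index k, defined for
   |t| < delta and moving only points of the compact subset K of D; it thus
   fixes the boundary of D. *)
Record fixed_boundary_variation (k : nat) phi (D K : set M) (delta : R)
    (Phi : R -> M -> 'rV[R]_N) : Prop := {
  variation_delta : 0 < delta ;
  variation_compact : compact K ;
  variation_sub : K `<=` D ;
  variation_smooth : forall i,
    smooth_on [set z : R^o * 'rV[R]_m | `|z.1| < delta /\ chart_img i z.2]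
      (fun z => Phi z.1 (param A i z.2)) ;
  variation_start : Phi 0 = phi ;
  variation_immersion : forall t, `|t| < delta ->
    indefinite_immersion k (Phi t) ;
  variation_fixed : forall t p, `|t| < delta -> ~ K p -> Phi t p = phi p }.

(* Volumes are compared, for all small t != 0, on every open set O of finite
   volume between K and D: on D itself when D has finite volume (e.g. when D
   is relatively compact), and otherwise on any finite-volume neighbourhood in
   D of the set K of moved points. Relatively compact such O always exist. *)
Definition increases_volume (k : nat) phi (D K : set M)
    (Phi : R -> M -> 'rV[R]_N) : Prop :=
  \forall t \near (0 : R)^', forall O : set M,
    open O -> K `<=` O -> O `<=` D -> (volume k phi O < +oo)%E ->
    (volume k phi O < volume k (Phi t) O)%E.

Definition decreases_volume (k : nat) phi (D K : set M)
    (Phi : R -> M -> 'rV[R]_N) : Prop :=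
  \forall t \near (0 : R)^', forall O : set M,
    open O -> K `<=` O -> O `<=` D -> (volume k phi O < +oo)%E ->
    (volume k (Phi t) O < volume k phi O)%E.

End Submanifold.

(* Main.v *)
Require Import Defs.
From HB Require Import structures.
From mathcomp Require Import all_boot all_order all_algebra.
From mathcomp Require Import all_classical all_reals all_analysis.
From mathcomp Require Import measurable_realfun ring lra.

Set Implicit Arguments.
Unset Strict Implicit.
Unset Printing Implicit Defensive.

Import Order.TTheory GRing.Theory Num.Theory.
Import numFieldNormedType.Exports.

Local Open Scope classical_set_scope.
Local Open Scope ring_scope.

(* Vary phi in the constant direction nu: phi_t = phi + t f nu, with f supported in
   a chart ball. With w_i = <nu, d_i phi>, b = <df, w> and
   q = |df|^2 (<nu, nu> - |w|^2) for the metric g^-1, the determinant lemma gives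
   exactly
     det g_t = det g ((1 + t b)^2 + t^2 q),
   where <nu, nu> - |w|^2 is the squared length of the normal part of nu. The
   first-order term of the volume is the integral of b sqrt|det g|, which vanishes by
   the divergence theorem and minimality, so that the change of volume is
   t^2/2 times the integral of q sqrt|det g|, up to o(t^2). Since m < N, nu can be
   chosen with non-null normal part at a point. Since 0 < k < m, there are covectors
   l with g^-1(l, l) of either sign; for f = G cos(a l.x) and f = G sin(a l.x), G a
   bump function, the two values of |df|^2 add up to |dG|^2 + a^2 G^2 g^-1(l, l), so
   for a large one of the two profiles gives the second variation the prescribed
   sign. *)

(** * Smooth functions *)

(** A constant direction replaces the normal field of the classical second variation: the metric
    then changes by a term of rank at most two, polynomial in t, and no derivative of a normal frame
    enters. The price is the pointwise first-order term b, which disappears only after integration.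
    The volumes are series of iterated integrals cut off by the indicator of an arbitrary open set,
    so they are never computed. Only their change is: it is the integral of a continuous function
    supported in a ball, for which linearity, translation invariance and integration by parts are
    proved directly. The pair of profiles spares any estimate of oscillatory integrals: the sum of
    their two second variations is an exact polynomial in a, whose leading coefficient has the
    prescribed sign. The index is carried along not as a maximal dimension but as a pair of
    complementary definite subspaces, a condition that survives small perturbations. *)

Section SmoothCalculus.
Context {R : realType}.
Implicit Types V W : normedModType R.

(** Derivatives are counted instead of listed, because the product and chain rules turn one
    derivative into several and call for induction on the order. [Ck 0] is already
    differentiability: [Ck n] makes all directional derivatives up to order n differentiable. *)
Fixpoint Ck (n : nat) V W (U : set V) (f : V -> W) : Prop :=
  (forall x, U x -> differentiable f x) /\
  if n is n'.+1 then forall v, Ck n' U ('D_v f) else True.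

Lemma Ck_differentiable n V W (U : set V) (f : V -> W) x :
  Ck n U f -> U x -> differentiable f x.
Proof. by case: n => [|n] [df _]; exact: df. Qed.

Lemma Ck_derive n V W (U : set V) (f : V -> W) v :
  Ck n.+1 U f -> Ck n U ('D_v f).
Proof. by move=> [_]; exact. Qed.

Lemma CkW n V W (U : set V) (f : V -> W) : Ck n.+1 U f -> Ck n U f.
Proof.
elim: n f => [|n IH] f [df Df]; first by split.
by split=> // v; apply: IH; exact: Df.
Qed.

Lemma smooth_onP V W (U : set V) (f : V -> W) :
  smooth_on U f <-> forall n, Ck n U f.
Proof.
split=> [sf n|Cf s x Ux].
  elim: n f sf => [|n IH] f sf; split=> //; try exact: (sf [::]).
  move=> v; apply: IH => s x Ux.
  by move: (sf (rcons s v) x Ux); rewrite /iter_derive foldr_rcons.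
have : Ck 0 U (iter_derive s f); last by case=> + _; apply.
move: (Cf (size s)); rewrite -[size s]addn0; move: 0%N => k.
elim: s k => [//|v s IH] k C.
by apply: Ck_derive; apply: IH; rewrite addnS.
Qed.

Lemma differentiableE V W (f : V -> W) x (L : {linear V -> W}) :
  continuous L ->
  (forall e : R, 0 < e ->
    \forall h \near (0 : V), `|f (h + x) - f x - L h| <= e * `|h|) ->
  differentiable f x /\ 'd f x = L :> (V -> W).
Proof.
move=> Lc fL.
have E : f \o shift x = cst (f x) + L +o_ 0 id.
  apply/eqaddoP => e e0; near=> h.
  have -> : (f \o shift x - (cst (f x) + L)) h = f (h + x) - f x - L h.
    by rewrite opprD addrA.
  by near: h; exact: fL.
have dL := diff_unique Lc E.
by split=> //; apply/diff_locallyP; rewrite dL.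
Unshelve. all: by end_near. Qed.

Lemma differentiable_approx V W (f : V -> W) x (e : R) :
  differentiable f x -> 0 < e ->
  \forall h \near (0 : V), `|f (h + x) - f x - 'd f x h| <= e * `|h|.
Proof.
move=> /diff_locallyP[_ /eqaddoP fE] e0; near=> h.
have -> : f (h + x) - f x - 'd f x h =
    (f \o shift x - (cst (f x) + 'd f x)) h by rewrite -[LHS]addrA -opprD.
by near: h; exact: fE.
Unshelve. all: by end_near. Qed.

Lemma differentiable_near_eq V W (f g : V -> W) x :
  (\near x, f x = g x) -> differentiable f x -> differentiable g x.
Proof.
move=> fg df.
suff [] : differentiable g x /\ 'd g x = 'd f x :> (V -> W) by [].
apply: differentiableE; first exact: diff_continuous.
move=> e e0; near=> h.
rewrite -(nbhs_singleton fg).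
have <- : f (h + x) = g (h + x).
  near: h.
  by have := fg; rewrite (near_shift 0) /= subr0.
near: h; exact: differentiable_approx.
Unshelve. all: by end_near. Qed.

Lemma Ck_eq n V W (U : set V) (f g : V -> W) : open U ->
  (forall x, U x -> f x = g x) -> Ck n U f -> Ck n U g.
Proof.
move=> oU; elim: n f g => [|n IH] f g fg [df Df].
  split=> // x Ux; apply: differentiable_near_eq (df x Ux).
  by near=> y; apply: fg; near: y; exact: open_nbhs_nbhs.
split.
  move=> x Ux; apply: differentiable_near_eq (df x Ux).
  by near=> y; apply: fg; near: y; exact: open_nbhs_nbhs.
move=> v; apply: IH (Df v) => x Ux.
apply: near_eq_derive.
by near=> y; apply: fg; near: y; exact: open_nbhs_nbhs.
Unshelve. all: by end_near. Qed.

Lemma Ck_sub n V W (U U' : set V) (f : V -> W) :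
  U' `<=` U -> Ck n U f -> Ck n U' f.
Proof.
move=> UU; elim: n f => [|n IH] f [df Df].
  by split=> // x /UU/df.
by split=> [x /UU/df//|v]; exact: IH (Df v).
Qed.

Lemma Ck_cst n V W (U : set V) (a : W) : Ck n U (cst a : V -> W).
Proof.
elim: n a => [|n IH] a; first by split=> // x _; exact: differentiable_cst.
split=> [x _|v]; first exact: differentiable_cst.
rewrite (_ : 'D_v (cst a) = cst 0); first exact: IH.
by apply/funext => x; exact: derive_cst.
Qed.

Lemma CkD n V W (U : set V) (f g : V -> W) : open U ->
  Ck n U f -> Ck n U g -> Ck n U (f \+ g).
Proof.
move=> oU; elim: n f g => [|n IH] f g [df Df] [dg Dg].
  by split=> // x Ux; apply: differentiableD; [exact: df|exact: dg].
split=> [x Ux|v]; first by apply: differentiableD; [exact: df|exact: dg].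
apply: (@Ck_eq _ _ _ _ ('D_v f \+ 'D_v g)) => //; last exact: IH (Df v) (Dg v).
move=> x Ux; rewrite -[RHS]/('D_v (f + g) x) deriveD //; apply: diff_derivable.
  exact: df.
exact: dg.
Qed.

Lemma Ck_sum n V W (U : set V) (I : Type) (s : seq I) (f : I -> V -> W) :
  open U -> (forall i, Ck n U (f i)) -> Ck n U (fun x => \sum_(i <- s) f i x).
Proof.
move=> oU Cf; elim: s => [|i s IH].
  by apply: (Ck_eq oU _ (Ck_cst n U 0)) => x _; rewrite big_nil.
by apply: (Ck_eq oU _ (CkD oU (Cf i) IH)) => x _; rewrite big_cons.
Qed.

Lemma CkM n V (U : set V) (f g : V -> R^o) : open U ->
  Ck n U f -> Ck n U g -> Ck n U (fun x => f x * g x).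
Proof.
move=> oU; elim: n f g => [|n IH] f g Cf Cg.
  by split=> // x Ux; apply: differentiableM;
    [exact: Ck_differentiable Cf Ux|exact: Ck_differentiable Cg Ux].
split=> [x Ux|v].
  by apply: differentiableM;
    [exact: Ck_differentiable Cf Ux|exact: Ck_differentiable Cg Ux].
apply: (@Ck_eq _ _ _ _ ((fun x => f x * 'D_v g x) \+ (fun x => g x * 'D_v f x))).
- by [].
- move=> x Ux; rewrite (_ : (fun x => f x * g x) = f * g)// deriveM //.
    exact/diff_derivable/(Ck_differentiable Cf).
  exact/diff_derivable/(Ck_differentiable Cg).
- by apply: CkD => //; apply: IH; (exact: Ck_derive || exact: CkW).
Qed.

Lemma Ck_prod n V (U : set V) (I : Type) (s : seq I) (f : I -> V -> R^o) :
  open U -> (forall i, Ck n U (f i)) -> Ck n U (fun x => \prod_(i <- s) f i x).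
Proof.
move=> oU Cf; elim: s => [|i s IH].
  by apply: (Ck_eq oU _ (@Ck_cst n V R^o U 1)) => x _; rewrite big_nil.
by apply: (Ck_eq oU _ (CkM oU (Cf i) IH)) => x _; rewrite big_cons.
Qed.

Lemma derive_lin_comp V W W' (f : V -> W) (L : {linear W -> W'}) x v :
  continuous L -> differentiable f x ->
  'D_v (fun y => L (f y)) x = L ('D_v f x).
Proof.
move=> Lc df; rewrite (_ : (fun y => L (f y)) = L \o f)//.
have dL := @linear_differentiable _ _ _ L (f x) Lc.
rewrite deriveE; last exact: differentiable_comp.
by rewrite diff_comp // diff_lin // deriveE.
Qed.

Lemma Ck_lin_comp n V W W' (U : set V) (f : V -> W) (L : {linear W -> W'}) :
  open U -> continuous L -> Ck n U f -> Ck n U (fun x => L (f x)).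
Proof.
move=> oU Lc; have dL y := @linear_differentiable _ _ _ L y Lc.
elim: n f => [|n IH] f Cf.
  by split=> // x Ux; apply: differentiable_comp (dL _); exact: Ck_differentiable Cf Ux.
split=> [x Ux|v].
  by apply: differentiable_comp (dL _); exact: Ck_differentiable Cf Ux.
apply: (Ck_eq oU _ (IH _ (Ck_derive v Cf))) => x Ux.
by rewrite derive_lin_comp //; exact: Ck_differentiable Cf Ux.
Qed.

Lemma Ck_comp_lin n V V' W (U : set V) (f : V -> W) (L : {linear V' -> V}) :
  continuous L -> Ck n U f -> open U -> Ck n (L @^-1` U) (fun x => f (L x)).
Proof.
move=> Lc Cf oU; have dL y := @linear_differentiable _ _ _ L y Lc.
have oLU : open (L @^-1` U) by apply: open_comp => // x _; exact: Lc.
elim: n f Cf => [|n IH] f Cf.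
  by split=> // x Ux; apply: differentiable_comp => //; exact: Ck_differentiable Cf Ux.
split=> [x Ux|v].
  by apply: differentiable_comp => //; exact: Ck_differentiable Cf Ux.
apply: (Ck_eq oLU _ (IH _ (Ck_derive (L v) Cf))) => x Ux.
have dfx := Ck_differentiable Cf Ux.
rewrite (_ : (fun y => f (L y)) = f \o L)//.
rewrite [RHS]deriveE; last exact: differentiable_comp.
by rewrite diff_comp //= diff_lin //= deriveE.
Qed.

(** The induction needs the derivative of the composite as a sum of products of functions of lower
    order. The finite frame [e] with coordinates [c] provides it: the sum over j of
    [c j ('D_v T x) * 'D_(e j) f (T x)]. *)
Lemma Ck_comp n d V V' (U : set V) (U' : set V') (f : V -> R^o) (T : V' -> V)
  (e : 'I_d -> V) (c : 'I_d -> {linear V -> R^o}) :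
  (forall j, continuous (c j)) -> (forall w, w = \sum_j c j w *: e j) ->
  open U -> open U' -> (forall x, U' x -> U (T x)) ->
  Ck n U f -> Ck n U' T -> Ck n U' (fun x => f (T x)).
Proof.
move=> cc ce oU oU' TU; elim: n f => [|n IH] f Cf CT.
  split=> // x Ux; apply: (@differentiable_comp _ _ _ _ T f).
    exact: Ck_differentiable CT Ux.
  by apply: Ck_differentiable Cf _; exact: TU.
split=> [x Ux|v].
  apply: (@differentiable_comp _ _ _ _ T f).
    exact: Ck_differentiable CT Ux.
  by apply: Ck_differentiable Cf _; exact: TU.
apply: (@Ck_eq _ _ _ _ (fun x => \sum_j c j ('D_v T x) * 'D_(e j) f (T x))) => //.
  move=> x Ux.
  have dT := Ck_differentiable CT Ux; have df := Ck_differentiable Cf (TU _ Ux).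
  rewrite [RHS](_ : _ = 'D_v (f \o T) x)//.
  rewrite [RHS]deriveE; last exact: differentiable_comp.
  rewrite diff_comp //= -(deriveE v dT) [in RHS](ce ('D_v T x)).
  rewrite linear_sum; apply: eq_bigr => j _.
  by rewrite linearZ -(deriveE (e j) df).
apply: Ck_sum => // j; apply: CkM => //.
  by apply: Ck_lin_comp => //; exact: Ck_derive.
by apply: (IH ('D_(e j) f)); [exact: Ck_derive|exact: CkW].
Qed.

Definition coord_lin m (j : 'I_m) (x : 'rV[R]_m) : R^o := x 0 j.

Lemma coord_lin_is_linear m (j : 'I_m) : linear (@coord_lin m j).
Proof. by move=> a x y; rewrite /coord_lin !mxE. Qed.

HB.instance Definition _ m (j : 'I_m) := GRing.isLinear.Build R 'rV[R]_m R^o _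
  (@coord_lin m j) (@coord_lin_is_linear m j).

Lemma coord_lin_continuous m (j : 'I_m) : continuous (@coord_lin m j).
Proof. by move=> x; exact: coord_continuous. Qed.

Lemma rV_sum_coord m (w : 'rV[R]_m) :
  w = \sum_j coord_lin j w *: delta_mx 0 j.
Proof. by rewrite [LHS]row_sum_delta. Qed.

Lemma Ck_comp_rV n m V' (U : set 'rV[R]_m) (U' : set V') (f : 'rV[R]_m -> R^o)
  (T : V' -> 'rV[R]_m) :
  open U -> open U' -> (forall x, U' x -> U (T x)) ->
  Ck n U f -> Ck n U' T -> Ck n U' (fun x => f (T x)).
Proof.
apply: (@Ck_comp n m _ _ U U' f T (fun j => delta_mx 0 j) (@coord_lin m)).
  exact: coord_lin_continuous.
exact: rV_sum_coord.
Qed.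

Lemma Ck_comp_R n V' (U : set R^o) (U' : set V') (f : R^o -> R^o)
  (T : V' -> R^o) :
  open U -> open U' -> (forall x, U' x -> U (T x)) ->
  Ck n U f -> Ck n U' T -> Ck n U' (fun x => f (T x)).
Proof.
apply: (@Ck_comp n 1 _ _ U U' f T (fun=> 1) (fun=> idfun)).
  by move=> _ x; exact: cvg_id.
by move=> w; rewrite big_ord1 /= [RHS]mulr1.
Qed.

Lemma derivable_coord m V (f : V -> 'rV[R]_m) x v j : differentiable f x ->
  'D_v (fun y => f y 0 j : R^o) x = 'D_v f x 0 j.
Proof.
move=> df.
exact: (@derive_lin_comp _ _ _ f (@coord_lin m j) x v (@coord_lin_continuous m j) df).
Qed.

End SmoothCalculus.

(** * Smoothness of elementary functions and of the flat exponential *)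

Section SmoothFunctions.
Context {R : realType}.

(** Gains one order. The derivatives of the reciprocal, the square root, sine, cosine and the flat
    exponentials are again expressed by these functions, so their smoothness follows by induction on
    n. *)
Lemma CkS_real n (U : set R^o) (f f' : R^o -> R^o) : open U ->
  (forall x : R, U x -> is_derive x (1 : R) (f : R -> R) (f' x)) ->
  Ck n U f' -> Ck n.+1 U f.
Proof.
move=> oU ff' Cf'.
have df x : U x -> differentiable f x.
  by move=> /ff' H; apply/derivable1_diffP.
split=> // v.
apply: (Ck_eq oU _ (CkM oU (@Ck_cst _ n R^o R^o U v) Cf')) => x Ux.
rewrite /= [RHS](deriveE _ (df _ Ux)).
rewrite -[X in 'd f x X](_ : v *: (1 : R^o) = v); last exact: mulr1.
rewrite linearZ -(deriveE _ (df _ Ux)).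
by rewrite (@derive_val _ _ _ _ _ _ _ (ff' x Ux)).
Qed.

Lemma Ck_real n (U : set R^o) (f f' : R^o -> R^o) : open U ->
  (forall x : R, U x -> is_derive x (1 : R) (f : R -> R) (f' x)) ->
  Ck n U f' -> Ck n U f.
Proof. by move=> oU ff' C; apply: CkW; exact: CkS_real C. Qed.

Lemma Ck_id n (U : set R^o) : open U -> Ck n U (id : R^o -> R^o).
Proof.
move=> oU; apply: (@Ck_real _ _ _ (cst 1)) => //; exact: Ck_cst.
Qed.

Lemma Ck_inv n : Ck n [set x : R^o | x != 0] (fun x : R^o => x^-1 : R^o).
Proof.
have oU : open [set x : R^o | x != 0] by exact: open_neq.
elim: n => [|n IH].
  by split=> // x x0; exact: differentiable_Rinv.
apply: (@CkS_real _ _ _ (fun x => (-1) * (x^-1 * x^-1))) => //.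
  move=> x x0; split.
    by apply/derivable1_diffP; exact: differentiable_Rinv.
  rewrite (@deriveV R R^o id x 1) //= derive_id.
  by rewrite [LHS]mulr1 mulN1r -exprVn expr2.
apply: CkM => //; last exact: CkM.
exact: Ck_cst.
Qed.

Lemma Ck_sqrt n : Ck n [set x : R^o | 0 < x] (fun x : R^o => Num.sqrt x : R^o).
Proof.
have oU : open [set x : R^o | 0 < x] by exact: open_gt.
have D (x : R) : 0 < x -> is_derive x 1 Num.sqrt (2 * Num.sqrt x)^-1.
  exact: is_derive1_sqrt.
elim: n => [|n IH].
  by split=> // x x0; have := D _ x0 => H; apply/derivable1_diffP.
apply: (CkS_real oU D).
apply: (@Ck_comp_R _ _ _ [set x : R^o | x != 0] _ (fun x => x^-1)
  (fun x : R^o => 2 * Num.sqrt x)).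
- exact: open_neq.
- by [].
- by move=> x x0; rewrite /= mulf_neq0// gt_eqF// sqrtr_gt0.
- exact: Ck_inv.
- by apply: CkM => //; exact: Ck_cst.
Qed.

Lemma Ck_sin_cos n : Ck n setT (@sin R : R^o -> R^o) /\ Ck n setT (@cos R : R^o -> R^o).
Proof.
elim: n => [|n [IHs IHc]].
  by split; split=> // x _; apply/derivable1_diffP.
split.
  by apply: (CkS_real openT _ IHc) => x _; exact: is_derive_sin.
apply: (@CkS_real _ _ _ (fun x => (-1) * sin x)); first exact: openT.
  by move=> x _; rewrite mulN1r; exact: is_derive_cos.
by apply: CkM => //; [exact: openT|exact: Ck_cst].
Qed.

(** The classical flat function exp (-1/x), with a polynomial factor in 1/x that makes the family
    closed under differentiation: p becomes X^2 (p - p'). *)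
Definition flat_exp (p : {poly R}) (x : R) : R :=
  if 0 < x then p.[x^-1] * expR (- x^-1) else 0.

(** A quadratic bound makes the derivative at 0 vanish. For the monomial of degree i it comes from
    the term of degree i + 2 in the exponential series of 1/x; the leading 1 in the constant only
    keeps it positive. *)
Lemma flat_exp_bound p : exists2 C : R, 0 < C & forall x, `|flat_exp p x| <= C * x ^+ 2.
Proof.
exists (1 + \sum_(i < size p) `|p`_i| * (i.+2)`!%:R).
  by rewrite ltr_pwDl// sumr_ge0.
move=> x; rewrite /flat_exp; case: ifPn => [x0|_]; last first.
  by rewrite normr0 mulr_ge0 ?sqr_ge0// addr_ge0// sumr_ge0.
have y0 : 0 < x^-1 by rewrite invr_gt0.
have E i : x^-1 ^+ i * expR (- x^-1) <= (i.+2)`!%:R * x ^+ 2.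
  rewrite expRN ler_pdivrMr ?expR_gt0//.
  have := @expR_ge1Dxn R x^-1 i.+1 (ltW y0).
  move=> /(le_trans _) H.
  have {}H : x^-1 ^+ i.+2 / (i.+2)`!%:R <= expR x^-1.
    by apply: H; rewrite lerDr.
  rewrite ler_pdivrMr ?ltr0n ?fact_gt0// in H.
  have -> : x^-1 ^+ i = x^-1 ^+ i.+2 * x ^+ 2.
    by rewrite -addn2 exprD -mulrA -exprMn mulVf ?gt_eqF// expr1n mulr1.
  by rewrite [leRHS]mulrAC ler_wpM2r ?sqr_ge0// mulrC.
rewrite horner_coef mulr_suml (le_trans (ler_norm_sum _ _ _))//.
apply: (@le_trans _ _ (\sum_(i < size p) `|p`_i| * (i.+2)`!%:R * x ^+ 2)).
  apply: ler_sum => i _.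
  rewrite -mulrA normrM -mulrA ler_wpM2l// ger0_norm ?E//.
  by rewrite mulr_ge0 ?expR_ge0// exprn_ge0// ltW.
by rewrite -mulr_suml mulrDl mul1r lerDr sqr_ge0.
Qed.

Lemma is_derive_flat_exp (p : {poly R}) (x : R) :
  is_derive x 1 (flat_exp p) (flat_exp ('X^2 * (p - p^`())) x).
Proof.
have [x0|x0|->] := ltgtP x 0.
- apply: (@near_eq_is_derive _ _ _ (cst 0)).
    near=> y; rewrite /flat_exp ifF//; apply/negbTE; rewrite -leNgt ltW//.
    by near: y; exact: lt_nbhsl.
  by rewrite /flat_exp ltNge ltW//=; exact: is_derive_cst.
- apply: (@near_eq_is_derive R R^o R^o (fun y => p.[y^-1] * expR (- y^-1))).
    near=> y; rewrite /flat_exp ifT//.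
    by near: y; exact: lt_nbhsr.
  rewrite /flat_exp x0.
  have dV : is_derive x 1 (fun y : R => y^-1) (- x ^- 2).
    split.
      by apply/derivable1_diffP; apply: differentiable_Rinv; rewrite gt_eqF.
    by rewrite (@deriveV R R^o id x 1) ?gt_eqF//= derive_id [LHS]mulr1.
  have dp := @is_derive1_comp R (horner p) (fun y : R => y^-1) x _ _ (is_derive_poly p x^-1) dV.
  have dN : is_derive x 1 (fun y : R => - y^-1) (- - x ^- 2) by exact: is_deriveN.
  have de := @is_derive1_comp R expR (fun y : R => - y^-1) x _ _ (is_derive_expR _) dN.
  have := is_deriveM dp de.
  move=> /(is_derive_eq) H; apply: H.
  rewrite !hornerE/= /GRing.scale/=.
  have x0' : x != 0 by rewrite gt_eqF.
  by field.
- have [C C0 HC] := flat_exp_bound p.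
  have f0 q : flat_exp q 0 = 0 by rewrite /flat_exp ltxx.
  have H : differentiable (flat_exp p : R^o -> R^o) 0 /\
      'd (flat_exp p : R^o -> R^o) (0 : R^o) = (\0 : R^o -> R^o) :> (R^o -> R^o).
    apply: differentiableE; first by move=> y; exact: cvg_cst.
    move=> e e0; near=> h.
    rewrite f0 addr0 subr0 /= subr0 (le_trans (HC h))//.
    rewrite -[h ^+ 2]ger0_norm ?sqr_ge0// normrX expr2 mulrA ler_wpM2r//.
    rewrite -ler_pdivlMl//.
    near: h; apply: (@nbhs0_le R R^o); rewrite mulr_gt0// invr_gt0//.
  have [d1 d2] := H; split; first exact/derivable1_diffP.
  by rewrite f0 deriveE// d2.
Unshelve. all: by end_near. Qed.

Lemma Ck_flat_exp n (p : {poly R}) : Ck n setT (flat_exp p : R^o -> R^o).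
Proof.
elim: n p => [|n IH] p.
  split=> // x _; have := is_derive_flat_exp p x => H.
  exact/derivable1_diffP.
apply: (CkS_real openT _ (IH _)) => x _; exact: is_derive_flat_exp.
Qed.

Lemma flat_exp1_gt0 x : 0 < x -> 0 < flat_exp 1 x.
Proof. by move=> x0; rewrite /flat_exp x0 hornerE mul1r expR_gt0. Qed.

Lemma flat_exp_eq0 p x : x <= 0 -> flat_exp p x = 0.
Proof. by move=> x0; rewrite /flat_exp ltNge x0. Qed.

End SmoothFunctions.

(** * Integration of compactly supported functions *)

Section Integration1.
Context {R : realType}.
Local Notation mu := (@lebesgue_measure R).

Definition supported_in (V : normedModType R) (r : R) (u : V -> R) :=
  forall x, r < `|x| -> u x = 0.

Lemma lebesgue_measure_segment (a b : R) : a <= b ->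
  mu `[a, b]%classic = (b - a)%:E.
Proof.
move=> ab; rewrite lebesgue_measure_itv /= lte_fin.
by case: ltgtP ab => // -> _; rewrite subrr.
Qed.

Lemma integral_supported (u : R -> R) r : supported_in (V:=R^o) r u ->
  (\int[mu]_(x in setT) (u x)%:E = \int[mu]_(x in `[(- r)%R, r]) (u x)%:E)%E.
Proof.
move=> ur; rewrite [RHS]integral_mkcond; congr integral; apply/funext => x.
rewrite patchE; case: ifPn => //; rewrite notin_setE /= in_itv /= -ler_norml.
by move=> /negP; rewrite -ltNge => /ur ->.
Qed.

Lemma integrable_supported (u : R -> R) r : continuous u ->
  supported_in (V:=R^o) r u -> mu.-integrable setT (EFin \o u).
Proof.
move=> cu ur.
have H : mu.-integrable `[- r, r] (EFin \o u).
  apply: continuous_compact_integrable; first exact: segment_compact.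
  exact: continuous_subspaceT.
have mI : measurable (`[- r, r] : set R) by exact: measurable_itv.
have := (@integrable_mkcond _ _ _ mu _ (EFin \o u) mI).1 H.
suff -> : (EFin \o u) \_ `[- r, r] = EFin \o u by [].
apply/funext => x; rewrite patchE; case: ifPn => //.
rewrite notin_setE /= in_itv /= -ler_norml.
by move=> /negP; rewrite -ltNge => /ur ->.
Qed.

Lemma Rintegral_supported_bound (u : R -> R) r M : continuous u -> 0 <= r ->
  supported_in (V:=R^o) r u -> (forall x, `|u x| <= M) ->
  `|\int[mu]_x u x| <= M * (r *+ 2).
Proof.
move=> cu r0 ur uM.
have iu := integrable_supported cu ur.
apply: (le_trans (le_normr_Rintegral _ iu)) => //.
have E : \int[mu]_x `|u x| = \int[mu]_(x in `[- r, r]) `|u x|.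
  rewrite /Rintegral (@integral_supported (fun x => `|u x|) r)//.
  by move=> x rx; rewrite (ur _ rx) normr0.
rewrite E.
have cN : continuous (fun x => `|u x| : R) .
  by move=> x; apply: continuous_comp; [exact: cu|exact: norm_continuous].
have iN : mu.-integrable `[- r, r] (EFin \o (fun x => `|u x|)).
  apply: continuous_compact_integrable; first exact: segment_compact.
  exact: continuous_subspaceT.
apply: (@le_trans _ _ (\int[mu]_(x in `[- r, r]) M)).
  apply: le_Rintegral => //.
  apply: continuous_compact_integrable; first exact: segment_compact.
  by apply: continuous_subspaceT => x; exact: cvg_cst.
rewrite Rintegral_cst// [X in M * fine X](_ : _ = (r *+ 2)%:E)//.
rewrite (_ : r *+ 2 = r - - r); last by rewrite opprK mulr2n.
by apply: lebesgue_measure_segment; lra.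
Qed.

Lemma continuous_funmax0 (T : topologicalType) (u : T -> R) :
  continuous u -> continuous (fun x => Num.max (u x) 0).
Proof.
move=> cu x.
by apply: (@continuous_max R T (u : T -> R^o) (cst 0 : T -> R^o)); [exact: cu|exact: cvg_cst].
Qed.

Lemma Rintegral_shift_ge0 (u : R -> R) h : continuous u ->
  (forall x, 0 <= u x) -> \int[mu]_x u (x + h) = \int[mu]_x u x.
Proof.
move=> cu u0; rewrite /Rintegral; congr fine.
pose F (x : R) := x + h.
have dF (x : R) : is_derive x 1 F 1.
  rewrite -[X in is_derive _ _ _ X](addr0 1).
  by apply: is_deriveD.
have F1 : derive1 F = cst 1.
  by apply/funext => x; rewrite derive1E; exact: derive_val.
rewrite (@increasing_ge0_integration_by_substitutionT R F u) //.
- by apply: eq_integral => x _; rewrite /= F1 /= mulr1.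
- by move=> x y xy; rewrite ltrD2r.
- by rewrite F1 => x; exact: cvg_cst.
- by rewrite F1; exact: is_cvg_cst.
- by rewrite F1; exact: is_cvg_cst.
- exact: cvg_addrr_Ny.
- exact: cvg_addrr.
Qed.

(** Positive and negative parts reduce this to nonnegative functions. A translate is supported in
    the ball enlarged by the length of the shift, so every part stays integrable. *)
Lemma Rintegral_shift (u : R -> R) r h : continuous u ->
  supported_in (V:=R^o) r u -> \int[mu]_x u (x + h) = \int[mu]_x u x.
Proof.
move=> cu ur.
pose up x := Num.max (u x) 0; pose un x := Num.max (- u x) 0.
have cup : continuous up by exact: continuous_funmax0.
have cun : continuous un.
  by apply: continuous_funmax0 => x; apply: cvgN; exact: cu.
have sup : supported_in (V:=R^o) r up.
  by move=> x /ur; rewrite /up => ->; rewrite maxxx.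
have sun : supported_in (V:=R^o) r un.
  by move=> x /ur; rewrite /un => ->; rewrite oppr0 maxxx.
have uE x : u x = up x - un x.
  by rewrite /up /un; have [H|H] := leP (u x) 0; case: (leP (- u x)); lra.
have sh (w : R -> R) : supported_in (V:=R^o) r w ->
    supported_in (V:=R^o) (r + `|h|) (fun x => w (x + h)).
  move=> sw x hx; apply: sw; have := ler_normB (x + h) h.
  by rewrite addrK; lra.
have ch (w : R -> R) : continuous w -> continuous (fun x => w (x + h)).
  move=> cw x; apply: (continuous_comp (f := fun x => x + h)); last exact: cw.
  by apply: cvgD; [exact: cvg_id|exact: cvg_cst].
transitivity (\int[mu]_x (up (x + h) - un (x + h))).
  by apply: eq_Rintegral => x _; rewrite uE.
transitivity (\int[mu]_x (up x - un x)); last first.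
  by apply: eq_Rintegral => x _; rewrite uE.
have iE (w : R -> R) : continuous w -> supported_in (V:=R^o) r w ->
    mu.-integrable setT (EFin \o w) /\
    mu.-integrable setT (EFin \o (fun x => w (x + h))).
  move=> cw sw; split; first exact: integrable_supported sw.
  exact: integrable_supported (ch _ cw) (sh _ sw).
have [ip1 ip2] := iE _ cup sup; have [in1 in2] := iE _ cun sun.
rewrite (RintegralB _ ip2 in2)// (RintegralB _ ip1 in1)//.
by rewrite !Rintegral_shift_ge0// => x; rewrite le_max lexx orbT.
Qed.

Lemma Rintegral_gt0 (u : R -> R) r p : continuous u ->
  supported_in (V:=R^o) r u -> (forall x, 0 <= u x) -> 0 < u p ->
  0 < \int[mu]_x u x.
Proof.
move=> cu ur u0 up.
have /cvgrPdist_lt /(_ (u p / 2)) : u x @[x --> p] --> u p by exact: cu.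
rewrite divr_gt0// => /(_ isT) /nbhs_ballP[d /= d0 Hd].
pose a := p - d / 2; pose b := p + d / 2.
have ab : a < b by rewrite /a /b; lra.
have iu := integrable_supported cu ur.
have sub : mu.-integrable `[a, b] (EFin \o u).
  by apply: integrableS iu.
have ge : \int[mu]_(x in `[a, b]) u x <= \int[mu]_x u x.
  rewrite [leLHS]Rintegral_mkcond; apply: le_Rintegral => //.
    have mI : measurable (`[a, b] : set R) by exact: measurable_itv.
    have := (@integrable_mkcond _ _ _ mu _ (EFin \o u) mI).1 sub.
    rewrite (_ : _ \_ _ = EFin \o (u \_ `[a, b]))//.
    by apply/funext => x; rewrite /= !patchE; case: ifP.
  by move=> x _; rewrite patchE; case: ifP.
apply: lt_le_trans ge.
apply: (@lt_le_trans _ _ (\int[mu]_(x in `[a, b]) (u p / 2))).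
  rewrite Rintegral_cst// [X in _ * fine X](_ : _ = (b - a)%:E).
    by rewrite mulr_gt0 ?subr_gt0// divr_gt0.
  by apply: lebesgue_measure_segment; exact: ltW.
apply: le_Rintegral => //.
  apply: continuous_compact_integrable; first exact: segment_compact.
  by apply: continuous_subspaceT => x; exact: cvg_cst.
move=> x; rewrite /= in_itv /= => /andP[ax xb].
have : `|u p - u x| < u p / 2.
  by apply: Hd; rewrite /= /ball /= ltr_norml; rewrite /a /b in ax xb; lra.
by rewrite ltr_norml; lra.
Qed.

Import HBNNSimple.

Lemma ge0_integral_le (f g : R -> \bar R) : (forall x, 0 <= f x)%E ->
  (forall x, f x <= g x)%E -> (\int[mu]_x f x <= \int[mu]_x g x)%E.
Proof.
move=> f0 fg; have g0 x : (0 <= g x)%E by exact: le_trans (f0 x) (fg x).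
rewrite !ge0_integralTE//; apply: le_ereal_sup => _ [h /= hf <-].
by exists h => //= x; exact: le_trans (hf x) (fg x).
Qed.

(* No measurability of f is needed: a simple function below f + u splits as the
   measurable functions (h - u)^+ <= f and min h u <= u. *)
Lemma ge0_integralDr (f : R -> \bar R) (u : R -> R) : (forall x, 0 <= f x)%E ->
  (forall x, 0 <= u x) -> mu.-integrable setT (EFin \o u) ->
  (\int[mu]_x (f x + (u x)%:E) = \int[mu]_x f x + \int[mu]_x (u x)%:E)%E.
Proof.
move=> f0 u0 iu; have mu_ : measurable_fun setT u.
  by apply/measurable_EFinP; exact: (measurable_int mu iu).
have fin : (\int[mu]_x (u x)%:E)%E \is a fin_num.
  exact: (integrable_fin_num _ iu).
have fu0 x : (0 <= f x + (u x)%:E)%E by rewrite adde_ge0// lee_fin.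
apply/eqP; rewrite eq_le; apply/andP; split.
  rewrite [leLHS]ge0_integralTE//; apply: ge_ereal_sup => _ [h /= hfu <-].
  rewrite -integralT_nnsfun.
  pose h1 x := Num.max (h x - u x) 0; pose h2 x := Num.min (h x) (u x).
  have mh : measurable_fun setT h by exact: measurable_funPT.
  have mh1 : measurable_fun setT h1.
    by apply: measurable_maxr => //; apply: measurable_funB.
  have mh2 : measurable_fun setT h2 by exact: measurable_minr.
  have hE x : h x = h1 x + h2 x.
    by rewrite /h1 /h2; have [H|H] := leP (h x) (u x);
      [rewrite max_r ?subr_le0// add0r|rewrite max_l ?subr_ge0 ?subrK// ltW].
  have h10 x : 0 <= h1 x by rewrite le_max lexx orbT.
  have h20 x : 0 <= h2 x by rewrite le_min fun_ge0 u0.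
  under eq_integral do rewrite hE EFinD.
  rewrite ge0_integralD//; first last.
  - exact/measurable_EFinP.
  - by move=> x _; rewrite lee_fin.
  - exact/measurable_EFinP.
  - by move=> x _; rewrite lee_fin.
  apply: leeD; apply: ge0_integral_le => x; rewrite ?lee_fin//.
    rewrite /h1; have [H|H] := leP (h x) (u x); first by rewrite max_r ?subr_le0.
    rewrite max_l ?subr_ge0 ?(ltW H)// EFinB leeBlDr//.
  by rewrite ge_min lexx orbT.
rewrite -leeBrDr//; rewrite [leLHS]ge0_integralTE//.
apply: ge_ereal_sup => _ [h /= hf <-]; rewrite -integralT_nnsfun leeBrDr//.
rewrite -ge0_integralD//; first last.
- exact/measurable_EFinP.
- by move=> x _; rewrite lee_fin.
- by apply/measurable_EFinP; exact: measurable_funPT.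
- by move=> x _; rewrite lee_fin.
apply: ge0_integral_le => x; first by rewrite adde_ge0// lee_fin.
by rewrite leeD2r.
Qed.

End Integration1.

(** * Iterated integrals over row vectors *)

Section IntegrationRV.
Context {R : realType}.
Local Notation mu := (@lebesgue_measure R).

Lemma ler_norm_coord d (x : 'rV[R]_d) j : `|x 0 j| <= `|x|.
Proof.
by rewrite [leRHS]mx_normrE (le_trans _ (le_bigmax _ _ (0, j))).
Qed.

Lemma ler_norm_rV d (x : 'rV[R]_d) (a : R) :
  0 <= a -> (forall j, `|x 0 j| <= a) -> `|x| <= a.
Proof.
move=> a0 xa; rewrite [leLHS]mx_normrE; apply: bigmax_le => // -[i j] _ /=.
by rewrite ord1.
Qed.

Definition slice d (t : R) (y : 'rV[R]_d) : 'rV[R]_d.+1 :=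
  row_mx (t%:M : 'rV[R]_1) y.

Lemma sliceB d t (y : 'rV[R]_d) t' y' :
  slice t y - slice t' y' = slice (t - t') (y - y').
Proof. by rewrite /slice raddfB -add_row_mx -opp_row_mx. Qed.

Lemma sliceD d t (y : 'rV[R]_d) t' y' :
  slice t y + slice t' y' = slice (t + t') (y + y').
Proof. by rewrite /slice raddfD -add_row_mx. Qed.

Lemma slice_split d (x : 'rV[R]_d.+1) :
  x = slice ((x : 'rV_(1 + d)) 0 0) (rsubmx (x : 'rV_(1 + d))).
Proof.
rewrite /slice (_ : _%:M = lsubmx (x : 'rV_(1 + d))) ?hsubmxK//.
apply/rowP => j; rewrite ord1 !mxE eqxx mulr1n; congr (x 0 _).
exact: val_inj.
Qed.

Lemma slice_l d t (y : 'rV[R]_d) (j : 'I_1) :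
  slice t y 0 (lshift d j : 'I_(1 + d)) = t.
Proof. by rewrite [LHS](row_mxEl (t%:M : 'rV_1) y) ord1 mxE eqxx mulr1n. Qed.

Lemma slice_r d t (y : 'rV[R]_d) j :
  slice t y 0 (rshift 1 j : 'I_(1 + d)) = y 0 j.
Proof. by rewrite [LHS](row_mxEr (t%:M : 'rV_1) y). Qed.

Lemma slice_normP d t (y : 'rV[R]_d) (a : R) :
  `|slice t y| <= a <-> `|t| <= a /\ `|y| <= a.
Proof.
split=> [H|[ta ya]].
  split.
    have := le_trans (ler_norm_coord (slice t y) (lshift d ord0 : 'I_(1 + d))) H.
    by rewrite slice_l.
  apply: ler_norm_rV => [|j]; first exact: le_trans (normr_ge0 _) H.
  have := le_trans (ler_norm_coord (slice t y) (rshift 1 j : 'I_(1 + d))) H.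
  by rewrite slice_r.
apply: ler_norm_rV => [|j]; first exact: le_trans (normr_ge0 _) ta.
case: (@splitP 1 d j) => k jk.
  by rewrite (_ : j = lshift d k :> 'I_(1 + d)) ?slice_l//; exact: val_inj.
rewrite (_ : j = rshift 1 k :> 'I_(1 + d)) ?slice_r; last exact: val_inj.
exact: le_trans (ler_norm_coord _ _) ya.
Qed.

Lemma slice_continuous d : continuous (fun z : R^o * 'rV[R]_d => slice z.1 z.2).
Proof.
move=> [t y]; apply/cvgrPdist_le => e e0; near=> z.
rewrite sliceB; apply/slice_normP; split; near: z.
  have : (fun z : R^o * 'rV[R]_d => z.1) @ (t, y) --> (t : R^o) by exact: cvg_fst.
  by move=> /cvgrPdist_le /(_ e e0).
have : (fun z : R^o * 'rV[R]_d => z.2) @ (t, y) --> y by exact: cvg_snd.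
by move=> /cvgrPdist_le /(_ e e0).
Unshelve. all: by end_near. Qed.

(** Real-valued counterpart of [integral_rV], meant for continuous functions supported in a ball
    ([ccs]), on which the two agree by [integral_rV_Irv]. *)
Fixpoint Irv (d : nat) : ('rV[R]_d -> R) -> R :=
  match d return ('rV[R]_d -> R) -> R with
  | 0 => fun c => c 0
  | d'.+1 => fun c => \int[mu]_t Irv (fun y => c (slice t y))
  end.

(** Tube lemma: joint continuity along the slice over [t0] gives convergence uniform over the
    compact K. It serves for continuity of slice integrals, for difference quotients and for the
    expansion of the volume. *)
Lemma near_uniform (T X : topologicalType) (K : set X) (g : T -> X -> R) t0 :
  compact K ->
  (forall y, K y -> {for (t0, y), continuous (fun z => g z.1 z.2)}) ->
  forall e, 0 < e -> \forall t \near t0, forall y, K y -> `|g t y - g t0 y| < e.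
Proof.
move=> /compact_near_coveringP cK cg e e0.
have := cK _ (nbhs t0) (fun t y => `|g t y - g t0 y| < e) _.
apply => y Ky; have := cg y Ky.
move=> /cvgrPdist_lt /(_ (e / 2)); rewrite divr_gt0// => /(_ isT).
move=> [[A B] [/= nA nB] AB].
exists (B, A) => //= -[y' t] /= [By' At].
have := AB (t, y') (conj At By').
have := AB (t0, y') (conj (nbhs_singleton nA) By').
rewrite !ltr_norml => /andP[? ?] /andP[? ?].
by apply/andP; lra.
Qed.

Lemma compact_ball_rV d (r : R) : compact [set y : 'rV[R]_d | `|y| <= r].
Proof.
apply: bounded_closed_compact.
  exists r; split; first exact: num_real.
  by move=> M rM y /= /le_trans; apply; exact: ltW.
rewrite (_ : [set _ | _] = Num.norm @^-1` [set x | x <= r])//.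
by apply: closed_comp => [x _|]; [exact: norm_continuous|exact: closed_le].
Qed.

Definition ccs d (c : 'rV[R]_d -> R) r := continuous c /\ supported_in r c.

Lemma ccs_slice d (c : 'rV[R]_d.+1 -> R) r t :
  ccs c r -> ccs (fun y => c (slice t y)) r.
Proof.
move=> [cc sc]; split.
  move=> y; apply: (continuous_comp (f := fun y => slice t y)); last exact: cc.
  apply/(@cvgrPdist_le _ _ _ (nbhs y)) => e e0; near=> z.
  rewrite sliceB; apply/slice_normP; split; first by rewrite subrr normr0 ltW.
  near: z; apply/nbhs_ballP; exists e => //= z.
  by rewrite -ball_normE => /ltW.
move=> y ry; apply: sc; rewrite ltNge; apply/negP => /slice_normP[_].
by rewrite leNgt ry.
Unshelve. all: by end_near. Qed.

Lemma ccs_slice0 d (c : 'rV[R]_d.+1 -> R) r t :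
  ccs c r -> r < `|t| -> (fun y => c (slice t y)) = fun=> 0.
Proof.
move=> [cc sc] rt; apply/funext => y; apply: sc.
rewrite ltNge; apply/negP => /slice_normP[].
by rewrite leNgt rt.
Qed.

Lemma ccsD d (c c' : 'rV[R]_d -> R) r :
  ccs c r -> ccs c' r -> ccs (fun x => c x + c' x) r.
Proof.
move=> [cc sc] [cc' sc']; split; first by move=> x; exact: (cvgD (cc x) (cc' x)).
by move=> x rx; rewrite sc// sc'// addr0.
Qed.

Lemma ccsZ d (c : 'rV[R]_d -> R) r (a : R) : ccs c r -> ccs (fun x => a * c x) r.
Proof.
move=> [cc sc]; split; first by move=> x; exact: (cvgM (cvg_cst a) (cc x)).
by move=> x rx; rewrite sc// mulr0.
Qed.

Lemma Irv0 d : Irv (fun _ : 'rV[R]_d => 0) = 0.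
Proof.
elim: d => [//|d IH] /=.
by under eq_Rintegral do rewrite IH; rewrite Rintegral_cst// mul0r.
Qed.

Let Irv_lin d := forall (c c' : 'rV[R]_d -> R) r a, ccs c r -> ccs c' r ->
  Irv (fun x => c x + a * c' x) = Irv c + a * Irv c'.
Let Irv_bnd d := forall (c : 'rV[R]_d -> R) r M, 0 <= r -> ccs c r ->
  (forall x, `|c x| <= M) -> `|Irv c| <= M * (r *+ 2) ^+ d.

Lemma Irv_slice_subproof d : Irv_lin d -> Irv_bnd d ->
  forall (c : 'rV[R]_d.+1 -> R) r, 0 <= r -> ccs c r ->
  continuous (fun t => Irv (fun y => c (slice t y))) /\
  supported_in (V:=R^o) r (fun t => Irv (fun y => c (slice t y))).
Proof.
move=> Il Ib c r r0 cr; split; last first.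
  by move=> t rt; rewrite (ccs_slice0 cr rt) Irv0.
move=> t0; apply/cvgrPdist_le => e e0.
(* Adding 1 keeps C positive when the ball is degenerate. *)
pose C := (r *+ 2) ^+ d + 1.
have C0 : 0 < C by rewrite ltr_wpDl// exprn_ge0// mulrn_wge0.
have := @near_uniform R 'rV[R]_d _ (fun t y => c (slice t y)) t0
  (@compact_ball_rV d r) _ (e / C) (divr_gt0 e0 C0).
have H : forall y : 'rV[R]_d, `|y| <= r ->
    {for (t0, y), continuous (fun z : R * 'rV[R]_d => c (slice z.1 z.2))}.
  move=> y _; apply: (continuous_comp (f := fun z : R * 'rV[R]_d => slice z.1 z.2)).
    exact: (@slice_continuous d (t0, y)).
  by case: cr => + _; exact.
move=> /(_ H) near_; near=> t.
have nt : forall y : 'rV[R]_d, `|y| <= r ->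
    `|c (slice t y) - c (slice t0 y)| < e / C by near: t.
have st := ccs_slice t cr; have st0 := ccs_slice t0 cr.
rewrite -mulN1r -(Il _ _ _ _ st0 st).
apply: (@le_trans _ _ (e / C * (r *+ 2) ^+ d)).
  apply: Ib => //; first by apply: ccsD => //; exact: ccsZ.
  move=> y; rewrite mulN1r distrC.
  have [yr|ry] := leP `|y| r; first by rewrite ltW// nt.
  by rewrite (proj2 st)// (proj2 st0)// subrr normr0 divr_ge0// ltW.
rewrite -mulrA ger_pMr// ler_pdivrMl// mulr1 /C lerDl//.
Unshelve. all: by end_near. Qed.

(** The two properties need a joint induction: in dimension d + 1 the outer integrand must be
    continuous, and the difference of two slice integrals is controlled by linearity together with
    the bound in dimension d. *)
Lemma Irv_lin_bnd d : Irv_lin d /\ Irv_bnd d.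
Proof.
elim: d => [|d [Il Ib]].
  split=> [c c' r a _ _ //|c r M r0 _ cM /=].
  by rewrite expr0 mulr1.
have sl := Irv_slice_subproof Il Ib.
split.
  move=> c c' r a cr cr' /=.
  (* A negative radius forces both functions to vanish identically. *)
  have [r0|r0] := leP 0 r; last first.
    have z (b : 'rV[R]_d.+1 -> R) t : ccs b r -> Irv (fun y => b (slice t y)) = 0.
      by move=> br; rewrite (ccs_slice0 br) ?Irv0// (lt_le_trans r0).
    have cs : ccs (fun x => c x + a * c' x) r by apply: ccsD => //; exact: ccsZ.
    under eq_Rintegral do rewrite (z _ _ cs).
    under [X in _ = X + _]eq_Rintegral do rewrite (z _ _ cr).
    under [X in _ = _ + _ * X]eq_Rintegral do rewrite (z _ _ cr').
    by rewrite !Rintegral_cst// !mul0r mulr0 addr0.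
  have [c1 s1] := sl _ _ r0 cr; have [c2 s2] := sl _ _ r0 cr'.
  have i1 := integrable_supported c1 s1; have i2 := integrable_supported c2 s2.
  under eq_Rintegral do rewrite (Il _ _ r a (ccs_slice _ cr) (ccs_slice _ cr')).
  rewrite RintegralD//; last first.
    apply: (@integrable_supported _ _ r).
      by move=> t; apply: cvgM; [exact: cvg_cst|exact: c2].
    by move=> t rt; rewrite (s2 _ rt) mulr0.
  by rewrite RintegralZl.
move=> c r M r0 cr cM /=.
have [c1 s1] := sl _ _ r0 cr.
rewrite exprSr mulrA; apply: Rintegral_supported_bound => // t.
by apply: Ib => //; exact: ccs_slice.
Qed.

Lemma ccs_le d (c : 'rV[R]_d -> R) r r' : r <= r' -> ccs c r -> ccs c r'.
Proof.
by move=> rr [cc sc]; split=> // x rx; apply: sc; exact: le_lt_trans rx.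
Qed.

Lemma ccs_max0 d (c : 'rV[R]_d -> R) r :
  ccs c r -> ccs (fun x => Num.max (c x) 0) r.
Proof.
move=> [cc sc]; split; first exact: continuous_funmax0.
by move=> x rx; rewrite sc// maxxx.
Qed.

Lemma ccsN d (c : 'rV[R]_d -> R) r : ccs c r -> ccs (fun x => - c x) r.
Proof.
move=> cr; rewrite (_ : (fun x => _) = (fun x => -1 * c x)); first exact: ccsZ.
by apply/funext => x; rewrite mulN1r.
Qed.

Lemma IrvDZ d (c c' : 'rV[R]_d -> R) r a : ccs c r -> ccs c' r ->
  Irv (fun x => c x + a * c' x) = Irv c + a * Irv c'.
Proof. by case: (Irv_lin_bnd d) => Il _; exact: Il. Qed.

Lemma IrvD d (c c' : 'rV[R]_d -> R) r : ccs c r -> ccs c' r ->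
  Irv (fun x => c x + c' x) = Irv c + Irv c'.
Proof.
move=> cr cr'; rewrite -[X in _ + X]mul1r -(IrvDZ 1 cr cr').
by congr Irv; apply/funext => x; rewrite mul1r.
Qed.

Lemma IrvB d (c c' : 'rV[R]_d -> R) r : ccs c r -> ccs c' r ->
  Irv (fun x => c x - c' x) = Irv c - Irv c'.
Proof.
move=> cr cr'; rewrite -[X in _ - X]mul1r -mulNr -(IrvDZ (-1) cr cr').
by congr Irv; apply/funext => x; rewrite mulN1r.
Qed.

Lemma IrvZ d (c : 'rV[R]_d -> R) r a : ccs c r ->
  Irv (fun x => a * c x) = a * Irv c.
Proof.
move=> cr; have z : ccs (fun _ : 'rV[R]_d => 0) r.
  by split=> //; exact: cst_continuous.
rewrite -[RHS]add0r -(Irv0 d) -(IrvDZ a z cr).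
by congr Irv; apply/funext => x; rewrite add0r.
Qed.

Lemma ccs_sum d (I : Type) (s : seq I) (c : I -> 'rV[R]_d -> R) r :
  (forall i, ccs (c i) r) -> ccs (fun x => \sum_(i <- s) c i x) r.
Proof.
move=> cr; elim: s => [|i s IH].
  rewrite (_ : (fun x => _) = fun=> 0); last by apply/funext => x; rewrite big_nil.
  by split=> //; exact: cst_continuous.
rewrite (_ : (fun x => _) = fun x => c i x + \sum_(j <- s) c j x).
  exact: ccsD.
by apply/funext => x; rewrite big_cons.
Qed.

Lemma Irv_sum d (I : Type) (s : seq I) (c : I -> 'rV[R]_d -> R) r :
  (forall i, ccs (c i) r) ->
  Irv (fun x => \sum_(i <- s) c i x) = \sum_(i <- s) Irv (c i).
Proof.
move=> cr; elim: s => [|i s IH].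
  rewrite big_nil -[RHS](Irv0 d).
  by congr Irv; apply/funext => x; rewrite big_nil.
rewrite big_cons -IH -(IrvD (cr i) (ccs_sum s cr)).
by congr Irv; apply/funext => x; rewrite big_cons.
Qed.

Lemma Irv_bound d (c : 'rV[R]_d -> R) r M : 0 <= r -> ccs c r ->
  (forall x, `|c x| <= M) -> `|Irv c| <= M * (r *+ 2) ^+ d.
Proof. by case: (Irv_lin_bnd d) => _ Ib; exact: Ib. Qed.

Lemma Irv_slice d (c : 'rV[R]_d.+1 -> R) r : 0 <= r -> ccs c r ->
  continuous (fun t => Irv (fun y => c (slice t y))) /\
  supported_in (V:=R^o) r (fun t => Irv (fun y => c (slice t y))).
Proof. by case: (Irv_lin_bnd d) => Il Ib; exact: Irv_slice_subproof. Qed.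

Lemma Irv_ge0 d (c : 'rV[R]_d -> R) : (forall x, 0 <= c x) -> 0 <= Irv c.
Proof.
elim: d c => [|d IH] c c0 /=; first exact: c0.
by apply: Rintegral_ge0 => t _; apply: IH.
Qed.

Lemma Irv_le d (c c' : 'rV[R]_d -> R) r : ccs c r -> ccs c' r ->
  (forall x, c x <= c' x) -> Irv c <= Irv c'.
Proof.
move=> cr cr' cc'; rewrite -subr_ge0 -(IrvB cr' cr).
by apply: Irv_ge0 => x; rewrite subr_ge0.
Qed.

Lemma Irv_gt0 d (c : 'rV[R]_d -> R) r p : 0 <= r -> ccs c r ->
  (forall x, 0 <= c x) -> 0 < c p -> 0 < Irv c.
Proof.
move=> r0; elim: d c p => [|d IH] c p cr c0 cp /=.
  by move: cp; rewrite (thinmx0 p).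
have [cs ss] := Irv_slice r0 cr.
apply: (Rintegral_gt0 (p := (p : 'rV_(1 + d)) 0 0) cs ss).
  by move=> t; apply: Irv_ge0.
apply: (IH _ (rsubmx (p : 'rV_(1 + d)))) => //; first exact: ccs_slice.
by rewrite -slice_split.
Qed.

Lemma Irv_shift d (c : 'rV[R]_d -> R) r v : ccs c r ->
  Irv (fun x => c (x + v)) = Irv c.
Proof.
wlog r0 : r / 0 <= r => [H cr|].
  by apply: (H (Num.max r 0)); rewrite ?le_max ?lexx ?orbT//;
    apply: ccs_le cr; rewrite le_max lexx.
elim: d c v => [|d IH] c v cr /=.
  by rewrite [_ + _]thinmx0.
have [cs ss] := Irv_slice r0 cr.
rewrite -(Rintegral_shift ((v : 'rV_(1 + d)) 0 0) cs ss).
apply: eq_Rintegral => t _.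
rewrite -(IH _ (rsubmx (v : 'rV_(1 + d))) (ccs_slice _ cr)).
by congr Irv; apply/funext => y; rewrite [in LHS](slice_split v) sliceD.
Qed.

Lemma ccs_shift d (c : 'rV[R]_d -> R) r v : ccs c r ->
  ccs (fun x => c (x + v)) (r + `|v|).
Proof.
move=> [cc sc]; split.
  move=> x; apply: (@continuous_comp 'rV[R]_d 'rV[R]_d R (fun x => x + v) c); last exact: cc.
  exact: (cvgD (@cvg_id _ (nbhs x)) (cvg_cst v)).
move=> x hx; apply: sc; have := ler_normB (x + v) v.
by rewrite addrK; lra.
Qed.

Lemma ccs_derive d (c : 'rV[R]_d -> R^o) r v : ccs c r ->
  continuous ('D_v c) -> ccs ('D_v c) r.
Proof.
move=> [cc sc] cD; split=> // x rx.
rewrite (@near_eq_derive _ _ _ _ (cst 0)) ?derive_cst//.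
near=> y; apply: sc; near: y.
have : open [set y : 'rV[R]_d | r < `|y|].
  rewrite (_ : [set _ | _] = Num.norm @^-1` [set x | r < x])//.
  by apply: open_comp => [z _|]; [exact: norm_continuous|exact: open_gt].
by move=> o; exact: (open_nbhs_nbhs (conj o rx)).
Unshelve. all: by end_near. Qed.

Lemma line_MVT (V : normedModType R) (c : V -> R^o) x v h :
  (forall s : R, `|s| <= `|h| -> differentiable c (x + s *: v)) ->
  exists2 s : R, `|s| <= `|h| & c (x + h *: v) - c x = h * 'D_v c (x + s *: v).
Proof.
move=> dc.
pose u (s : R) := c (x + s *: v) : R.
have du (s : R) : `|s| <= `|h| -> is_derive s 1 u ('D_v c (x + s *: v)).
  move=> sh.
  have dl : is_diff (s : R^o) (fun s : R^o => x + s *: v)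
      (fun s : R^o => s *: v).
    have := is_diffD (is_diff_cst x (s : R^o)) (is_diff_scalel (s : R^o) v).
    by move=> /is_diff_eq; apply; rewrite add0r.
  have dl' : differentiable (fun s : R^o => x + s *: v) s by exact: ex_diff.
  have duc : differentiable (c \o (fun s : R^o => x + s *: v)) s.
    by apply: differentiable_comp => //; exact: dc.
  split; first exact/derivable1_diffP.
  rewrite [LHS](deriveE _ duc) diff_comp//=; last exact: dc.
  rewrite deriveE; last exact: dc.
  by congr ('d c _ _); rewrite diff_val scale1r.
have cs (a b : R) : (forall s, a <= s <= b -> `|s| <= `|h|) ->
    {within `[a, b], continuous u}.
  move=> ab; apply: continuous_in_subspaceT => s; rewrite inE /= in_itv /=.
  move=> /ab /du dus.
  by apply/differentiable_continuous/derivable1_diffP.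
have [h0|h0|->] := ltgtP h 0; last first.
- by exists 0; rewrite ?normr0// scale0r addr0 subrr mul0r.
- have H s : 0 <= s <= h -> `|s| <= `|h|.
    by move=> /andP[s0 sh]; rewrite !ger0_norm// ltW.
  have du' s : s \in `]0, h[%R -> is_derive s 1 u ('D_v c (x + s *: v)).
    by rewrite in_itv /= => /andP[s0 sh]; apply: du; apply: H; rewrite !ltW.
  have [s] := MVT h0 du' (cs _ _ H).
  rewrite in_itv /= => /andP[s0 sh]; rewrite /u scale0r addr0 subr0 => ->.
  by exists s; [apply: H; rewrite !ltW|rewrite mulrC].
- have H s : h <= s <= 0 -> `|s| <= `|h|.
    by move=> /andP[s0 sh]; rewrite !ler0_norm ?lerN2// ltW.
  have du' s : s \in `]h, 0[%R -> is_derive s 1 u ('D_v c (x + s *: v)).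
    by rewrite in_itv /= => /andP[s0 sh]; apply: du; apply: H; rewrite !ltW.
  have [s] := MVT h0 du' (cs _ _ H).
  rewrite in_itv /= => /andP[s0 sh]; rewrite /u scale0r addr0 => E.
  exists s; first by apply: H; rewrite !ltW.
  by move: E; lra.
Qed.

(** By translation invariance every difference quotient along v has integral 0, and by the mean
    value theorem the quotients converge to the derivative uniformly on a fixed ball. This is the
    divergence theorem used for the first variation. *)
Lemma Irv_derive d (c : 'rV[R]_d -> R^o) r v : ccs c r ->
  (forall x, differentiable c x) -> continuous ('D_v c) -> Irv ('D_v c) = 0.
Proof.
wlog r0 : r / 0 <= r => [H cr|cr dc cD].
  by apply: (H (Num.max r 0)); rewrite ?le_max ?lexx ?orbT//;
    apply: ccs_le cr; rewrite le_max lexx.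
have sD := ccs_derive cr cD.
pose r' := r + `|v|.
have rr' : r <= r' by rewrite lerDl.
have r'0 : 0 <= r' by exact: le_trans rr'.
pose C := (r' *+ 2) ^+ d + 1.
have C0 : 0 < C by rewrite ltr_wpDl// exprn_ge0// mulrn_wge0.
suff H e : 0 < e -> `|Irv ('D_v c)| <= e.
  apply/eqP; rewrite -normr_le0; apply/ler_addgt0Pr => e e0.
  by rewrite add0r; exact: H.
move=> e0.
have U : \forall s \near (0 : R), forall x : 'rV[R]_d, `|x| <= r' ->
    `|'D_v c (x + s *: v) - 'D_v c (x + 0 *: v)| < e / C.
  apply: (@near_uniform R 'rV[R]_d _ (fun s x => 'D_v c (x + s *: v)) 0
    (@compact_ball_rV d r')); last exact: divr_gt0.
  move=> x _; apply: (@continuous_comp (R * 'rV[R]_d)%type 'rV[R]_d R (fun z => z.2 + z.1 *: v) ('D_v c)); last exact: cD.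
  by apply: cvgD; [exact: cvg_snd|apply: cvgZr_tmp; exact: cvg_fst].
have [dl /= dl0 Hdl] := (nbhs_ballP _ _).1 U.
(* The bound 1 keeps the support of the translate inside the ball of radius [r']; dl / 2 puts h
   within reach of the uniform estimate. *)
pose h := Num.min (dl / 2) 1.
have h0 : 0 < h by rewrite lt_min ltr01 divr_gt0.
have h1 : h <= 1 by rewrite ge_min lexx orbT.
have hdl : h < dl by rewrite gt_min ltr_pdivrMr//; apply/orP; left; lra.
have cs : ccs (fun x => c (x + h *: v)) r'.
  apply: ccs_le (ccs_shift _ cr); rewrite lerD2l normrZ gtr0_norm//.
  by rewrite ler_piMl.
have cr' := ccs_le rr' cr; have sD' := ccs_le rr' sD.
have E : Irv ('D_v c) = Irv (fun x => 'D_v c x +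
    (- h^-1) * (c (x + h *: v) - c x)).
  rewrite (IrvDZ _ sD'); last first.
    by apply: ccsD => //; exact: ccsN.
  by rewrite (IrvB cs cr') (Irv_shift _ cr) subrr mulr0 addr0.
rewrite E; apply: (@le_trans _ _ (e / C * (r' *+ 2) ^+ d)).
  apply: Irv_bound => //.
    by apply: ccsD => //; apply: ccsZ; apply: ccsD => //; exact: ccsN.
  move=> x; have [xr|rx] := leP `|x| r'; last first.
    by rewrite (proj2 sD')// (proj2 cs)// (proj2 cr')// subrr mulr0 addr0 normr0 divr_ge0// ltW.
  have [s sh ->] := @line_MVT _ c x v h (fun s _ => dc _).
  rewrite mulNr mulrA mulVf ?gt_eqF// mul1r distrC.
  rewrite -[X in _ - 'D_v c X]addr0 -(scale0r v); apply: ltW.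
  apply: (Hdl s _ x xr); rewrite /= /ball /= sub0r normrN.
  by rewrite (le_lt_trans sh)// gtr0_norm.
by rewrite -mulrA ger_pMr// ler_pdivrMl// mulr1 /C lerDl.
Qed.

Lemma integral_rV_Irv d (c : 'rV[R]_d -> R) r : ccs c r ->
  integral_rV (fun x => (c x)%:E) = (Irv c)%:E.
Proof.
wlog r0 : r / 0 <= r => [H cr|].
  by apply: (H (Num.max r 0)); rewrite ?le_max ?lexx ?orbT//;
    apply: ccs_le cr; rewrite le_max lexx.
elim: d c => [//|d IH] c cr /=.
under eq_integral do rewrite (IH _ (ccs_slice _ cr)).
have [cs ss] := Irv_slice r0 cr.
by rewrite fineK//; apply: integrable_fin_num => //; exact: integrable_supported ss.
Qed.

Lemma integral_rV_ge0 d (f : 'rV[R]_d -> \bar R) :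
  (forall x, 0 <= f x)%E -> (0 <= integral_rV f)%E.
Proof.
elim: d f => [|d IH] f f0 /=; first exact: f0.
by apply: integral_ge0 => t _; apply: IH.
Qed.

Lemma integral_rV_addr d (f : 'rV[R]_d -> \bar R) (c : 'rV[R]_d -> R) r :
  (forall x, 0 <= f x)%E -> (forall x, 0 <= c x) -> ccs c r ->
  (integral_rV (fun x => f x + (c x)%:E) = integral_rV f + (Irv c)%:E)%E.
Proof.
wlog r0 : r / 0 <= r => [H f0 c0 cr|].
  by apply: (H (Num.max r 0)) => //; rewrite ?le_max ?lexx ?orbT//;
    apply: ccs_le cr; rewrite le_max lexx.
elim: d f c => [//|d IH] f c f0 c0 cr.
rewrite -(integral_rV_Irv cr) /=.
under eq_integral do rewrite (IH _ _ _ _ (ccs_slice _ cr))//.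
under [X in _ = _ + X]eq_integral do rewrite (integral_rV_Irv (ccs_slice _ cr)).
have [cs ss] := Irv_slice r0 cr.
apply: ge0_integralDr.
- by move=> t; exact: integral_rV_ge0.
- by move=> t; apply: Irv_ge0.
- exact: integrable_supported ss.
Qed.

(** Both integrals may be infinite, so they are never subtracted: the positive part of g - f is
    added to f and the negative part to g, which gives one function, and the finite terms are then
    moved across. *)
Lemma integral_rV_perturb d (f g : 'rV[R]_d -> R) r : (forall x, 0 <= f x) ->
  (forall x, 0 <= g x) -> ccs (fun x => g x - f x) r ->
  (integral_rV (EFin \o g) =
   integral_rV (EFin \o f) + (Irv (fun x => g x - f x))%:E)%E.
Proof.
move=> f0 g0 cr; set c := (fun x => g x - f x) in cr *.
pose cp x := Num.max (c x) 0; pose cn x := Num.max (- c x) 0.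
have sp : ccs cp r by exact: ccs_max0.
have sn : ccs cn r by apply: ccs_max0; exact: ccsN.
have p0 x : 0 <= cp x by rewrite le_max lexx orbT.
have n0 x : 0 <= cn x by rewrite le_max lexx orbT.
have cE x : c x = cp x - cn x.
  by rewrite /cp /cn; have [H|H] := leP (c x) 0; case: (leP (- c x)); lra.
have E : (integral_rV (EFin \o g) + (Irv cn)%:E =
          integral_rV (EFin \o f) + (Irv cp)%:E)%E.
  rewrite -(integral_rV_addr _ n0 sn); last by move=> x; rewrite lee_fin.
  rewrite -(integral_rV_addr _ p0 sp); last by move=> x; rewrite lee_fin.
  congr integral_rV; apply/funext => x /=; congr (_%:E).
  by have := cE x; rewrite /c; lra.
have -> : Irv c = Irv cp - Irv cn.
  by rewrite -(IrvB sp sn); congr Irv; apply/funext => x; exact: cE.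
by rewrite EFinB addeA -E addeK.
Qed.

End IntegrationRV.

(** * Indefinite quadratic forms *)

Section MatrixLimits.
Context {R : realType} {T : Type} {F : set_system T} {FF : Filter F}.

Lemma cvg_mxP m n (f : T -> 'M[R]_(m, n)) (A : 'M[R]_(m, n)) :
  f @ F --> A <-> forall i j, f x i j @[x --> F] --> A i j.
Proof.
split=> [fA i j|fA].
  have := @coord_continuous R m n i j A.
  by move=> /(cvg_comp _ _ fA).
apply/cvgrPdist_le => e e0; near=> x.
rewrite [leLHS]mx_normrE; apply: bigmax_le; first exact: ltW.
move=> [i j] _ /=; rewrite !mxE.
move: i j; near: x; apply: filter_forall => i; apply: filter_forall => j.
by have /cvgrPdist_le /(_ e e0) := fA i j.
Unshelve. all: by end_near. Qed.

Lemma cvg_mulmx m n p (f : T -> 'M[R]_(m, n)) (g : T -> 'M[R]_(n, p)) (A : 'M[R]_(m, n)) (B : 'M[R]_(n, p)) :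
  f @ F --> A -> g @ F --> B -> f x *m g x @[x --> F] --> A *m B.
Proof.
move=> /cvg_mxP fA /cvg_mxP gB; apply/cvg_mxP => i j.
rewrite mxE (_ : (fun x => _) = (fun x => \sum_k f x i k * g x k j)).
  apply: cvg_big => [|k _]; first exact: add_continuous.
  exact: (cvgM (fA i k) (gB k j)).
by apply/funext => x; rewrite mxE.
Qed.

Lemma cvg_trmx m n (f : T -> 'M[R]_(m, n)) (A : 'M[R]_(m, n)) :
  f @ F --> A -> (f x)^T @[x --> F] --> A^T.
Proof.
move=> /cvg_mxP fA; apply/cvg_mxP => i j; rewrite mxE.
by rewrite (_ : (fun x => _) = (fun x => f x j i))//; apply/funext => x; rewrite mxE.
Qed.

Lemma cvg_det m (f : T -> 'M[R]_m) (A : 'M[R]_m) : f @ F --> A -> \det (f x) @[x --> F] --> \det A.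
Proof.
move=> /cvg_mxP fA; apply: cvg_big => [|s _]; first exact: add_continuous.
apply: cvgM; first exact: cvg_cst.
by apply: cvg_big => [|i _]; [exact: mul_continuous|exact: fA].
Qed.

Lemma cvg_invmx m (f : T -> 'M[R]_m) (A : 'M[R]_m) : A \in unitmx -> f @ F --> A ->
  invmx (f x) @[x --> F] --> invmx A.
Proof.
move=> AU fA.
have dA : \det A != 0 by rewrite -unitfE -unitmxE.
have d := cvg_det fA.
have near_ : \forall x \near F, \det (f x) != 0 by exact: (cvgr_neq0 _ d).
have adjA : \adj (f x) @[x --> F] --> \adj A.
  apply/cvg_mxP => i j; rewrite mxE.
  rewrite (_ : (fun x => _) = (fun x => cofactor (f x) j i)); last first.
    by apply/funext => x; rewrite mxE.
  rewrite /cofactor; apply: cvgM; first exact: cvg_cst.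
  have /cvg_mxP fA' := fA.
  apply: cvg_det; apply/cvg_mxP => a b; rewrite !mxE.
  rewrite (_ : (fun x => _) = (fun x => f x (lift j a) (lift i b)))//.
  by apply/funext => x; rewrite !mxE.
have H : (\det (f x))^-1 *: \adj (f x) @[x --> F] --> (\det A)^-1 *: \adj A.
  by apply: cvgZ => //; exact: cvgV.
rewrite /invmx AU.
apply: cvg_trans H; apply: near_eq_cvg; near=> x.
have fx : \det (f x) != 0 by near: x.
by rewrite unitmxE unitfE fx.
Unshelve. all: by end_near. Qed.

End MatrixLimits.

(** * Bilinear forms and the determinant of a perturbed metric *)

Section LinearAlgebra.
Context {R : realType}.

Definition qf m (g : 'M[R]_m) (v w : 'rV[R]_m) : R := (v *m g *m w^T) 0 0.

Lemma qfDl m (g : 'M[R]_m) v v' w : qf g (v + v') w = qf g v w + qf g v' w.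
Proof. by rewrite /qf !mulmxDl mxE. Qed.

Lemma qfDr m (g : 'M[R]_m) v w w' : qf g v (w + w') = qf g v w + qf g v w'.
Proof. by rewrite /qf raddfD mulmxDr mxE. Qed.

Lemma qfZl m (g : 'M[R]_m) a v w : qf g (a *: v) w = a * qf g v w.
Proof. by rewrite /qf -!scalemxAl mxE. Qed.

Lemma qfZr m (g : 'M[R]_m) a v w : qf g v (a *: w) = a * qf g v w.
Proof. by rewrite /qf linearZ -scalemxAr mxE. Qed.

Lemma qfNm m (g : 'M[R]_m) v w : qf (- g) v w = - qf g v w.
Proof. by rewrite /qf mulmxN mulNmx mxE. Qed.

Lemma qf0l m (g : 'M[R]_m) w : qf g 0 w = 0.
Proof. by rewrite /qf !mul0mx mxE. Qed.

Lemma qf_sym m (g : 'M[R]_m) v w : g^T = g -> qf g v w = qf g w v.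
Proof.
move=> gT; rewrite /qf (_ : v *m g *m w^T = (w *m g *m v^T)^T) ?mxE//.
by rewrite !trmx_mul trmxK gT mulmxA.
Qed.

Lemma qf_unit0 m (g : 'M[R]_m) v : g \in unitmx -> (forall w, qf g v w = 0) -> v = 0.
Proof.
move=> gU H; suff vg : v *m g = 0 by rewrite -[v](mulmxK gU) vg mul0mx.
apply/rowP => j; have := H (delta_mx 0 j).
by rewrite /qf trmx_delta -colE !mxE.
Qed.

Lemma det_mx22 (M : 'M[R]_2) :
  \det M = M 0 0 * M 1 1 - M 0 1 * M 1 0.
Proof.
rewrite (expand_det_row _ 0) !big_ord_recl big_ord0 addr0 /cofactor !det_mx11.
rewrite !mxE /= expr0 expr1 mul1r mulN1r mulrN.
by congr (M _ _ * M _ _ - M _ _ * M _ _); exact: val_inj.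
Qed.

Lemma det_block11 (A B C D : 'M[R]_1) :
  \det (block_mx A B C D) = A 0 0 * D 0 0 - B 0 0 * C 0 0.
Proof.
have E0 : 0 = lshift 1 (0 : 'I_1) :> 'I_(1 + 1) by exact: val_inj.
have E1 : 1 = rshift 1 (0 : 'I_1) :> 'I_(1 + 1) by exact: val_inj.
rewrite det_mx22 -[in RHS](block_mxEul A B C D) -[in RHS](block_mxEdr A B C D).
by rewrite -[in RHS](block_mxEur A B C D) -[in RHS](block_mxEdl A B C D) -E0 -E1.
Qed.

(** The Weinstein-Aronszajn identity: one block matrix factors in two ways into block triangular
    matrices. *)
Lemma det_1pmulmx m n (A : 'M[R]_(m, n)) (B : 'M[R]_(n, m)) :
  \det (1%:M + A *m B) = \det (1%:M + B *m A).
Proof.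
have E1 : block_mx 1%:M A (- B) 1%:M =
    block_mx 1%:M 0 (- B) 1%:M *m block_mx 1%:M A 0 (1%:M + B *m A).
  rewrite mulmx_block !(mul1mx, mul0mx, mulmx0, mulmx1, addr0, mulNmx).
  by rewrite addrC addrK.
have E2 : block_mx 1%:M A (- B) 1%:M =
    block_mx (1%:M + A *m B) A 0 1%:M *m block_mx 1%:M 0 (- B) 1%:M.
  rewrite mulmx_block !(mul1mx, mul0mx, mulmx0, mulmx1, add0r, mulmxN).
  by rewrite addrK.
have := congr1 determinant E1; rewrite {1}E2 !det_mulmx det_ublock !det_lblock det_ublock.
by rewrite !det1 !mulr1 !mul1r.
Qed.

(** The perturbation factors as U V through dimension two, so [det_1pmulmx] leaves a two by two
    determinant in the values of the inverse form at p and w. *)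
Lemma det_metric_perturb m (g : 'M[R]_m) (p w : 'rV[R]_m) (t a : R) :
  g \in unitmx -> g^T = g ->
  \det (g + t *: (p^T *m w + w^T *m p) + (t ^+ 2 * a) *: (p^T *m p)) =
  \det g * ((1 + t * qf (invmx g) p w) ^+ 2 +
    t ^+ 2 * (qf (invmx g) p p * (a - qf (invmx g) w w))).
Proof.
move=> gU gT; set gi := invmx g.
pose U : 'M[R]_(m, 1 + 1) := row_mx (t *: p^T) (w^T + (t * a) *: p^T).
pose V : 'M[R]_(1 + 1, m) := col_mx w (t *: p).
have -> : g + t *: (p^T *m w + w^T *m p) + (t ^+ 2 * a) *: (p^T *m p) =
    g *m (1%:M + (gi *m U) *m V).
  rewrite mulmxDr mulmx1 -mulmxA mulKVmx// /U /V mul_row_col.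
  rewrite -scalemxAl -scalemxAr mulmxDl -scalemxAl -addrA; congr (g + _).
  rewrite scalerDr -addrA; congr (_ + _); rewrite scalerDr scalerA; congr (_ + _ *: _).
  by rewrite mulrA -expr2.
rewrite det_mulmx det_1pmulmx; congr (_ * _).
have giT : gi^T = gi by rewrite /gi trmx_inv gT.
have VgU : V *m (gi *m U) = block_mx (t *: (p *m gi *m w^T))
    (w *m gi *m w^T + (t * a) *: (p *m gi *m w^T)) (t ^+ 2 *: (p *m gi *m p^T))
    (t *: (p *m gi *m w^T) + (t ^+ 2 * a) *: (p *m gi *m p^T)).
  have wp : w *m gi *m p^T = p *m gi *m w^T.
    by apply/matrixP => i j; rewrite !ord1; exact: (qf_sym w p giT).
  rewrite /V /U mul_mx_row mul_col_row.
  rewrite !mulmxDr -!scalemxAr -!scalemxAl !mulmxA wp.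
  by rewrite !scalerA -!expr2 mulrAC -expr2.
rewrite {}VgU scalar_mx_block add_block_mx det_block11 !add0r.
have mxD (X Y : 'M[R]_1) : (X + Y) 0 0 = X 0 0 + Y 0 0 by rewrite mxE.
have mxZ b (X : 'M[R]_1) : (b *: X) 0 0 = b * X 0 0 by rewrite mxE.
have mx1 : (1%:M : 'M[R]_1) 0 0 = 1 by rewrite mxE.
rewrite !mxD !mxZ mx1 -/(qf gi p w) -/(qf gi p p) -/(qf gi w w).
by ring.
Qed.

End LinearAlgebra.

(** * Index and complementary definite subspaces *)

Section Index.
Context {R : realType}.

Lemma negdef_on_le0 m (g : 'M[R]_m) r (B : 'M[R]_(r, m)) v :
  negdef_on g B -> qf g (v *m B) (v *m B) <= 0.
Proof.
move=> nB; have [->|v0] := eqVneq v 0; first by rewrite mul0mx qf0l.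
by apply: ltW; exact: nB.
Qed.

Lemma negdef_on_eq0 m (g : 'M[R]_m) r (B : 'M[R]_(r, m)) v :
  negdef_on g B -> 0 <= qf g (v *m B) (v *m B) -> v = 0.
Proof.
by move=> nB; have [//|v0] := eqVneq v 0; rewrite leNgt (nB _ v0).
Qed.

(** [negdef_on (- g) C] says that g is positive definite on the span of C. A vector in both spans
    has a value that is both nonpositive and nonnegative, hence it is 0. *)
Lemma col_mx_free m (g : 'M[R]_m) r s (B : 'M[R]_(r, m)) (C : 'M[R]_(s, m)) :
  negdef_on g B -> negdef_on (- g) C -> row_free (col_mx B C).
Proof.
move=> nB pC; apply/inj_row_free => v; rewrite -[v]hsubmxK mul_row_col.
set a := lsubmx v; set b := rsubmx v => E.
have {}E : a *m B = - (b *m C) by apply/eqP; rewrite -addr_eq0 E.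
have q : qf g (a *m B) (a *m B) = qf g (b *m C) (b *m C).
  by rewrite E -scaleN1r qfZl qfZr mulrA mulrNN !mul1r.
have a0 : a = 0.
  apply: (negdef_on_eq0 nB); rewrite q -[leRHS]opprK -qfNm oppr_ge0.
  exact: negdef_on_le0.
have b0 : b = 0.
  apply: (negdef_on_eq0 pC); rewrite qfNm -q oppr_ge0.
  exact: negdef_on_le0.
by rewrite a0 b0 row_mx0.
Qed.

Lemma negdef_bound m (g : 'M[R]_m) r s (B : 'M[R]_(r, m)) (C : 'M[R]_(s, m)) :
  negdef_on g B -> negdef_on (- g) C -> (r + s <= m)%N.
Proof.
by move=> nB pC; rewrite -(eqP (col_mx_free nB pC)) rank_leq_col.
Qed.

(** A definite pair of full total dimension certifies the index, since C bounds every negative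
    definite subspace. Unlike maximality, the two definiteness conditions are open in g. *)
Lemma split_index m k l (g : 'M[R]_m) (B : 'M[R]_(k, m)) (C : 'M[R]_(l, m)) :
  (k + l)%N = m -> negdef_on g B -> negdef_on (- g) C -> has_index g k.
Proof.
move=> klm nB pC; split; first by exists B.
by move=> r D nD; rewrite -(leq_add2r l) klm; exact: negdef_bound nD pC.
Qed.

Lemma split_full m k l (g : 'M[R]_m) (B : 'M[R]_(k, m)) (C : 'M[R]_(l, m)) (v : 'rV[R]_m) :
  (k + l)%N = m -> negdef_on g B -> negdef_on (- g) C ->
  exists a b, v = a *m B + b *m C.
Proof.
move=> klm nB pC.
have full : row_full (col_mx B C).
  by rewrite /row_full (eqP (col_mx_free nB pC)) klm.
have /submxP[w ->] := submx_full v full.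
by exists (lsubmx w), (rsubmx w); rewrite -{1}[w]hsubmxK mul_row_col.
Qed.

(** Pair a kernel vector a B + b C with each of its two components: by symmetry the cross terms
    agree, so the nonpositive value at a B equals the nonnegative value at b C, and both vanish. *)
Lemma split_unit m k l (g : 'M[R]_m) (B : 'M[R]_(k, m)) (C : 'M[R]_(l, m)) :
  (k + l)%N = m -> g^T = g -> negdef_on g B -> negdef_on (- g) C ->
  g \in unitmx.
Proof.
move=> klm gT nB pC; rewrite -row_free_unit; apply/inj_row_free => v vg.
have q0 w : qf g v w = 0 by rewrite /qf vg mul0mx mxE.
have [a [b vE]] := split_full v klm nB pC.
have := q0 (a *m B); have := q0 (b *m C).
rewrite vE !qfDl (qf_sym (b *m C) (a *m B) gT) => E1 E2.
have a0 : a = 0.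
  apply: (negdef_on_eq0 nB).
  have := negdef_on_le0 b pC; rewrite qfNm; lra.
have b0 : b = 0.
  apply: (negdef_on_eq0 pC); rewrite qfNm.
  have := negdef_on_le0 a nB; lra.
by rewrite a0 b0 !mul0mx addr0.
Qed.

(* C spans the g-orthogonal complement of a maximal negative definite subspace. *)
Lemma index_split m k (g : 'M[R]_m) : g \in unitmx -> g^T = g -> has_index g k ->
  exists (B : 'M[R]_(k, m)) l (C : 'M[R]_(l, m)),
    [/\ (k + l)%N = m, negdef_on g B & negdef_on (- g) C].
Proof.
move=> gU gT [[B nB] kmax].
have Bfree : row_free B.
  apply/inj_row_free => v vB; apply: (negdef_on_eq0 nB).
  by rewrite vB qf0l.
pose K := kermx (g *m B^T).
have orth v w : (v <= K)%MS -> qf g v (w *m B) = 0.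
  move=> /sub_kermxP H; rewrite /qf trmx_mul mulmxA -[v *m g *m _]mulmxA H.
  by rewrite mul0mx mxE.
(* A vector of K with negative value would extend B by one dimension, against the maximality of
   k. *)
have ge0 v : (v <= K)%MS -> 0 <= qf g v v.
  move=> vK; rewrite leNgt; apply/negP => v0.
  suff nD : negdef_on g (col_mx B v).
    by have := kmax _ _ nD; rewrite addn1 ltnn.
  move=> w w0; rewrite -[w]hsubmxK mul_row_col.
  set a := lsubmx w; set b := rsubmx w.
  have -> : b *m v = b 0 0 *: v.
    by rewrite {1}[b]mx11_scalar mul_scalar_mx.
  rewrite -/(qf _ _ _) qfDl !qfDr !qfZl !qfZr (qf_sym _ v gT) (orth _ _ vK).
  rewrite !mulr0 addr0 add0r.
  have aB := negdef_on_le0 a nB.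
  have [b0|b0] := eqVneq (b 0 0) 0.
    rewrite b0 mul0r addr0; apply: nB; apply: contra w0 => /eqP a0.
    rewrite -[w]hsubmxK -/a -/b a0 [b]mx11_scalar b0.
    by rewrite raddf0 row_mx0.
  have : 0 < b 0 0 ^+ 2 by rewrite exprn_even_gt0.
  by rewrite mulrA -expr2; nra.
have Kk : (\rank K = m - k)%N.
  rewrite mxrank_ker; congr (_ - _)%N.
  have gU' : row_full g by rewrite row_full_unit.
  rewrite -mxrank_tr trmx_mul trmxK gT mxrankMfree; last by rewrite row_free_unit.
  exact/eqP.
have km : (k <= m)%N by rewrite -(eqP Bfree) rank_leq_col.
exists B, (\rank K), (row_base K); split=> //; first by rewrite Kk subnKC.
have full (v : 'rV[R]_m) : exists a c, v = a *m B + c /\ (c <= K)%MS.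
  have F : row_free (col_mx B (row_base K)).
    apply/inj_row_free => u; rewrite -[u]hsubmxK mul_row_col.
    set a := lsubmx u; set b := rsubmx u => E.
    have bK : (b *m row_base K <= K)%MS by rewrite (submx_trans (submxMl _ _)) ?eq_row_base.
    have a0 : a = 0.
      apply: (negdef_on_eq0 nB).
      have -> : qf g (a *m B) (a *m B) = - qf g (b *m row_base K) (a *m B).
        by rewrite -mulN1r -qfZl scaleN1r; congr (qf g _ _); apply/eqP; rewrite -addr_eq0 E.
      by rewrite (orth _ _ bK) oppr0.
    move: E; rewrite a0 mul0mx add0r => E.
    have := row_base_free K => /row_freeP[X XE].
    by rewrite -[b]mulmx1 -XE mulmxA E mul0mx row_mx0.
  have full : row_full (col_mx B (row_base K)).
    by rewrite /row_full (eqP F) Kk subnKC.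
  have /submxP[w ->] := submx_full v full.
  exists (lsubmx w), (rsubmx w *m row_base K).
  split; first by rewrite -mul_row_col hsubmxK.
  by rewrite (submx_trans (submxMl _ _)) ?eq_row_base.
move=> v v0; rewrite -/(qf _ _ _) qfNm oppr_lt0.
set x := v *m row_base K.
have xK : (x <= K)%MS by rewrite (submx_trans (submxMl _ _)) ?eq_row_base.
have x0 : x != 0.
  apply: contra v0 => /eqP x0; have := row_base_free K => /row_freeP[X XE].
  by rewrite -[v]mulmx1 -XE mulmxA -/x x0 mul0mx.
rewrite lt_neqAle (ge0 _ xK) andbT eq_sym; apply: contra x0 => /eqP q0.
apply/eqP; apply: (qf_unit0 gU) => y.
have [a [c [-> cK]]] := full y.
rewrite qfDr (orth _ _ xK) add0r.
(* Equality case of Cauchy-Schwarz: x is null and the form is nonnegative on K, so the linear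
   coefficient of this nonnegative quadratic in s must vanish. *)
have H (s : R) : 0 <= 2 * s * qf g x c + s ^+ 2 * qf g c c.
  have : ((x + s *: c)%R <= K)%MS by rewrite addmx_sub ?scalemx_sub.
  move=> /ge0; rewrite qfDl !qfDr !qfZl !qfZr q0 (qf_sym c x gT).
  by rewrite add0r; lra.
have c0 := ge0 _ cK.
apply/eqP; rewrite eq_le; apply/andP; split.
  rewrite leNgt; apply/negP => b0.
  (* Nearly the minimizer in s; the added 1 covers the case where c is null. *)
  have := H (- qf g x c / (qf g c c + 1)).
  have C0 : 0 < qf g c c + 1 by lra.
  rewrite -(pmulr_lge0 _ (exprn_gt0 2 C0)).
  have -> : (2 * (- qf g x c / (qf g c c + 1)) * qf g x c +
     (- qf g x c / (qf g c c + 1)) ^+ 2 * qf g c c) * (qf g c c + 1) ^+ 2 =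
     - (qf g x c ^+ 2 * (qf g c c + 2)) by field; rewrite gt_eqF.
  have : 0 < qf g x c ^+ 2 by rewrite exprn_gt0.
  nra.
rewrite leNgt; apply/negP => b0.
have := H (- qf g x c / (qf g c c + 1)).
have C0 : 0 < qf g c c + 1 by lra.
rewrite -(pmulr_lge0 _ (exprn_gt0 2 C0)).
have -> : (2 * (- qf g x c / (qf g c c + 1)) * qf g x c +
   (- qf g x c / (qf g c c + 1)) ^+ 2 * qf g c c) * (qf g c c + 1) ^+ 2 =
   - (qf g x c ^+ 2 * (qf g c c + 2)) by field; rewrite gt_eqF.
have : 0 < qf g x c ^+ 2 by rewrite exprn_even_gt0//= lt_eqF.
nra.
Qed.

End Index.

(** * Sign of the determinant, stability of definiteness, normal directions *)

Section Signature.
Context {R : realType}.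

Lemma mulmx_tr_gt0 m (v : 'rV[R]_m) : v != 0 -> 0 < (v *m v^T) 0 0.
Proof.
move=> v0; rewrite mxE.
have sq i : 0 <= v 0 i * v^T i 0 by rewrite mxE -expr2 sqr_ge0.
rewrite lt_neqAle sumr_ge0// andbT eq_sym; apply: contra v0 => /eqP H.
apply/eqP/rowP => i.
have /eqP := H; rewrite psumr_eq0// => /allP /(_ i (mem_index_enum i)) /=.
by rewrite !mxE mulf_eq0 orbb => /eqP.
Qed.

(** Join g by a segment to the model form [h1], which is diagonal with entries -1 and 1 in the basis
    given by B and C. Each form on the segment stays definite on both spans, hence invertible, so
    its determinant, a polynomial in s, keeps the sign it has at [h1]. *)
Lemma split_det_sign m k l (g : 'M[R]_m) (B : 'M[R]_(k, m)) (C : 'M[R]_(l, m)) :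
  (k + l)%N = m -> g^T = g -> negdef_on g B -> negdef_on (- g) C ->
  0 < (-1) ^+ k * \det g.
Proof.
move=> klm; subst m => gT nB pC.
pose P : 'M[R]_(k + l) := col_mx B C.
have PU : P \in unitmx by rewrite -row_free_unit; exact: col_mx_free nB pC.
pose Q := invmx P.
pose D : 'M[R]_(k + l) := block_mx (-1)%:M 0 0 1%:M.
pose h1 := Q *m D *m Q^T.
have qh1 u : qf h1 (u *m P) (u *m P) = qf D u u.
  rewrite /qf /h1; congr (fun_of_matrix _ 0 0).
  by rewrite trmx_mul !mulmxA mulmxK// -[_ *m Q^T *m P^T]mulmxA -trmx_mul mulmxV// trmx1 mulmx1.
have qD (a : 'rV_k) (b : 'rV_l) : qf D (row_mx a b) (row_mx a b) =
    - (a *m a^T) 0 0 + (b *m b^T) 0 0.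
  rewrite /qf mul_row_block !mulmx0 addr0 add0r mulmx1 mul_mx_scalar.
  by rewrite tr_row_mx mul_row_col scaleN1r mulNmx !mxE.
have nh1 : negdef_on h1 B.
  move=> v v0; rewrite -/(qf _ _ _).
  have -> : v *m B = row_mx v 0 *m P by rewrite mul_row_col mul0mx addr0.
  by rewrite qh1 qD mul0mx [X in _ + X]mxE addr0 oppr_lt0 mulmx_tr_gt0.
have ph1 : negdef_on (- h1) C.
  move=> v v0; rewrite -/(qf _ _ _) qfNm.
  have -> : v *m C = row_mx 0 v *m P by rewrite mul_row_col mul0mx add0r.
  by rewrite qh1 qD mul0mx [X in - X + _]mxE oppr0 add0r oppr_lt0 mulmx_tr_gt0.
have h1T : h1^T = h1.
  rewrite /h1 !trmx_mul trmxK mulmxA (_ : D^T = D)//.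
  by rewrite /D tr_block_mx !tr_scalar_mx !trmx0.
pose p := \det (map_mx polyC g + 'X *: map_mx polyC (h1 - g)).
have pE s : p.[s] = \det (g + s *: (h1 - g)).
  rewrite /p -horner_evalE -det_map_mx; congr determinant.
  by apply/matrixP => i j; rewrite !mxE /= horner_evalE !hornerE.
have qs s v : qf (g + s *: (h1 - g)) v v = (1 - s) * qf g v v + s * qf h1 v v.
  rewrite /qf mulmxDr mulmxDl -scalemxAr -scalemxAl mulmxBr mulmxBl !mxE.
  by ring.
have nz s : 0 <= s <= 1 -> p.[s] != 0.
  move=> /andP[s0 s1]; rewrite pE -unitfE -unitmxE.
  apply: (split_unit (erefl (k + l)%N) (B := B) (C := C)).
  - by rewrite linearD linearZ /= linearB /= gT h1T.
  - move=> v v0; rewrite -/(qf _ _ _) qs.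
    have := nB v v0; have := nh1 v v0; rewrite -!/(qf _ _ _).
    have [->|] := eqVneq s 0; first by lra.
    move=> sn0; have s0' : 0 < s by rewrite lt_neqAle eq_sym sn0.
    nra.
  - move=> v v0; rewrite -/(qf _ _ _) qfNm qs.
    have := pC v v0; have := ph1 v v0; rewrite -!/(qf _ _ _) !qfNm.
    have [->|] := eqVneq s 0; first by lra.
    move=> sn0; have s0' : 0 < s by rewrite lt_neqAle eq_sym sn0.
    nra.
have p1 : 0 < (-1) ^+ k * p.[1].
  rewrite pE scale1r addrC subrK /h1 !det_mulmx det_tr det_ublock !det_scalar.
  rewrite expr1n mulr1.
  have -> : (-1) ^+ k * (\det Q * (-1) ^+ k * \det Q) =
    ((-1) ^+ k) ^+ 2 * \det Q ^+ 2 :> R by ring.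
  rewrite -exprM mulnC exprM sqrrN expr1n expr1n mul1r exprn_even_gt0//=.
  by rewrite /Q det_inv invr_eq0 -unitfE -unitmxE.
have -> : \det g = p.[0] by rewrite pE scale0r addr0.
rewrite ltNge; apply/negP => p0.
have H : (((-1) ^+ k)%:P * p).[0] <= 0 <= (((-1) ^+ k)%:P * p).[1].
  by rewrite !hornerE p0 ltW.
have [x xI] := poly_ivt ler01 H.
rewrite rootE hornerM hornerC mulf_eq0 signr_eq0 /= => xr.
by have := nz x xI; rewrite xr.
Qed.

(** Compactness of the unit sphere gives one neighbourhood for all unit vectors; homogeneity gives
    the other vectors. *)
Lemma near_negdef_on m r (g : 'M[R]_m) (B : 'M[R]_(r, m)) :
  negdef_on g B -> \forall h \near g, negdef_on h B.
Proof.
move=> nB.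
have cS : compact [set v : 'rV[R]_r | `|v| = 1].
  apply: bounded_closed_compact.
    exists 1; split; first exact: num_real.
    by move=> M M1 y /= ->; exact: ltW.
  rewrite (_ : [set _ | _] = Num.norm @^-1` [set 1])//.
  apply: closed_comp => [x _|]; first exact: norm_continuous.
  exact: closed_eq.
have cq : continuous (fun z : 'M[R]_m * 'rV[R]_r => qf z.1 (z.2 *m B) (z.2 *m B)).
  move=> [h v].
  have c1 : z.1 @[z --> (h, v)] --> h by exact: cvg_fst.
  have c2 : z.2 *m B @[z --> (h, v)] --> v *m B.
    by apply: cvg_mulmx; [exact: cvg_snd|exact: cvg_cst].
  exact: ((cvg_mxP _ _).1 (cvg_mulmx (cvg_mulmx c2 c1) (cvg_trmx c2)) 0 0).
move/compact_near_coveringP : cS => /(_ _ (nbhs g)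
  (fun h v => qf h (v *m B) (v *m B) < 0) _) cS.
have {}cS : \forall h \near g, forall v : 'rV[R]_r, `|v| = 1 -> qf h (v *m B) (v *m B) < 0.
  apply: cS => v v1.
  have v0 : v != 0 by rewrite -normr_eq0 v1 oner_eq0.
  have /cvgr_lt /(_ 0 (nB v v0)) := cq (g, v).
  move=> [[U V] [/= nU nV] UV]; exists (V, U) => //= -[v' h] /= [Vv' Uh].
  exact: (UV (h, v')).
near=> h => v v0.
have nS : forall v : 'rV[R]_r, `|v| = 1 -> qf h (v *m B) (v *m B) < 0 by near: h.
have n0 : 0 < `|v| by rewrite normr_gt0.
have := nS (`|v|^-1 *: v).
rewrite normrZ gtr0_norm ?invr_gt0// mulVf ?gt_eqF// => /(_ erefl).
rewrite -scalemxAl qfZl qfZr -/(qf _ _ _) mulrA pmulr_rlt0//.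
by rewrite mulr_gt0 ?invr_gt0.
Unshelve. all: by end_near. Qed.

(** Lowering an index, v to v g, carries the form g to its inverse form, so covectors of either sign
    come from nonzero vectors in the two definite subspaces. *)
Lemma exists_signed_covector m k (g : 'M[R]_m) : (0 < k < m)%N ->
  g \in unitmx -> g^T = g -> has_index g k ->
  (exists p, qf (invmx g) p p < 0) /\ (exists p, 0 < qf (invmx g) p p).
Proof.
move=> /andP[k0 km] gU gT ik.
have [B [l [C [klm nB pC]]]] := index_split gU gT ik.
have qi v : qf (invmx g) (v *m g) (v *m g) = qf g v v.
  by rewrite /qf mulmxK// trmx_mul gT mulmxA.
have dl r : (0 < r)%N -> const_mx 1 != 0 :> 'rV[R]_r.
  case: r => // r _; apply/eqP => /rowP /(_ 0); rewrite !mxE => /eqP.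
  by rewrite oner_eq0.
split.
  by exists (const_mx 1 *m B *m g); rewrite qi; apply: nB; exact: dl.
exists (const_mx 1 *m C *m g); rewrite qi.
have l0 : (0 < l)%N by rewrite -(ltn_add2l k) addn0 klm.
by have := pC _ (dl _ l0); rewrite -/(qf _ _ _) qfNm oppr_lt0.
Qed.

(** S is the form measuring the normal part. If all its values vanished, polarization would give S =
    0; then e would factor through dimension m, against its rank N. *)
Lemma exists_normal_nonnull m N (e : 'M[R]_N) (J : 'M[R]_(m, N)) :
  (m < N)%N -> e \in unitmx -> e^T = e ->
  exists nu : 'rV[R]_N,
    qf e nu nu - qf (invmx (J *m e *m J^T)) (nu *m e *m J^T) (nu *m e *m J^T) != 0.
Proof.
move=> mN eU eT; set g := J *m e *m J^T.
have gT : g^T = g by rewrite /g !trmx_mul trmxK eT mulmxA.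
pose S := e - e *m J^T *m invmx g *m J *m e.
have ST : S^T = S.
  by rewrite /S linearB /= !trmx_mul trmxK trmx_inv gT eT !mulmxA.
have qS v : qf S v v =
    qf e v v - qf (invmx g) (v *m e *m J^T) (v *m e *m J^T).
  rewrite /qf /S mulmxBr mulmxBl mxE [X in _ + X]mxE; congr (_ - fun_of_matrix _ 0 0).
  by rewrite !trmx_mul trmxK eT !mulmxA.
apply: contrapT => /forallNP H.
have q0 v : qf S v v = 0 by have /negP := H v; rewrite negbK -qS => /eqP.
have S0 : S = 0.
  apply/matrixP => i j.
  have q2 v w : qf S v w = 0.
    have := q0 (v + w); rewrite qfDl !qfDr !q0 (qf_sym w v ST); lra.
  have := q2 (delta_mx 0 i) (delta_mx 0 j).
  by rewrite /qf trmx_delta -rowE -colE !mxE.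
have : (\rank e <= m)%N.
  have -> : e = e *m J^T *m (invmx g *m J *m e).
    by apply/eqP; rewrite -subr_eq0 !mulmxA -/S S0.
  exact: leq_trans (mxrankM_maxl _ _) (rank_leq_col _).
by rewrite mxrank_unit// leqNgt mN.
Qed.

Lemma eta_sym n N : (Defs.eta R n N)^T = Defs.eta R n N.
Proof. exact: tr_diag_mx. Qed.

Lemma eta_unit n N : Defs.eta R n N \in unitmx.
Proof.
rewrite unitmxE det_diag unitfE; apply/prodf_neq0 => i _; rewrite mxE.
by case: ifP; rewrite ?oppr_eq0 oner_eq0.
Qed.

Lemma congr_unit m (T g : 'M[R]_m) : T \in unitmx -> g \in unitmx ->
  T *m g *m T^T \in unitmx.
Proof. by move=> TU gU; rewrite !unitmx_mul TU gU unitmx_tr TU. Qed.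

Lemma congr_has_index m k (T g : 'M[R]_m) : T \in unitmx ->
  has_index g k -> has_index (T *m g *m T^T) k.
Proof.
have qT u : qf (T *m g *m T^T) u u = qf g (u *m T) (u *m T).
  by rewrite /qf trmx_mul !mulmxA.
move=> TU [[B nB] kmax]; split.
  exists (B *m invmx T) => v v0; rewrite -/(qf _ _ _) qT !mulmxA mulmxKV//.
  exact: nB.
move=> r D nD; apply: (kmax _ (D *m T)) => v v0.
by have := nD v v0; rewrite -!/(qf _ _ _) qT mulmxA.
Qed.

End Signature.

(** * Derivatives and divergence *)

Section Schwarz.
Context {R : realType} {V : normedModType R}.

Definition second_difference (f : V -> R^o) x u v (h : R) : R :=
  f (x + h *: u + h *: v) - f (x + h *: u) - (f (x + h *: v) - f x).

(** The mean value theorem along u, applied to y -> f (y + h v) - f y, leaves a difference of two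
    values of ['D_u f] near x; both are expanded to first order at x. *)
Lemma second_difference_approx (f : V -> R^o) x u v e :
  (\near x, differentiable f x) -> differentiable ('D_u f) x -> 0 < e ->
  \forall h \near (0 : R),
    `|second_difference f x u v h - h ^+ 2 * 'D_v ('D_u f) x| <= e * h ^+ 2.
Proof.
move=> df dDf e0.
(* The two first-order remainders are taken at s u + h v and s u with s at most h in absolute value;
   their norms add up to at most C times that of h. The 1 keeps C positive. *)
pose C := `|u| *+ 2 + `|v| + 1.
have C0 : 0 < C by rewrite ltr_wpDl// addr_ge0// mulrn_wge0.
have eC : 0 < e / C by rewrite divr_gt0.
have /nbhs_ballP[r1 /= r10 H1] := df.
have /nbhs_ballP[r2 /= r20 H2] := differentiable_approx dDf eC.
have [r [r0 rr1 rr2]] : exists r : R, [/\ 0 < r, r <= r1 & r <= r2].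
  by exists (Num.min r1 r2); split; rewrite ?lt_min ?r10// ge_min lexx ?orbT.
have rC : 0 < r / C by rewrite divr_gt0.
near=> h.
have hr : `|h| * C < r.
  rewrite -ltr_pdivlMr//; near: h; exact: (@nbhs0_lt R R^o).
have inb (a b : R) : `|a| <= `|h| -> `|b| <= `|h| -> `|a *: u + b *: v| < r.
  move=> ah bh; apply: le_lt_trans hr.
  rewrite (le_trans (ler_normD _ _))// !normrZ /C.
  have := ler_wpM2r (normr_ge0 u) ah; have := ler_wpM2r (normr_ge0 v) bh.
  have := mulr_ge0 (normr_ge0 h) (normr_ge0 u); have := normr_ge0 h.
  by rewrite mulr2n !mulrDr; lra.
have dfab (a b : R) : `|a| <= `|h| -> `|b| <= `|h| ->
    differentiable f (x + (a *: u + b *: v)).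
  move=> ah bh; apply: H1; rewrite -ball_normE /= opprD addrA subrr sub0r normrN.
  by rewrite (lt_le_trans (inb _ _ ah bh)).
have h0 : `|(0 : R)| <= `|h| by rewrite normr0.
pose phi y := f (y + h *: v) - f y : R^o.
have dphi s : `|s| <= `|h| -> differentiable phi (x + s *: u) /\
   'D_u phi (x + s *: u) = 'D_u f (x + (s *: u + h *: v)) - 'D_u f (x + (s *: u + 0 *: v)).
  move=> sh.
  have d1 := dfab s h sh (lexx _); have d2 := dfab s 0 sh h0.
  rewrite scale0r addr0 in d2 *.
  have ds : is_diff (x + s *: u) (fun y => y + h *: v) (id : V -> V).
    have := is_diffD (is_diff_id (x + s *: u)) (is_diff_cst (h *: v) (x + s *: u)).
    by move=> /is_diff_eq; apply; rewrite addr0.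
  have ds' : differentiable (fun y => y + h *: v) (x + s *: u) by exact: ex_diff.
  have d1' : differentiable f ((fun y => y + h *: v) (x + s *: u)) by rewrite /= -addrA.
  have d3 : differentiable (f \o (fun y => y + h *: v)) (x + s *: u).
    exact: differentiable_comp.
  split; first exact: differentiableB.
  rewrite -[phi]/((f \o (fun y => y + h *: v)) - f) deriveB; try exact/diff_derivable.
  congr (_ - _); rewrite deriveE// diff_comp//= diff_val deriveE ?addrA//.
have [s sh] := line_MVT (fun s sh => (dphi s sh).1).
rewrite (dphi s sh).2 => E.
have -> : second_difference f x u v h = phi (x + h *: u) - phi x by [].
rewrite E.
have A1 := H2 (s *: u + h *: v).
have A2 := H2 (s *: u + 0 *: v).
have {}A1 : `|'D_u f (s *: u + h *: v + x) - 'D_u f x - 'd ('D_u f) x (s *: u + h *: v)|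
    <= e / C * `|s *: u + h *: v|.
  apply: A1; rewrite -ball_normE /= sub0r normrN.
  by apply: lt_le_trans rr2; exact: inb.
have {}A2 : `|'D_u f (s *: u + 0 *: v + x) - 'D_u f x - 'd ('D_u f) x (s *: u + 0 *: v)|
    <= e / C * `|s *: u + 0 *: v|.
  apply: A2; rewrite -ball_normE /= sub0r normrN.
  by apply: lt_le_trans rr2; exact: inb.
rewrite !(addrC x) (deriveE _ dDf).
rewrite scale0r addr0 in A2 *.
set a := 'D_u f (_ + _ + x) in A1 *; set b := 'D_u f (_ + x) in A2 *.
set c := 'D_u f x in A1 A2 *.
set q := 'd ('D_u f) x v; pose p := 'd ('D_u f) x u.
have L1 : 'd ('D_u f) x (s *: u + h *: v) = s * p + h * q.
  by rewrite linearD !linearZ.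
have L2 : 'd ('D_u f) x (s *: u) = s * p by rewrite linearZ.
rewrite {}L1 in A1; rewrite {}L2 in A2.
have B : `|a - b - h * q| <= e / C * (`|s *: u + h *: v| + `|s *: u|).
  have -> : a - b - h * q = (a - c - (s * p + h * q)) - (b - c - s * p) by ring.
  by rewrite (le_trans (ler_normB _ _))// mulrDr lerD.
have -> : h * (a - b) - h ^+ 2 * q = h * (a - b - h * q) by ring.
rewrite normrM; apply: (le_trans (ler_wpM2l (normr_ge0 h) B)).
have -> : e * h ^+ 2 = `|h| * (e / C * (`|h| * C)).
  rewrite -[h ^+ 2]ger0_norm ?sqr_ge0// normrX; field; by rewrite gt_eqF.
rewrite ler_wpM2l// ler_wpM2l ?(ltW eC)//.
have : `|s *: u + h *: v| <= `|s| * `|u| + `|h| * `|v|.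
  by rewrite (le_trans (ler_normD _ _))// !normrZ.
rewrite normrZ /C.
have := ler_wpM2r (normr_ge0 u) sh; have := normr_ge0 h.
by rewrite mulr2n !mulrDr; lra.
Unshelve. all: by end_near. Qed.

(** The second difference is symmetric in u and v, and divided by h^2 it tends to either iterated
    derivative. *)
Lemma derive_comm (f : V -> R^o) x u v :
  (\near x, differentiable f x) -> differentiable ('D_u f) x ->
  differentiable ('D_v f) x -> 'D_v ('D_u f) x = 'D_u ('D_v f) x.
Proof.
move=> df du dv.
apply/eqP; rewrite -subr_eq0 -normr_le0; apply/ler_addgt0Pr => e e0.
rewrite add0r.
have e2 : 0 < e / 2 by rewrite divr_gt0.
have A1 := second_difference_approx v df du e2.
have A2 := second_difference_approx u df dv e2.
have [h [[B1 B2] h0]] := filter_ex (filterI (filterI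
  (nbhs_dnbhs A1) (nbhs_dnbhs A2)) (nbhs_dnbhs_neq (0 : R))).
have sE : second_difference f x v u h = second_difference f x u v h.
  by rewrite /second_difference [x + h *: v + _]addrAC; ring.
rewrite sE in B2.
have h2 : 0 < h ^+ 2 by rewrite exprn_even_gt0.
move: B1 B2; move: (second_difference _ _ _ _ _) ('D_v _ x) ('D_u _ x).
move=> S a b B1 B2.
rewrite -(ler_pM2l h2) -{1}[h ^+ 2]ger0_norm ?(ltW h2)// -normrM mulrBr.
move: B1 B2; rewrite !ler_norml.
move=> /andP[? ?] /andP[? ?]; apply/andP; split; lra.
Qed.

End Schwarz.

(** * Derivatives of matrix products, determinants and inverses *)

Section MatrixDerivative.
Context {R : realType} {V : normedModType R}.
Implicit Types (x v : V).

Lemma differentiable_sumR (I : Type) (s : seq I) (h : I -> V -> R^o) x :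
  (forall i, differentiable (h i) x) ->
  differentiable (fun y => \sum_(i <- s) h i y : R^o) x.
Proof.
move=> dh; elim: s => [|i s IH].
  rewrite (_ : (fun y => _) = cst 0); first exact: differentiable_cst.
  by apply/funext => y; rewrite big_nil.
rewrite (_ : (fun y => _) = h i + (fun y => \sum_(i <- s) h i y : R^o)).
  exact: differentiableD.
by apply/funext => y; rewrite big_cons.
Qed.

Lemma derive_sumR (I : Type) (s : seq I) (h : I -> V -> R^o) x v :
  (forall i, differentiable (h i) x) ->
  'D_v (fun y => \sum_(i <- s) h i y : R^o) x = \sum_(i <- s) 'D_v (h i) x.
Proof.
move=> dh; elim: s => [|i s IH].
  rewrite big_nil (_ : (fun y => _) = cst 0) ?derive_cst//.
  by apply/funext => y; rewrite big_nil.
rewrite big_cons -IH.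
rewrite (_ : (fun y => _) = h i + (fun y => \sum_(i <- s) h i y : R^o)).
  rewrite deriveD//; apply: diff_derivable => //; exact: differentiable_sumR.
by apply/funext => y; rewrite big_cons.
Qed.

Lemma derive_mulR (f g : V -> R^o) x v :
  differentiable f x -> differentiable g x ->
  'D_v (fun y => f y * g y : R^o) x = 'D_v f x * g x + f x * 'D_v g x.
Proof.
move=> df dg; rewrite (_ : (fun y => _) = f * g)// deriveM; try exact: diff_derivable.
by rewrite addrC [_ *: 'D_v f x]mulrC.
Qed.

Lemma differentiable_prodR (I : Type) (s : seq I) (h : I -> V -> R^o) x :
  (forall i, differentiable (h i) x) ->
  differentiable (fun y => \prod_(i <- s) h i y : R^o) x.
Proof.
move=> dh; elim: s => [|i s IH].
  rewrite (_ : (fun y => _) = cst 1); first exact: differentiable_cst.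
  by apply/funext => y; rewrite big_nil.
rewrite (_ : (fun y => _) = h i * (fun y => \prod_(i <- s) h i y : R^o)).
  exact: differentiableM.
by apply/funext => y; rewrite big_cons.
Qed.

Lemma derive_prodR (I : eqType) (s : seq I) (h : I -> V -> R^o) x v : uniq s ->
  (forall i, differentiable (h i) x) ->
  'D_v (fun y => \prod_(i <- s) h i y : R^o) x =
    \sum_(i <- s) 'D_v (h i) x * \prod_(j <- s | j != i) h j x.
Proof.
move=> + dh; elim: s => [_|i s IH /= /andP[is_ us]].
  rewrite big_nil (_ : (fun y => _) = cst 1) ?derive_cst//.
  by apply/funext => y; rewrite big_nil.
rewrite (_ : (fun y => _) = (fun y => h i y * \prod_(i <- s) h i y)); last first.
  by apply/funext => y; rewrite big_cons.
rewrite derive_mulR//; last exact: differentiable_prodR.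
rewrite IH// big_cons big_cons eqxx /=; congr (_ * _ + _).
  rewrite [LHS]big_seq [RHS]big_seq_cond; apply: eq_bigl => j.
  by case: (boolP (j \in s)) => //= js; rewrite (memPn is_).
rewrite mulr_sumr [LHS]big_seq [RHS]big_seq; apply: eq_bigr => k ks.
rewrite [in RHS]big_cons ifT; first by rewrite mulrCA.
by apply: contra is_ => /eqP ->.
Qed.

Definition mxdiff p q (A : V -> 'M[R]_(p, q)) x :=
  forall i j, differentiable (fun y => A y i j : R^o) x.

Definition dmx p q v (A : V -> 'M[R]_(p, q)) x : 'M[R]_(p, q) :=
  \matrix_(i, j) 'D_v (fun y => A y i j : R^o) x.

Lemma mxdiff_cst p q (A : 'M[R]_(p, q)) x : mxdiff (fun=> A) x.
Proof. by move=> i j; exact: differentiable_cst. Qed.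

Lemma dmx_cst p q (A : 'M[R]_(p, q)) x v : dmx v (fun=> A) x = 0.
Proof. by apply/matrixP => i j; rewrite !mxE; exact: derive_cst. Qed.

Lemma mxdiff_mul p q r (A : V -> 'M[R]_(p, q)) (B : V -> 'M[R]_(q, r)) x :
  mxdiff A x -> mxdiff B x -> mxdiff (fun y => A y *m B y) x.
Proof.
move=> dA dB i j.
rewrite (_ : (fun y => _) = (fun y => \sum_k A y i k * B y k j)).
  by apply: differentiable_sumR => k; apply: differentiableM.
by apply/funext => y; rewrite mxE.
Qed.

Lemma dmx_mul p q r (A : V -> 'M[R]_(p, q)) (B : V -> 'M[R]_(q, r)) x v :
  mxdiff A x -> mxdiff B x ->
  dmx v (fun y => A y *m B y) x = dmx v A x *m B x + A x *m dmx v B x.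
Proof.
move=> dA dB; apply/matrixP => i j; rewrite !mxE.
rewrite (_ : (fun y => _) = (fun y => \sum_k A y i k * B y k j)); last first.
  by apply/funext => y; rewrite mxE.
rewrite derive_sumR; last by move=> k; apply: differentiableM.
rewrite -big_split; apply: eq_bigr => k _ /=.
by rewrite derive_mulR// !mxE.
Qed.

Lemma mxdiff_tr p q (A : V -> 'M[R]_(p, q)) x :
  mxdiff A x -> mxdiff (fun y => (A y)^T) x.
Proof.
move=> dA i j; rewrite (_ : (fun y => _) = (fun y => A y j i))//.
by apply/funext => y; rewrite mxE.
Qed.

Lemma dmx_tr p q (A : V -> 'M[R]_(p, q)) x v :
  dmx v (fun y => (A y)^T) x = (dmx v A x)^T.
Proof.
apply/matrixP => i j; rewrite !mxE.
rewrite (_ : (fun y => (A y)^T i j) = (fun y => A y j i))//.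
by apply/funext => y; rewrite mxE.
Qed.

Lemma mxdiff_det p (A : V -> 'M[R]_p) x :
  mxdiff A x -> differentiable (fun y => \det (A y) : R^o) x.
Proof.
move=> dA; apply: differentiable_sumR => s; apply: differentiableM.
  exact: differentiable_cst.
exact: differentiable_prodR.
Qed.

(** Jacobi's formula. The Leibniz expansion differentiates one row at a time: [B i] is A with row i
    replaced by its derivative, and expanding along that row yields the adjugate. *)
Lemma derive_det p (A : V -> 'M[R]_p) x v : mxdiff A x ->
  'D_v (fun y => \det (A y) : R^o) x = \tr (dmx v A x *m \adj (A x)).
Proof.
move=> dA.
pose dd s := differentiable_prodR (index_enum 'I_p)
  (fun i => dA i (perm.fun_of_perm s i)).
rewrite derive_sumR; last first.
  move=> s; apply: differentiableM; first exact: differentiable_cst.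
  exact: dd.
pose B i : 'M[R]_p := \matrix_(k, l) if k == i then dmx v A x k l else A x k l.
transitivity (\sum_i \det (B i)).
  rewrite exchange_big /=; apply: eq_bigr => s _.
  rewrite derive_mulR//.
  rewrite derive_cst mul0r add0r derive_prodR ?index_enum_uniq//.
  rewrite mulr_sumr; apply: eq_bigr => i _; congr (_ * _).
  rewrite [RHS](bigD1 i)//= !mxE eqxx; congr (_ * _).
  by apply: eq_bigr => k /negbTE ki; rewrite !mxE ki.
rewrite /mxtrace; apply: eq_bigr => i _.
rewrite (expand_det_row _ i) mxE; apply: eq_bigr => j _.
rewrite !mxE eqxx; congr (_ * _); rewrite /cofactor; congr (_ * \det _).
apply/matrixP => k l; rewrite !mxE.
by rewrite (negbTE (neq_lift _ _)) || rewrite eq_sym (negbTE (neq_lift _ _)).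
Qed.

Lemma mxdiff_inv p (A : V -> 'M[R]_p) x : A x \in unitmx ->
  mxdiff A x -> mxdiff (fun y => invmx (A y)) x.
Proof.
move=> AU dA i j.
have dd := mxdiff_det dA.
have d0 : \det (A x) != 0 by rewrite -unitfE -unitmxE.
apply: (@differentiable_near_eq _ _ _
  (fun y => (\det (A y))^-1 * cofactor (A y) j i)).
  have /cvgr_neq0 : \det (A y) @[y --> x] --> \det (A x).
    exact: (differentiable_continuous dd).
  move=> /(_ d0); apply: filterS => y dy.
  by rewrite /invmx unitmxE unitfE dy; rewrite !mxE.
apply: differentiableM; first exact: differentiableV.
apply: differentiableM; first exact: differentiable_cst.
apply: mxdiff_det => k l.
rewrite (_ : (fun y => _) = (fun y => A y (lift j k) (lift i l)))//.
by apply/funext => y; rewrite !mxE.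
Qed.

Lemma dmx_inv p (A : V -> 'M[R]_p) x v : A x \in unitmx -> mxdiff A x ->
  dmx v (fun y => invmx (A y)) x = - (invmx (A x) *m dmx v A x *m invmx (A x)).
Proof.
move=> AU dA; have di := mxdiff_inv AU dA.
have nU : \forall y \near x, A y \in unitmx.
  have /cvgr_neq0 : \det (A y) @[y --> x] --> \det (A x).
    exact: (differentiable_continuous (mxdiff_det dA)).
  by rewrite -unitfE -unitmxE => /(_ AU); apply: filterS => y; rewrite unitmxE unitfE.
have := dmx_mul v dA di.
have -> : dmx v (fun y => A y *m invmx (A y)) x = 0.
  rewrite -(dmx_cst 1%:M x v); apply/matrixP => i j; rewrite !mxE.
  by apply: near_eq_derive; move: nU; apply: filterS => y yU; rewrite mulmxV// mxE.
move=> /esym/eqP; rewrite addrC addr_eq0 => /eqP E.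
by rewrite -[LHS](mulKmx AU) E mulmxN mulmxA.
Qed.

Lemma derive_sqrt_det p (A : V -> 'M[R]_p) x v c : 0 < c * \det (A x) ->
  mxdiff A x ->
  'D_v (fun y => Num.sqrt (c * \det (A y)) : R^o) x =
    2^-1 * Num.sqrt (c * \det (A x)) * \tr (invmx (A x) *m dmx v A x).
Proof.
move=> c0 dA.
have d0 : \det (A x) != 0 by apply: contraTneq c0 => ->; rewrite mulr0 ltxx.
have AU : A x \in unitmx by rewrite unitmxE unitfE.
have dd : differentiable (fun y => c * \det (A y) : R^o) x.
  by apply: differentiableM; [exact: differentiable_cst|exact: mxdiff_det].
have S := is_derive1_sqrt c0.
have ds : differentiable (Num.sqrt : R^o -> R^o) (c * \det (A x)).
  by apply/derivable1_diffP; case: S.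
rewrite (_ : (fun y => Num.sqrt _) = (Num.sqrt : R^o -> R^o) \o (fun y => c * \det (A y) : R^o))//.
rewrite deriveE; last exact: differentiable_comp.
rewrite diff_comp//= -(deriveE v dd).
rewrite -[X in 'd _ _ X](_ : 'D_v (fun y => c * \det (A y) : R^o) x *: (1 : R^o) = _); last exact: mulr1.
rewrite linearZ -(deriveE (1 : R^o) ds) (@derive_val _ _ _ _ _ _ _ S).
rewrite derive_mulR; [|exact: differentiable_cst|exact: mxdiff_det].
rewrite derive_cst mul0r add0r derive_det//.
have -> : \adj (A x) = \det (A x) *: invmx (A x).
  by rewrite /invmx AU scalerA mulfV// scale1r.
rewrite -scalemxAr mxtraceZ mxtrace_mulC.
set T := \tr _; set s := Num.sqrt _.
have s0 : 0 < s by rewrite sqrtr_gt0.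
have -> : c * (\det (A x) * T) = s ^+ 2 * T by rewrite sqr_sqrtr ?ltW// mulrA.
rewrite -[LHS]/(s ^+ 2 * T * (2 * s)^-1); field; by rewrite gt_eqF.
Qed.

End MatrixDerivative.

(** * Divergence of the tangential part of a constant vector *)

Section Divergence.
Context {R : realType}.

(** Here G is the inverse metric and row j of [P i] is the second derivative of the immersion along
    i and j. The symmetry of P lets the derivative of the density cancel one of the two terms from
    the derivative of G; the other is the tangential correction in the second fundamental form. *)
Lemma divergence_algebra m N (G : 'M[R]_m) (J : 'M[R]_(m, N)) (E : 'M[R]_N)
    (P : 'I_m -> 'M[R]_(m, N)) (nu : 'rV[R]_N) :
  G^T = G -> E^T = E -> (forall i a b, P i a b = P a i b) ->
  let w := nu *m E *m J^T in
  let dg i := P i *m E *m J^T + J *m E *m (P i)^T in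
  \sum_i (2^-1 * \tr (G *m dg i) * (w *m G) 0 i +
     ((nu *m E *m (P i)^T *m G) 0 i - (w *m G *m dg i *m G) 0 i)) =
  \sum_i \sum_j G i j * (qf E nu (row j (P i)) -
     qf E nu (row j (P i) *m E *m J^T *m G *m J)).
Proof.
move=> GT ET Psym w dg.
pose S i : 'M[R]_m := P i *m E *m J^T.
have dgE i : dg i = S i + (S i)^T.
  by rewrite /dg /S !trmx_mul trmxK ET mulmxA.
have Ssym i a c : S i a c = S a i c.
  rewrite /S -!mulmxA !mxE; apply: eq_bigr => k _; congr (_ * _); exact: Psym.
pose u := w *m G.
have GE i j : G i j = G j i by rewrite -{1}GT mxE.
have trE i : 2^-1 * \tr (G *m dg i) = \sum_a \sum_c G c a * S i a c.
  rewrite dgE mulmxDr mxtraceD.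
  have -> : \tr (G *m (S i)^T) = \tr (G *m S i).
    by rewrite -mxtrace_tr trmx_mul trmxK GT mxtrace_mulC.
  have half (t : R) : 2^-1 * (t + t) = t by field.
  rewrite half.
  rewrite /mxtrace exchange_big /=; apply: eq_bigr => c _.
  by rewrite mxE.
have uE i : (w *m G *m dg i *m G) 0 i =
    \sum_a \sum_c u 0 a * S i a c * G c i + \sum_a \sum_c u 0 a * S i c a * G c i.
  rewrite dgE -/u mulmxDr mulmxDl mxE; congr (_ + _).
    rewrite mxE exchange_big /=; apply: eq_bigr => c _.
    by rewrite mxE mulr_suml.
  rewrite mxE exchange_big /=; apply: eq_bigr => c _.
  by rewrite mxE mulr_suml; apply: eq_bigr => a _; rewrite [(S i)^T _ _]mxE.
have q2 i j : qf E nu (row j (P i) *m E *m J^T *m G *m J) = \sum_a S i j a * u 0 a.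
  rewrite /qf !trmx_mul trmxK GT ET !mulmxA -/w -/u.
  have -> : u *m J *m E *m (row j (P i))^T = u *m (row j (S i))^T.
    by rewrite /S !row_mul !trmx_mul trmxK ET !mulmxA.
  by rewrite mxE; apply: eq_bigr => a _; rewrite !mxE mulrC.
have q1 i : (nu *m E *m (P i)^T *m G) 0 i = \sum_j G i j * qf E nu (row j (P i)).
  rewrite mxE; apply: eq_bigr => j _; rewrite GE mulrC /qf; congr (_ * _).
  by rewrite tr_row colE mulmxA -colE [RHS]mxE.
under eq_bigr do rewrite trE uE q1.
under [RHS]eq_bigr do under eq_bigr do rewrite q2 mulrBr.
under [RHS]eq_bigr do rewrite sumrB.
have X1 : \sum_(i < m) (\sum_(a < m) \sum_(c < m) G c a * S i a c) * (w *m G) 0 i =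
    \sum_(i < m) \sum_(a < m) \sum_(c < m) u 0 a * S i a c * G c i.
  rewrite [RHS]exchange_big /=; apply: eq_bigr => i _.
  rewrite mulr_suml; apply: eq_bigr => a _.
  rewrite mulr_suml; apply: eq_bigr => c _.
  by rewrite (Ssym a) -/u; ring.
have X2 : \sum_(i < m) \sum_(a < m) \sum_(c < m) u 0 a * S i c a * G c i =
    \sum_(i < m) \sum_(j < m) G i j * (\sum_(a < m) S i j a * u 0 a).
  apply: eq_bigr => i _; rewrite exchange_big /=; apply: eq_bigr => c _.
  by rewrite mulr_sumr; apply: eq_bigr => a _; rewrite (GE i c); ring.
rewrite big_split /= !sumrB big_split /= X1 -X2.
rewrite addrCA; congr (_ + _).
by rewrite opprD addrA subrr sub0r.
Qed.

Section At.
Context {m N : nat} (n : nat) (psi : 'rV[R]_m -> 'rV[R]_N) (U : set 'rV[R]_m).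
Context (oU : open U) (Cpsi : forall k, Ck k U psi).
Let e i : 'rV[R]_m := delta_mx 0 i.
Let E := Defs.eta R n N.

Lemma jacobian_entry y i b : U y -> 'J psi y i b = 'D_(e i) psi y 0 b.
Proof.
move=> Uy; have d := Ck_differentiable (Cpsi 0) Uy.
by rewrite (deriveEjacobian _ d) -rowE [RHS]mxE.
Qed.

Lemma near_open x : U x -> \forall y \near x, U y.
Proof. by move=> Ux; exact: open_nbhs_nbhs. Qed.

Lemma Ck_jacobian k i b : Ck k U (fun y => 'J psi y i b : R^o).
Proof.
apply: (Ck_eq oU (f := fun y => coord_lin b ('D_(e i) psi y))).
  by move=> y Uy; rewrite jacobian_entry.
by apply: Ck_lin_comp => //; [exact: coord_lin_continuous|exact: Ck_derive (Cpsi k.+1)].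
Qed.

Lemma mxdiff_jacobian x : U x -> mxdiff (fun y => 'J psi y) x.
Proof. by move=> Ux i b; exact: Ck_differentiable (Ck_jacobian 0 i b) Ux. Qed.

Lemma dmx_jacobian x v i : U x ->
  row i (dmx v (fun y => 'J psi y) x) = 'D_v ('D_(e i) psi) x.
Proof.
move=> Ux; apply/rowP => b; rewrite !mxE.
have d := Ck_differentiable (Ck_derive (e i) (Cpsi 1)) Ux.
rewrite -(derivable_coord v b d); apply: near_eq_derive.
by apply: filterS (near_open Ux) => y Uy; rewrite jacobian_entry.
Qed.

Lemma dmx_jacobian_sym x i a b : U x ->
  dmx (e i) (fun y => 'J psi y) x a b = dmx (e a) (fun y => 'J psi y) x i b.
Proof.
move=> Ux; pose f y := psi y 0 b : R^o.
have Cf k : Ck k U f.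
  exact: (@Ck_lin_comp _ k _ _ _ U psi (@coord_lin R N b) oU (@coord_lin_continuous R N b) (Cpsi k)).
have Df j y : U y -> 'J psi y j b = 'D_(e j) f y.
  move=> Uy; rewrite jacobian_entry// -derivable_coord//.
  exact: Ck_differentiable (Cpsi 0) Uy.
have DD j l : dmx (e j) (fun y => 'J psi y) x l b = 'D_(e j) ('D_(e l) f) x.
  rewrite mxE; apply: near_eq_derive.
  by apply: filterS (near_open Ux) => y Uy; rewrite Df.
apply: (etrans (DD i a)); apply: (etrans _ (esym (DD a i))).
apply: (@derive_comm R 'rV[R]_m f x (e a) (e i)).
- by apply: filterS (near_open Ux) => y Uy; exact: Ck_differentiable (Cf 0) Uy.
- exact: Ck_differentiable (Ck_derive _ (Cf 1)) Ux.
- exact: Ck_differentiable (Ck_derive _ (Cf 1)) Ux.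
Qed.

Lemma metric_sym y : (induced_metric n psi y)^T = induced_metric n psi y.
Proof. by rewrite /induced_metric !trmx_mul trmxK eta_sym mulmxA. Qed.

Definition conormal (nu : 'rV[R]_N) y : 'rV[R]_m := nu *m E *m ('J psi y)^T.

(** With c = (-1)^k, this is the volume density times the gradient of the height function <nu, psi>,
    in coordinates. *)
Definition gradient_field c nu i y : R :=
  Num.sqrt (c * \det (induced_metric n psi y)) *
  (conormal nu y *m invmx (induced_metric n psi y)) 0 i.

Lemma mxdiff_metric x : U x -> mxdiff (induced_metric n psi) x.
Proof.
move=> Ux; apply: mxdiff_mul; last by apply: mxdiff_tr; exact: mxdiff_jacobian.
by apply: mxdiff_mul; [exact: mxdiff_jacobian|exact: mxdiff_cst].
Qed.

Lemma dmx_metric x v : U x -> let P := dmx v (fun y => 'J psi y) x in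
  dmx v (induced_metric n psi) x =
    P *m E *m ('J psi x)^T + 'J psi x *m E *m P^T.
Proof.
move=> Ux P; have dJ := mxdiff_jacobian Ux.
rewrite /induced_metric dmx_mul; last 2 first.
- by apply: mxdiff_mul => //; exact: mxdiff_cst.
- exact: mxdiff_tr.
by rewrite (dmx_mul v dJ (mxdiff_cst E x)) dmx_cst mulmx0 addr0 dmx_tr.
Qed.

(** The classical fact that the Laplacian of the height function <nu, psi> is the nu-component of
    the mean curvature vector, multiplied by the density. *)
Lemma divergence_gradient_field x nu c : U x ->
  0 < c * \det (induced_metric n psi x) ->
  \sum_i 'D_(e i) (gradient_field c nu i : _ -> R^o) x =
  Num.sqrt (c * \det (induced_metric n psi x)) *
    qf E nu (mean_curvature n psi x).
Proof.
move=> Ux c0; set g := induced_metric n psi.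
have gU : g x \in unitmx.
  by rewrite unitmxE unitfE; apply: contraTneq c0; rewrite /g => ->; rewrite mulr0 ltxx.
have dJ := mxdiff_jacobian Ux; have dg := mxdiff_metric Ux.
have dW : mxdiff (conormal nu) x.
  apply: (@mxdiff_mul R _ _ _ _ (fun=> nu *m E) (fun y => ('J psi y)^T)).
    exact: mxdiff_cst.
  exact: mxdiff_tr.
have di := mxdiff_inv gU dg.
pose P i := dmx (e i) (fun y => 'J psi y) x.
pose G := invmx (g x).
have dWG := mxdiff_mul dW di.
have dF : differentiable (fun y => Num.sqrt (c * \det (g y)) : R^o) x.
  apply: (@differentiable_comp _ _ _ _ (fun y => c * \det (g y) : R^o) (Num.sqrt : R^o -> R^o)).
    by apply: differentiableM; [exact: differentiable_cst|exact: mxdiff_det].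
  by apply/derivable1_diffP; case: (is_derive1_sqrt c0).
have -> : qf E nu (mean_curvature n psi x) = \sum_i \sum_j G i j *
    (qf E nu (row j (P i)) - qf E nu (row j (P i) *m E *m ('J psi x)^T *m G *m 'J psi x)).
  have qsum (I : finType) (F : I -> 'rV[R]_N) : qf E nu (\sum_i F i) = \sum_i qf E nu (F i).
    elim/big_rec2 : _ => [|i a b _ <-]; last by rewrite qfDr.
    by rewrite /qf trmx0 mulmx0 mxE.
  rewrite /mean_curvature qsum; apply: eq_bigr => i _.
  rewrite qsum; apply: eq_bigr => j _; rewrite qfZr; congr (_ * _).
  rewrite /second_fundamental_form /normal_part -dmx_jacobian//.
  by rewrite -scaleN1r qfDr qfZr mulN1r.
rewrite -(@divergence_algebra _ _ G ('J psi x) E P nu); first last.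
- by move=> i a b; exact: dmx_jacobian_sym.
- exact: eta_sym.
- by rewrite /G trmx_inv metric_sym.
rewrite mulr_sumr; apply: eq_bigr => i _.
rewrite /gradient_field (derive_mulR (e i) dF (dWG 0 i)).
rewrite (derive_sqrt_det _ c0)//.
have := congr1 (fun M : 'rV_m => M 0 i) (dmx_mul (e i) dW di).
rewrite [dmx _ _ _ _ _]mxE => ->.
rewrite dmx_inv// dmx_metric// /conormal dmx_mul; last 2 first.
- exact: mxdiff_cst.
- exact: mxdiff_tr.
have mxB (X Y : 'rV[R]_m) : (X - Y) 0 i = X 0 i - Y 0 i by rewrite !mxE.
rewrite dmx_cst mul0mx add0r dmx_tr -/(P i) mulmxN mxB.
rewrite !mulmxA -/g -/G -/E; ring.
Qed.

End At.
End Divergence.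

(** * Variation inside a chart *)

Section ChartVariation.
Context {R : realType}.

Definition Ckmx (V : normedModType R) k p q (U : set V) (A : V -> 'M[R]_(p, q)) :=
  forall i j, Ck k U (fun y => A y i j : R^o).

Lemma Ckmx_cst (V : normedModType R) k p q (U : set V) (A : 'M[R]_(p, q)) :
  Ckmx k U (fun=> A).
Proof. by move=> i j; exact: (@Ck_cst R k V R^o U (A i j)). Qed.

Lemma Ckmx_mul (V : normedModType R) k p q r (U : set V) (A : V -> 'M[R]_(p, q))
  (B : V -> 'M[R]_(q, r)) : open U -> Ckmx k U A -> Ckmx k U B ->
  Ckmx k U (fun y => A y *m B y).
Proof.
move=> oU cA cB i j.
rewrite (_ : (fun y => _) = (fun y => \sum_l A y i l * B y l j)).
  by apply: Ck_sum => // l; apply: CkM => //; (exact: cA || exact: cB).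
by apply/funext => y; rewrite mxE.
Qed.

Lemma Ckmx_tr (V : normedModType R) k p q (U : set V) (A : V -> 'M[R]_(p, q)) :
  Ckmx k U A -> Ckmx k U (fun y => (A y)^T).
Proof.
move=> cA i j; rewrite (_ : (fun y => _) = (fun y => A y j i)); first exact: cA.
by apply/funext => y; rewrite mxE.
Qed.

Lemma Ck_det (V : normedModType R) k p (U : set V) (A : V -> 'M[R]_p) :
  open U -> Ckmx k U A -> Ck k U (fun y => \det (A y) : R^o).
Proof.
move=> oU cA; apply: Ck_sum => // s; apply: CkM => //.
  exact: (@Ck_cst R k V R^o U).
by apply: Ck_prod => // i; exact: cA.
Qed.

Lemma Ckmx_inv (V : normedModType R) k p (U : set V) (A : V -> 'M[R]_p) :
  open U -> (forall y, U y -> A y \in unitmx) -> Ckmx k U A ->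
  Ckmx k U (fun y => invmx (A y)).
Proof.
move=> oU AU cA i j.
apply: (@Ck_eq _ _ _ _ U (fun y => (\det (A y))^-1 * cofactor (A y) j i)) => //.
  by move=> y Uy; rewrite /invmx (AU y Uy) !mxE.
apply: CkM => //.
  apply: (@Ck_comp_R _ _ _ [set x : R^o | x != 0] _ (fun x => x^-1)
    (fun y => \det (A y) : R^o)) => //.
  - by move=> y Uy; rewrite /= -unitfE -unitmxE AU.
  - exact: Ck_inv.
  - exact: Ck_det.
apply: CkM => //; first exact: (@Ck_cst R k V R^o U).
apply: Ck_det => // a b.
rewrite (_ : (fun y => _) = (fun y => A y (lift j a) (lift i b))); first exact: cA.
by apply/funext => y; rewrite !mxE.
Qed.

Lemma Ck_continuous (V W : normedModType R) k (U : set V) (f : V -> W) x :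
  Ck k U f -> U x -> {for x, continuous f}.
Proof. by move=> cf Ux; apply: differentiable_continuous; exact: Ck_differentiable cf Ux. Qed.

Lemma Ckmx_cvg (V : normedModType R) k p q (U : set V) (A : V -> 'M[R]_(p, q)) x :
  Ckmx k U A -> U x -> A y @[y --> x] --> A x.
Proof. by move=> cA Ux; apply/cvg_mxP => i j; exact: (Ck_continuous (cA i j) Ux). Qed.

Lemma Ck_setU (V W : normedModType R) k (U U' : set V) (f : V -> W) :
  Ck k U f -> Ck k U' f -> Ck k (U `|` U') f.
Proof.
elim: k f => [|k IH] f [d1 D1] [d2 D2].
  by split=> // x [/d1|/d2].
by split=> [x [/d1|/d2]//|v]; exact: IH (D1 v) (D2 v).
Qed.

Lemma Ck_open_zero (V W : normedModType R) k (U : set V) (f : V -> W) :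
  open U -> (forall x, U x -> f x = 0) -> Ck k U f.
Proof.
by move=> oU f0; apply: (Ck_eq oU _ (@Ck_cst R k V W U 0)) => x /f0 ->.
Qed.

Lemma open_outside (V : normedModType R) (p : V) r : open [set x | r < `|x - p|].
Proof.
rewrite (_ : [set _ | _] = (fun x => `|x - p|) @^-1` [set t | r < t])//.
apply: open_comp => [x _|]; last exact: open_gt.
by apply: cvg_norm; apply: cvgB; [exact: cvg_id|exact: cvg_cst].
Qed.

Lemma compact_cball_rV m (p : 'rV[R]_m) r : compact [set x | `|x - p| <= r].
Proof.
rewrite (_ : [set _ | _] = (fun y => y + p) @` [set y | `|y| <= r]).
  apply: continuous_compact; last exact: compact_ball_rV.
  apply: continuous_subspaceT => x.
  exact: (cvgD (@cvg_id _ (nbhs x)) (cvg_cst p)).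
apply/seteqP; split=> [x /= xr|_ [y /= yr <-]]; last by rewrite /= addrK.
by exists (x - p); rewrite //= subrK.
Qed.

Definition restrict_ball (V : normedModType R) (p : V) r (h : V -> R) x : R :=
  if `|x - p| <= r then h x else 0.

(** Two open sets cover the space: U, where the cut-off function is h, and the outside of the ball,
    where it is 0. The radius grows by the norm of p because [ccs] is centred at the origin. *)
Lemma ccs_restrict m (U : set 'rV[R]_m) p r (h : 'rV[R]_m -> R) : open U ->
  (forall x, `|x - p| <= r -> U x) -> (forall x, U x -> {for x, continuous h}) ->
  (forall x, U x -> r < `|x - p| -> h x = 0) ->
  ccs (restrict_ball p r h) (r + `|p|).
Proof.
move=> oU BU ch h0; split; last first.
  move=> x rx; rewrite /restrict_ball leNgt ifF//; apply/negbTE; rewrite negbK.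
  by have := ler_normD (x - p) p; rewrite subrK; lra.
move=> x; have [Ux|nUx] := pselect (U x).
  have E : \forall y \near x, h y = restrict_ball p r h y.
    apply: filterS (open_nbhs_nbhs (conj oU Ux)) => y Uy.
    by rewrite /restrict_ball; case: leP => // /(h0 _ Uy).
  rewrite /continuous_at -(nbhs_singleton E).
  by apply: cvg_trans (ch x Ux); exact: near_eq_cvg E.
have rx : r < `|x - p| by rewrite ltNge; apply/negP => /BU.
have E : \forall y \near x, (cst 0 : 'rV[R]_m -> R) y = restrict_ball p r h y.
  apply: filterS (open_nbhs_nbhs (conj (@open_outside _ p r) rx)) => y /= ry.
  by rewrite /restrict_ball [`|y - p| <= r]leNgt ry.
apply/(@cvgrPdist_le _ _ _ (nbhs x)) => e e0; apply: filterS E => y <- /=.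
by rewrite /restrict_ball [`|x - p| <= r]leNgt rx subr0 normr0 ltW.
Qed.

Definition sqdist m (p x : 'rV[R]_m) : R := \sum_j (x 0 j - p 0 j) ^+ 2.

(** The squared Euclidean distance is polynomial, hence smooth, whereas the norm of row vectors is
    the maximum norm. The Euclidean ball lies in the cube of the same radius, so the support is
    still controlled. *)
Definition bump m (p : 'rV[R]_m) (r : R) (x : 'rV[R]_m) : R^o :=
  flat_exp 1 (r ^+ 2 - sqdist p x).

Lemma Ck_coord k m (j : 'I_m) (U : set 'rV[R]_m) : open U ->
  Ck k U (fun x : 'rV[R]_m => x 0 j : R^o).
Proof.
move=> oU; apply: (@Ck_sub _ _ _ _ setT); first by [].
have C1 : Ck k setT (@id 'rV[R]_m).
  have oT : open [set: 'rV[R]_m] by exact: openT.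
  case: k => [|k]; first by split.
  split=> [//|v]; apply: (Ck_eq oT _ (@Ck_cst R k _ _ setT v)) => x _.
  by rewrite derive_id.
exact: (@Ck_lin_comp _ k _ _ _ setT (@id 'rV[R]_m) (@coord_lin R m j) openT
  (@coord_lin_continuous R m j) C1).
Qed.

Lemma Ck_bump k m (p : 'rV[R]_m) r : Ck k setT (bump p r).
Proof.
have oT : open [set: 'rV[R]_m] by exact: openT.
apply: (@Ck_comp_R _ _ _ setT setT (flat_exp 1 : R^o -> R^o)
  (fun x => r ^+ 2 - sqdist p x : R^o)) => //; first exact: openT.
  exact: Ck_flat_exp.
apply: (@Ck_eq R k 'rV[R]_m R^o setT (cst (r ^+ 2 : R^o) \+
    (fun x => \sum_j (-1 * ((x 0 j - p 0 j) * (x 0 j - p 0 j))) : R^o))) => //.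
  move=> x _; rewrite /= /sqdist -sumrN; congr (_ + _).
  by apply: eq_bigr => j _; rewrite mulN1r expr2.
apply: CkD => //; first exact: Ck_cst.
apply: Ck_sum => // j; apply: CkM => //; first exact: (@Ck_cst R k _ R^o).
have C : Ck k setT (fun x : 'rV[R]_m => x 0 j - p 0 j : R^o).
  apply: (@CkD R k 'rV[R]_m R^o setT (fun x => x 0 j) (cst (- p 0 j : R^o))) => //.
    exact: Ck_coord.
  exact: Ck_cst.
exact: CkM.
Qed.

Lemma bump_center m (p : 'rV[R]_m) r : 0 < r -> 0 < bump p r p.
Proof.
move=> r0; apply: flat_exp1_gt0.
rewrite /sqdist big1 ?subr0 ?exprn_gt0// => j _.
by rewrite subrr expr0n.
Qed.

Lemma bump_out m (p : 'rV[R]_m) r x : 0 < r -> r < `|x - p| -> bump p r x = 0.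
Proof.
move=> r0 rx; apply: flat_exp_eq0; rewrite subr_le0 leNgt; apply/negP => H.
move: rx; rewrite ltNge => /negP; apply; apply: ler_norm_rV => [|j]; first exact: ltW.
rewrite !mxE -(@ler_pXn2r _ 2) ?nnegrE ?(ltW r0)// real_normK ?num_real//.
apply: le_trans (ltW H); rewrite /sqdist (bigD1 j)//= lerDl sumr_ge0// => l _.
exact: sqr_ge0.
Qed.

Definition gradient m (f : 'rV[R]_m -> R^o) x : 'rV[R]_m :=
  \row_i 'D_(delta_mx 0 i) f x.

Lemma Ckmx_gradient k m (f : 'rV[R]_m -> R^o) : (forall k, Ck k setT f) ->
  Ckmx k setT (gradient f).
Proof.
move=> Cf i j; rewrite (_ : (fun y => _) = 'D_(delta_mx 0 j) f).
  exact: Ck_derive (Cf k.+1).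
by apply/funext => y; rewrite mxE.
Qed.

Lemma gradient_out m (f : 'rV[R]_m -> R^o) p r :
  (forall x, r < `|x - p| -> f x = 0) ->
  forall x, r < `|x - p| -> gradient f x = 0.
Proof.
move=> f0 x rx; apply/rowP => j; rewrite !mxE.
rewrite (@near_eq_derive _ _ _ f (cst 0)) ?derive_cst//.
by apply: filterS (open_nbhs_nbhs (conj (@open_outside _ p r) rx)) => y /= /f0.
Qed.

Definition scale_row N (nu : 'rV[R]_N) (a : R^o) : 'rV[R]_N := a *: nu.

Lemma scale_row_is_linear N (nu : 'rV[R]_N) : linear (scale_row nu).
Proof. by move=> a x y; rewrite /scale_row scalerDl scalerA. Qed.

HB.instance Definition _ N (nu : 'rV[R]_N) := GRing.isLinear.Build R R^o 'rV[R]_N _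
  (scale_row nu) (scale_row_is_linear nu).

Lemma scale_row_continuous N (nu : 'rV[R]_N) : continuous (scale_row nu).
Proof. by move=> a; apply: cvgZr_tmp; exact: cvg_id. Qed.

Definition vary m N (psi : 'rV[R]_m -> 'rV[R]_N) (f : 'rV[R]_m -> R^o)
  (nu : 'rV[R]_N) (t : R) x : 'rV[R]_N := psi x + (t * f x) *: nu.

Lemma Ck_vary k m N (psi : 'rV[R]_m -> 'rV[R]_N) (U : set 'rV[R]_m) f nu t :
  open U -> Ck k U psi -> Ck k U f -> Ck k U (vary psi f nu t).
Proof.
move=> oU cpsi cf.
apply: (@CkD R k _ _ U psi (fun x => scale_row nu (t * f x))) => //.
apply: (@Ck_lin_comp R k _ _ _ U (fun x => t * f x : R^o) (scale_row nu)) => //.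
  exact: scale_row_continuous.
by apply: CkM => //; exact: (@Ck_cst R k _ R^o U t).
Qed.

End ChartVariation.

(** * First and second variation of the volume in a constant direction *)

Section FixedField.
Context {R : realType} {m N : nat} (n : nat).
Context (psi : 'rV[R]_m -> 'rV[R]_N) (U : set 'rV[R]_m) (oU : open U).
Context (Cpsi : forall k, Ck k U psi).
Context (f : 'rV[R]_m -> R^o) (Cf : forall k, Ck k setT f) (nu : 'rV[R]_N).
Let E := Defs.eta R n N.
Let g := induced_metric n psi.
Let w := conormal n psi nu.
Let df := gradient f.

Lemma jacobian_vary t x : U x ->
  'J (vary psi f nu t) x = 'J psi x + t *: ((df x)^T *m nu).
Proof.
move=> Ux; have CfU k : Ck k U f by apply: Ck_sub (Cf k).
have Cv k := Ck_vary nu t oU (Cpsi k) (CfU k).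
apply/matrixP => i b; rewrite (jacobian_entry Cv)//.
rewrite [RHS]mxE (jacobian_entry Cpsi)//.
have dpsi := Ck_differentiable (Cpsi 0) Ux.
have df_ := Ck_differentiable (CfU 0) Ux.
have dtf : differentiable (fun y => t * f y : R^o) x.
  by apply: differentiableM => //; exact: differentiable_cst.
have dL : differentiable (fun y => scale_row nu (t * f y)) x.
  have ds := @linear_differentiable _ _ _ (scale_row nu) (t * f x) (@scale_row_continuous R N nu).
  exact: (differentiable_comp dtf ds).
have -> : vary psi f nu t = psi + (fun y => scale_row nu (t * f y)) by [].
rewrite deriveD; [|exact: diff_derivable|exact: diff_derivable].
rewrite [LHS]mxE; congr (_ + _).
rewrite (derive_lin_comp _ (@scale_row_continuous R N nu) dtf).
rewrite derive_mulR//.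
rewrite derive_cst mul0r add0r /scale_row !mxE big_ord1 !mxE.
by rewrite mulrA.
Qed.

(** The varied metric in closed form, from which joint continuity in t and x can be read off. *)
Definition perturbed t x : 'M[R]_m :=
  g x + t *: ((df x)^T *m w x + (w x)^T *m df x) +
  (t ^+ 2 * qf E nu nu) *: ((df x)^T *m df x).

Lemma metric_vary t x : U x -> induced_metric n (vary psi f nu t) x = perturbed t x.
Proof.
move=> Ux; rewrite /induced_metric jacobian_vary//.
set J := 'J psi x; set d := df x.
have nn : nu *m E *m nu^T = (qf E nu nu)%:M by rewrite -mx11_scalar.
have wE : (w x)^T = J *m E *m nu^T by rewrite /w /conormal !trmx_mul trmxK eta_sym mulmxA.
rewrite linearD linearZ /= trmx_mul trmxK !mulmxDl !mulmxDr.
rewrite ?(=^~scalemxAl, =^~scalemxAr) !mulmxA -/E -wE.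
have -> : d^T *m nu *m E *m J^T = d^T *m w x by rewrite /w /conormal !mulmxA.
have -> : d^T *m nu *m E *m nu^T *m d = qf E nu nu *: (d^T *m d).
  rewrite -[d^T *m nu *m E]mulmxA -[d^T *m _ *m nu^T]mulmxA nn mul_mx_scalar.
  by rewrite -scalemxAl.
rewrite /perturbed -/d !scalerA -expr2 scalerDr -[J *m E *m J^T]/(g x) -!addrA.
by congr (_ + _); rewrite !addrA; congr (_ + _); rewrite addrC.
Qed.

Lemma cvg_metric x : U x -> g y @[y --> x] --> g x.
Proof.
move=> Ux; have cJ := Ckmx_cvg (fun i j => Ck_jacobian oU Cpsi 0 i j) Ux.
exact: (cvg_mulmx (cvg_mulmx cJ (cvg_cst E)) (cvg_trmx cJ)).
Qed.

Lemma cvg_conormal x : U x -> w y @[y --> x] --> w x.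
Proof.
move=> Ux; have cJ := Ckmx_cvg (fun i j => Ck_jacobian oU Cpsi 0 i j) Ux.
exact: (cvg_mulmx (cvg_cst (nu *m E)) (cvg_trmx cJ)).
Qed.

Lemma cvg_gradient x : df y @[y --> x] --> df x.
Proof. exact: (Ckmx_cvg (Ckmx_gradient 0 Cf) (I : setT x)). Qed.

Lemma cvg_qf (T : Type) (F : set_system T) {FF : Filter F} (h : T -> 'M[R]_m)
  (a b : T -> 'rV[R]_m) h0 a0 b0 : h @ F --> h0 -> a @ F --> a0 -> b @ F --> b0 ->
  qf (h x) (a x) (b x) @[x --> F] --> qf h0 a0 b0.
Proof.
move=> ch ca cb.
exact: ((cvg_mxP _ _).1 (cvg_mulmx (cvg_mulmx ca ch) (cvg_trmx cb)) 0 0).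
Qed.

Lemma cvg_perturbed t0 x : U x ->
  perturbed z.1 z.2 @[z --> (t0, x)] --> perturbed t0 x.
Proof.
move=> Ux.
have c2 : z.2 @[z --> (t0, x)] --> x by exact: cvg_snd.
have c1 : (z.1 : R^o) @[z --> ((t0 : R^o), x)] --> (t0 : R^o) by exact: cvg_fst.
have cg := cvg_comp _ _ c2 (cvg_metric Ux).
have cw := cvg_comp _ _ c2 (cvg_conormal Ux).
have cd := cvg_comp _ _ c2 (cvg_gradient (x := x)).
apply: cvgD; first apply: cvgD => //.
  apply: cvgZ => //.
  exact: (cvgD (cvg_mulmx (cvg_trmx cd) cw) (cvg_mulmx (cvg_trmx cw) cd)).
apply: cvgZ; last exact: (cvg_mulmx (cvg_trmx cd) cd).
by apply: cvgM; [exact: cvgM|exact: cvg_cst].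
Qed.

(** [beta], [normal_norm] and [quad] are the quantities b, <nu, nu> - |w|^2 and q of the determinant
    formula. *)
Definition beta x : R := qf (invmx (g x)) (df x) (w x).
Definition normal_norm x : R := qf E nu nu - qf (invmx (g x)) (w x) (w x).
Definition quad x : R := qf (invmx (g x)) (df x) (df x) * normal_norm x.

Context (c : R) (cpos : forall x, U x -> 0 < c * \det (g x)).
Definition density x : R := Num.sqrt (c * \det (g x)).
Definition vdensity t x : R :=
  Num.sqrt (c * \det (induced_metric n (vary psi f nu t) x)).

Lemma metric_unit x : U x -> g x \in unitmx.
Proof.
move=> /cpos; rewrite unitmxE unitfE => H.
by apply: contraTneq H => ->; rewrite mulr0 ltxx.
Qed.

Lemma vdensityE t x : U x ->
  vdensity t x = density x * Num.sqrt ((1 + t * beta x) ^+ 2 + t ^+ 2 * quad x).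
Proof.
move=> Ux; rewrite /vdensity metric_vary// /perturbed.
rewrite det_metric_perturb; [|exact: metric_unit|exact: metric_sym].
rewrite [c * _]mulrA sqrtrM; last exact: ltW (cpos Ux).
by [].
Qed.

Lemma cvg_beta x : U x -> beta y @[y --> x] --> beta x.
Proof.
move=> Ux; exact: (cvg_qf (cvg_invmx (metric_unit Ux) (cvg_metric Ux))
  (cvg_gradient (x := x)) (cvg_conormal Ux)).
Qed.

Lemma cvg_normal_norm x : U x -> normal_norm y @[y --> x] --> normal_norm x.
Proof.
move=> Ux.
have H : qf (invmx (g y)) (w y) (w y) @[y --> x] --> qf (invmx (g x)) (w x) (w x).
  exact: (cvg_qf (cvg_invmx (metric_unit Ux) (cvg_metric Ux))
    (cvg_conormal Ux) (cvg_conormal Ux)).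
exact: (cvgB (cvg_cst (qf E nu nu)) H).
Qed.

Lemma cvg_quad x : U x -> quad y @[y --> x] --> quad x.
Proof.
move=> Ux.
have H : qf (invmx (g y)) (df y) (df y) @[y --> x] --> qf (invmx (g x)) (df x) (df x).
  exact: (cvg_qf (cvg_invmx (metric_unit Ux) (cvg_metric Ux))
    (cvg_gradient (x := x)) (cvg_gradient (x := x))).
exact: (cvgM H (cvg_normal_norm Ux)).
Qed.

Lemma cvg_density x : U x -> density y @[y --> x] --> density x.
Proof.
move=> Ux.
have H : c * \det (g y) @[y --> x] --> c * \det (g x).
  exact: (cvgM (cvg_cst c) (cvg_det (cvg_metric Ux))).
exact: (cvg_comp _ _ H (@sqrt_continuous R _)).
Qed.

Lemma cvg_vdensity t x : U x -> vdensity t y @[y --> x] --> vdensity t x.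
Proof.
move=> Ux; have CfU k : Ck k U f by apply: Ck_sub (Cf k).
have Cv k := Ck_vary nu t oU (Cpsi k) (CfU k).
have cJ := Ckmx_cvg (fun i j => Ck_jacobian oU Cv 0 i j) Ux.
have cg : induced_metric n (vary psi f nu t) y @[y --> x] -->
    induced_metric n (vary psi f nu t) x.
  exact: (cvg_mulmx (cvg_mulmx cJ (cvg_cst E)) (cvg_trmx cJ)).
have H : c * \det (induced_metric n (vary psi f nu t) y) @[y --> x] -->
    c * \det (induced_metric n (vary psi f nu t) x).
  exact: (cvgM (cvg_cst c) (cvg_det cg)).
exact: (cvg_comp _ _ H (@sqrt_continuous R _)).
Qed.

Context (p : 'rV[R]_m) (r : R).
Context (BU : forall x, `|x - p| <= r -> U x).
Context (fout : forall x, r < `|x - p| -> f x = 0).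

Lemma beta_out x : r < `|x - p| -> beta x = 0.
Proof. by move=> rx; rewrite /beta /df (gradient_out fout rx) qf0l. Qed.

Lemma quad_out x : r < `|x - p| -> quad x = 0.
Proof. by move=> rx; rewrite /quad /df (gradient_out fout rx) qf0l mul0r. Qed.

Lemma ccs_density_mul (h : 'rV[R]_m -> R) :
  (forall x, U x -> h y @[y --> x] --> h x) ->
  (forall x, r < `|x - p| -> h x = 0) ->
  ccs (restrict_ball p r (fun x => density x * h x)) (r + `|p|).
Proof.
move=> ch h0; apply: (ccs_restrict oU) => // [x Ux|x _ rx].
  exact: (cvgM (cvg_density Ux) (ch x Ux)).
by rewrite h0// mulr0.
Qed.

Lemma ccs_vdensity t :
  ccs (restrict_ball p r (fun x => vdensity t x - density x)) (r + `|p|).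
Proof.
apply: (ccs_restrict oU) => // [x Ux|x Ux rx].
  exact: (cvgB (cvg_vdensity (t := t) Ux) (cvg_density Ux)).
rewrite vdensityE// beta_out// quad_out// !mulr0 !addr0 expr1n sqrtr1 mulr1.
by rewrite subrr.
Qed.

Lemma Ck_gradient_field k i : Ck k U (gradient_field n psi c nu i : _ -> R^o).
Proof.
have cJ : Ckmx k U (fun y => 'J psi y) by move=> a b; exact: Ck_jacobian.
have cg : Ckmx k U g.
  by apply: Ckmx_mul => //; [apply: Ckmx_mul => //; exact: Ckmx_cst|exact: Ckmx_tr].
have cw : Ckmx k U w.
  by apply: Ckmx_mul => //; [exact: Ckmx_cst|exact: Ckmx_tr].
apply: CkM => //.
  apply: (@Ck_comp_R _ _ _ [set x : R^o | 0 < x] _ (fun x => Num.sqrt x)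
    (fun y => c * \det (g y) : R^o)) => //.
  - exact: Ck_sqrt.
  - by apply: CkM => //; [exact: (@Ck_cst R k _ R^o U c)|exact: Ck_det].
by apply: Ckmx_mul => //; apply: Ckmx_inv => // y; exact: metric_unit.
Qed.

(* Integration by parts against the field of [gradient_field], whose divergence
   is the density times the nu-component of the mean curvature. *)
Lemma first_variation : (forall x, U x -> mean_curvature n psi x = 0) ->
  Irv (restrict_ball p r (fun x => density x * beta x)) = 0.
Proof.
move=> H0.
pose Z i := gradient_field n psi c nu i : _ -> R^o.
pose h i x := f x * Z i x : R^o.
(* The field [Z i] is controlled only on U, but f vanishes outside the ball: this open cover makes
   the products [h i] smooth everywhere. *)
have out : U `|` [set x | r < `|x - p|] = setT.
  by apply/seteqP; split=> // x _; have [/BU|] := leP `|x - p| r; [left|right].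
have Ch k i : Ck k setT (h i).
  rewrite -out; apply: Ck_setU.
    by apply: CkM => //; [exact: Ck_sub (Cf k)|exact: Ck_gradient_field].
  by apply: Ck_open_zero => [|x /= /fout fx]; [exact: open_outside|rewrite /h fx mul0r].
have sh i : ccs (h i) (r + `|p|).
  split=> [x|x rx]; first exact: Ck_continuous (Ch 0 i) _.
  rewrite /h fout ?mul0r//; have := ler_normD (x - p) p.
  by rewrite subrK; lra.
have cDh i : continuous ('D_(delta_mx 0 i) (h i)).
  by move=> x; exact: Ck_continuous (Ck_derive (delta_mx 0 i) (Ch 1 i)) _.
have I0 i : Irv ('D_(delta_mx 0 i) (h i)) = 0.
  apply: (Irv_derive (sh i)) => // x; exact: Ck_differentiable (Ch 0 i) _.
have <- : \sum_i Irv ('D_(delta_mx 0 i) (h i)) = 0 by rewrite big1.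
rewrite -(Irv_sum _ (fun i => ccs_derive (sh i) (cDh i))).
congr Irv; apply/funext => x; rewrite /restrict_ball.
case: leP => [/BU Ux|rx]; last first.
  apply/esym; rewrite big1// => i _.
  rewrite (@near_eq_derive _ _ _ (h i) (cst 0)) ?derive_cst//.
  apply: filterS (open_nbhs_nbhs (conj (@open_outside _ _ p r) rx)) => y /= ry.
  by rewrite /h fout// mul0r.
have dZ i := Ck_differentiable (Ck_gradient_field 0 i) Ux.
have dfx := Ck_differentiable (Cf 0) (I : setT x).
under eq_bigr do rewrite (derive_mulR _ dfx (dZ _)).
rewrite big_split /= -mulr_sumr (divergence_gradient_field oU Cpsi nu Ux (cpos Ux)).
rewrite H0// (_ : qf _ _ 0 = 0) ?mulr0 ?addr0; last first.
  by rewrite /qf trmx0 mulmx0 mxE.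
rewrite /beta qf_sym; last by rewrite trmx_inv metric_sym.
rewrite /qf mxE mulr_sumr; apply: eq_bigr => i _.
have -> : (df x)^T i 0 = 'D_(delta_mx 0 i) f x by rewrite !mxE.
by rewrite mulrA [RHS]mulrC.
Qed.

(** With u = 1 + t b, the difference sqrt (u^2 + t^2 q) - u equals t^2 q divided by the sum of the
    two terms, and that sum tends to 2 uniformly on the ball. The error is thus a small multiple of
    t^2 |q|, and the linear term integrates to 0. *)
Lemma volume_expansion s :
  (forall x, U x -> mean_curvature n psi x = 0) ->
  0 < s * Irv (restrict_ball p r (fun x => density x * quad x)) ->
  \forall t \near (0 : R)^',
    0 < s * Irv (restrict_ball p r (fun x => vdensity t x - density x)).
Proof.
move=> H0; set Q := restrict_ball p r (fun x => density x * quad x) => sQ.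
have cQ : ccs Q (r + `|p|).
  by apply: ccs_density_mul => [x|x]; [exact: cvg_quad|exact: quad_out].
have cB : ccs (restrict_ball p r (fun x => density x * beta x)) (r + `|p|).
  by apply: ccs_density_mul => [x|x]; [exact: cvg_beta|exact: beta_out].
have cA : ccs (fun x => `|Q x|) (r + `|p|).
  case: cQ => cQ sQ'; split=> [x|x /sQ' ->]; last by rewrite normr0.
  exact: (cvg_norm (cQ x)).
set A := Irv (fun x => `|Q x|).
have A0 : 0 <= A by apply: Irv_ge0 => x.
have s0 : s != 0 by apply: contraTneq sQ => ->; rewrite mul0r ltxx.
(* Chosen so that the integrated error is at most a quarter of t^2 s [Irv Q], against a main term of
   one half; A + 1 avoids division by 0. *)
pose e := (s * Irv Q) / (4 * `|s| * (A + 1)).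
have e0 : 0 < e.
  by rewrite divr_gt0// !mulr_gt0// ?normr_gt0// ltr_wpDl.
pose den t x := 1 + t * beta x + Num.sqrt ((1 + t * beta x) ^+ 2 + t ^+ 2 * quad x).
pose rad t x := (1 + t * beta x) ^+ 2 + t ^+ 2 * quad x.
have cK := @compact_cball_rV R m p r.
have cb x : U x -> beta z.2 @[z --> ((0 : R), x)] --> beta x.
  move=> Ux; have c2 : z.2 @[z --> ((0 : R), x)] --> x by exact: cvg_snd.
  exact: (cvg_comp _ _ c2 (cvg_beta Ux)).
have cq x : U x -> quad z.2 @[z --> ((0 : R), x)] --> quad x.
  move=> Ux; have c2 : z.2 @[z --> ((0 : R), x)] --> x by exact: cvg_snd.
  exact: (cvg_comp _ _ c2 (cvg_quad Ux)).
have c1 x : (z.1 : R) @[z --> ((0 : R), x : 'rV[R]_m)] --> (0 : R) by exact: cvg_fst.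
have cu x : U x -> 1 + z.1 * beta z.2 @[z --> ((0 : R), x)] --> 1 + 0 * beta x.
  move=> Ux; apply: cvgD; first exact: cvg_cst.
  exact: (cvgM (c1 x) (cb x Ux)).
have crad x : U x -> rad z.1 z.2 @[z --> ((0 : R), x)] --> rad 0 x.
  move=> Ux; apply: cvgD; first exact: (cvgM (cu x Ux) (cu x Ux)).
  apply: cvgM; last exact: cq.
  exact: (cvgM (c1 x) (c1 x)).
have cden x : U x -> den z.1 z.2 @[z --> ((0 : R), x)] --> den 0 x.
  move=> Ux; apply: cvgD; first exact: cu.
  exact: (cvg_comp _ _ (crad x Ux) (@sqrt_continuous R _)).
have den0 x : den 0 x = 2.
  by rewrite /den mul0r addr0 expr0n mul0r addr0 expr1n sqrtr1.
have U1 : \forall t \near (0 : R), forall x, `|x - p| <= r ->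
    `|(den t x)^-1 - (den 0 x)^-1| < e.
  apply: (@near_uniform R _ _ _ (fun t x => (den t x)^-1) 0 cK) => // x Bx.
  have d0 : den 0 x != 0 by rewrite den0.
  exact: (cvgV d0 (cden x (BU Bx))).
pose lin (t : R) x := 1 + t * beta x.
(* At t = 0 both [lin] and [rad] equal 1; staying within distance 1 makes 1 + t b and the radicand
   positive. *)
have U2 : \forall t \near (0 : R), forall x, `|x - p| <= r ->
    `|lin t x - lin 0 x| < 1.
  apply: (@near_uniform R _ _ _ lin 0 cK) => // x Bx.
  exact: cu x (BU Bx).
have U3 : \forall t \near (0 : R), forall x, `|x - p| <= r ->
    `|rad t x - rad 0 x| < 1.
  apply: (@near_uniform R _ _ _ rad 0 cK) => // x Bx.
  exact: crad x (BU Bx).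
near=> t.
have t0 : t != 0 by near: t; exact: nbhs_dnbhs_neq.
have u1 : forall x, `|x - p| <= r -> `|(den t x)^-1 - (den 0 x)^-1| < e.
  by near: t; exact: nbhs_dnbhs U1.
have u2 : forall x, `|x - p| <= r -> `|lin t x - lin 0 x| < 1.
  by near: t; exact: nbhs_dnbhs U2.
have u3 : forall x, `|x - p| <= r -> `|rad t x - rad 0 x| < 1.
  by near: t; exact: nbhs_dnbhs U3.
set D := restrict_ball p r _.
set B := restrict_ball p r (fun x => density x * beta x) in cB.
have cD : ccs D (r + `|p|) by exact: ccs_vdensity.
have bound x : `|D x - (t * B x + (t ^+ 2 / 2) * Q x)| <= t ^+ 2 * e * `|Q x|.
  rewrite /D /B /Q /restrict_ball; case: (leP _ r) => [Bx|_]; last first.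
    by rewrite !mulr0 addr0 subrr normr0 mulr0.
  have Ux := BU Bx.
  rewrite vdensityE//.
  have := u1 x Bx; have := u2 x Bx; have := u3 x Bx.
  rewrite den0 /lin /rad mul0r addr0 expr1n expr0n mul0r addr0 => v3 v2 v1.
  set S := Num.sqrt _.
  have R0 : 0 <= (1 + t * beta x) ^+ 2 + t ^+ 2 * quad x.
    by move: v3; rewrite ltr_norml; lra.
  have S0 : 0 <= S by exact: sqrtr_ge0.
  have SS : S ^+ 2 = (1 + t * beta x) ^+ 2 + t ^+ 2 * quad x by rewrite sqr_sqrtr.
  have u0 : 0 < 1 + t * beta x by move: v2; rewrite ltr_norml; lra.
  have d0 : 0 < 1 + t * beta x + S by lra.
  (* Multiplication by the conjugate, whose sum form is the positive number [den t x]. *)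
  have SE : S = 1 + t * beta x + t ^+ 2 * quad x * (den t x)^-1.
    apply: (mulIf (lt0r_neq0 d0)); rewrite /den -/S mulrDl divfK ?gt_eqF//.
    by move: SS; lra || nra.
  rewrite SE.
  have -> : density x * (1 + t * beta x + t ^+ 2 * quad x * (den t x)^-1) - density x -
      (t * (density x * beta x) + t ^+ 2 / 2 * (density x * quad x)) =
      t ^+ 2 * (density x * quad x) * ((den t x)^-1 - 2^-1) by field; rewrite gt_eqF.
  rewrite normrM [`|t ^+ 2 * _|]normrM [`|t ^+ 2|]ger0_norm ?sqr_ge0//.
  rewrite -!(mulrA (t ^+ 2)); apply: ler_wpM2l; first exact: sqr_ge0.
  by rewrite [e * _]mulrC; apply: ler_wpM2l => //; exact: ltW.
have cL : ccs (fun x => t * B x + (t ^+ 2 / 2) * Q x) (r + `|p|).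
  by apply: ccsD; exact: ccsZ.
have IB : Irv B = 0 by exact: first_variation.
have IL : Irv (fun x => t * B x + (t ^+ 2 / 2) * Q x) = t ^+ 2 / 2 * Irv Q.
  by rewrite (IrvD (ccsZ _ cB) (ccsZ _ cQ)) !(IrvZ _ cB) IB mulr0 add0r (IrvZ _ cQ).
have cDL : ccs (fun x => D x - (t * B x + (t ^+ 2 / 2) * Q x)) (r + `|p|).
  by apply: ccsD => //; exact: ccsN.
have up := Irv_le cDL (ccsZ (t ^+ 2 * e) cA) (fun x => le_trans (ler_norm _) (bound x)).
have lo : - (t ^+ 2 * e) * A <= Irv (fun x => D x - (t * B x + (t ^+ 2 / 2) * Q x)).
  rewrite -(IrvZ _ cA); apply: (Irv_le (ccsZ _ cA) cDL) => x.
  by rewrite mulNr lerNl; apply: le_trans (bound x); rewrite -normrN ler_norm.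
rewrite (IrvZ _ cA) -/A (IrvB cD cL) IL in up; rewrite (IrvB cD cL) IL in lo.
have t2 : 0 < t ^+ 2 by rewrite exprn_even_gt0.
have eA : `|s| * (e * A) <= s * Irv Q / 4.
  have -> : s * Irv Q / 4 = `|s| * (e * (A + 1)).
    have s1 : `|s| != 0 by rewrite normr_eq0.
    have A1 : A + 1 != 0 by rewrite gt_eqF// ltr_wpDl.
    by rewrite /e; field; rewrite A1 s1.
  by rewrite ler_wpM2l// ler_wpM2l ?(ltW e0)// lerDl.
have : `|s * (Irv D - t ^+ 2 / 2 * Irv Q)| <= t ^+ 2 * (s * Irv Q / 4).
  rewrite normrM; apply: (@le_trans _ _ (`|s| * (t ^+ 2 * e * A))).
    by rewrite ler_wpM2l// ler_norml; apply/andP; split=> //; rewrite -mulNr.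
  by rewrite -mulrA mulrCA ler_wpM2l// ltW.
rewrite ler_norml => /andP[+ _].
have : 0 < t ^+ 2 * (s * Irv Q) by rewrite mulr_gt0.
move=> X Y; lra.
Unshelve. all: by end_near. Qed.

End FixedField.

(** * Oscillating profiles and their gradients *)

Section Oscillation.
Context {R : realType} {m : nat}.

Definition dotp (l x : 'rV[R]_m) : R^o := \sum_j x 0 j * l 0 j.

Lemma Ck_dotp k l (U : set 'rV[R]_m) : open U -> Ck k U (dotp l).
Proof.
move=> oU; apply: Ck_sum => // j; apply: CkM => //; first exact: Ck_coord.
exact: (@Ck_cst R k _ R^o U (l 0 j)).
Qed.

Lemma derive_dotp l x i : 'D_(delta_mx 0 i) (dotp l) x = l 0 i.
Proof.
have dc (j : 'I_m) : differentiable (fun y : 'rV[R]_m => y 0 j : R^o) x.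
  exact: differentiable_coord.
rewrite derive_sumR; last by move=> j; apply: differentiableM.
rewrite (bigD1 i)//= big1 => [|j ji].
  rewrite derive_mulR// derive_cst mulr0 addr0 (derivable_coord _ i (f := id))//.
  by rewrite derive_id mxE !eqxx mul1r addr0.
rewrite derive_mulR// derive_cst mulr0 addr0 (derivable_coord _ j (f := id))//.
by rewrite derive_id mxE (negbTE ji) andbF mul0r.
Qed.

Lemma derive_comp_real (h h' : R -> R) (u : 'rV[R]_m -> R^o) (x v : 'rV[R]_m) :
  (forall y : R, is_derive y (1 : R) h (h' y)) -> differentiable u x ->
  differentiable (fun y => h (u y) : R^o) x /\
  'D_v (fun y => h (u y) : R^o) x = h' (u x) * 'D_v u x.
Proof.
move=> hd du.
have dh : differentiable (h : R^o -> R^o) (u x).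
  by apply/derivable1_diffP; case: (hd (u x)).
have dc : differentiable ((h : R^o -> R^o) \o u) x by exact: differentiable_comp.
split=> //; rewrite (_ : (fun y => _) = (h : R^o -> R^o) \o u)//.
rewrite deriveE// diff_comp//= -(deriveE v du).
have -> : 'd (h : R^o -> R^o) (u x) ('D_v u x) =
    'd (h : R^o -> R^o) (u x) ('D_v u x *: (1 : R^o)) by rewrite [_ *: _]mulr1.
rewrite linearZ -(deriveE (1 : R^o) dh) (@derive_val _ _ _ _ _ _ _ (hd (u x))).
exact: mulrC.
Qed.

Definition osc (h : R -> R) (G : 'rV[R]_m -> R^o) l (a : R) x : R^o :=
  G x * h (a * dotp l x).

Lemma Ck_osc k (h : R -> R) G l a : Ck k setT (h : R^o -> R^o) ->
  Ck k setT G -> Ck k setT (osc h G l a).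
Proof.
have oT : open [set: 'rV[R]_m] by exact: openT.
move=> Ch CG; apply: CkM => //.
apply: (@Ck_comp_R _ k _ setT setT (h : R^o -> R^o) (fun x => a * dotp l x)) => //.
  exact: openT.
by apply: CkM => //; [exact: (@Ck_cst R k _ R^o)|exact: Ck_dotp].
Qed.

Lemma gradient_osc (h h' : R -> R) G l a x :
  (forall y : R, is_derive y (1 : R) h (h' y)) -> differentiable G x ->
  gradient (osc h G l a) x = h (a * dotp l x) *: gradient G x +
    (a * G x * h' (a * dotp l x)) *: l.
Proof.
move=> hd dG; apply/rowP => i; rewrite !mxE.
have dl : differentiable (dotp l) x.
  exact: Ck_differentiable (Ck_dotp 0 l openT) (I : setT x).
have du : differentiable (fun y => a * dotp l y : R^o) x by exact: differentiableM.
have [dh E] := derive_comp_real (delta_mx 0 i) hd du.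
rewrite /osc derive_mulR// E derive_mulR// derive_cst mul0r add0r derive_dotp.
by ring.
Qed.

(* Pairing cos with sin cancels the oscillation, and a ^+ 2 carries the sign of
   the covector l. *)
Lemma qf_osc (M : 'M[R]_m) G l a x : differentiable G x ->
  let f1 := osc cos G l a in let f2 := osc sin G l a in
  qf M (gradient f1 x) (gradient f1 x) + qf M (gradient f2 x) (gradient f2 x) =
  qf M (gradient G x) (gradient G x) + a ^+ 2 * (G x ^+ 2 * qf M l l).
Proof.
move=> dG f1 f2; rewrite /f1 /f2.
rewrite (@gradient_osc cos (fun y => - sin y))//.
rewrite (@gradient_osc sin cos)//.
rewrite !qfDl !qfDr !qfZl !qfZr.
set C := cos _; set S := sin _.
have CS : C ^+ 2 = 1 - S ^+ 2 by rewrite -(cos2Dsin2 (a * dotp l x)) addrK.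
set q1 := qf M _ _; set q2 := qf M _ l; set q3 := qf M l _; set q4 := qf M l l.
transitivity (C ^+ 2 * q1 + S ^+ 2 * q1 + a ^+ 2 * (G x ^+ 2 * q4) * (C ^+ 2 + S ^+ 2)).
  by ring.
by rewrite CS; ring.
Qed.

End Oscillation.

(** * Choice of direction, covector and profile in a chart *)

Section ChooseVariation.
Context {R : realType} {m N : nat} (n k : nat).
Context (psi : 'rV[R]_m -> 'rV[R]_N) (U : set 'rV[R]_m) (oU : open U).
Context (Cpsi : forall k, Ck k U psi).
Context (mN : (m < N)%N) (hk : (0 < k < m)%N).
Context (himm : forall x, U x ->
  induced_metric n psi x \in unitmx /\ has_index (induced_metric n psi x) k).
Context (hmin : forall x, U x -> mean_curvature n psi x = 0).
Let c : R := (-1) ^+ k.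
Let g := induced_metric n psi.
Let E := Defs.eta R n N.

Lemma metric_det_sign x : U x -> 0 < c * \det (g x).
Proof.
move=> /himm[gU ik].
have [B [l [C [klm nB pC]]]] := index_split gU (metric_sym n psi x) ik.
exact: split_det_sign klm (metric_sym n psi x) nB pC.
Qed.

(** The sign of the squared normal length of nu is not at our disposal, as the normal space may be
    definite; the covector compensates for it. *)
Lemma exists_normal_and_covector p s : U p -> s != 0 ->
  exists (nu : 'rV[R]_N) (l : 'rV[R]_m),
    0 < s * (qf (invmx (g p)) l l * normal_norm n psi nu p).
Proof.
move=> Up s0; have [gU ik] := himm Up.
have [nu nu0] := exists_normal_nonnull ('J psi p) mN (eta_unit n N) (eta_sym n N).
have {}nu0 : normal_norm n psi nu p != 0 by exact: nu0.
have [[l1 l1n] [l2 l2p]] := exists_signed_covector hk gU (metric_sym n psi p) ik.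
exists nu; set a := normal_norm _ _ _ _ in nu0 *.
have sa : s * a != 0 by rewrite mulf_neq0.
have [sa0|sa0|/eqP] := ltgtP (s * a) 0; last by rewrite (negbTE sa).
  by exists l1; rewrite mulrCA nmulr_rgt0.
by exists l2; rewrite mulrCA pmulr_rgt0.
Qed.

Lemma exists_profile p r s nu l : U p -> 0 < r -> (forall x, `|x - p| <= r -> U x) ->
  (forall x, `|x - p| <= r ->
    0 < s * (qf (invmx (g x)) l l * normal_norm n psi nu x)) ->
  exists f : 'rV[R]_m -> R^o, [/\ forall j, Ck j setT f,
    forall x, r < `|x - p| -> f x = 0 &
    0 < s * Irv (restrict_ball p r (fun x => density n psi c x * quad n psi f nu x))].
Proof.
move=> Up r0 BU pos.
pose G := bump p r.
have CG j : Ck j setT G by exact: Ck_bump.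
have Gout x : r < `|x - p| -> G x = 0 by exact: bump_out.
pose L x : R := G x ^+ 2 * (qf (invmx (g x)) l l * normal_norm n psi nu x).
have cL : ccs (restrict_ball p r (fun x => density n psi c x * L x)) (r + `|p|).
  apply: (ccs_density_mul n oU Cpsi c BU) => [x Ux|x rx]; last first.
    by rewrite /L Gout// expr0n mul0r.
  have H1 : G y @[y --> x] --> G x := Ck_continuous (CG 0) (I : setT x).
  have H2 : qf (invmx (g y)) l l @[y --> x] --> qf (invmx (g x)) l l.
    exact: (cvg_qf (cvg_invmx (himm Ux).1 (cvg_metric oU Cpsi Ux)) (cvg_cst l) (cvg_cst l)).
  have H3 := cvg_normal_norm oU Cpsi (nu := nu) metric_det_sign Ux.
  exact: (cvgM (cvgM H1 H1) (cvgM H2 H3)).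
have cA : ccs (restrict_ball p r (fun x => density n psi c x * quad n psi G nu x)) (r + `|p|).
  apply: (ccs_density_mul n oU Cpsi c BU) => [x Ux|x rx]; last exact: quad_out Gout _ rx.
  exact: (cvg_quad oU Cpsi CG metric_det_sign Ux).
set rL := restrict_ball p r _ in cL; set rA := restrict_ball p r _ in cA.
have sL : 0 < s * Irv rL.
  rewrite -(IrvZ s cL); apply: (Irv_gt0 (p := p) _ (ccsZ s cL)).
  - by rewrite addr_ge0// ltW.
  - move=> x; rewrite /rL /restrict_ball; case: (leP `|x - p| r) => [Bx|_]; last by rewrite mulr0.
    rewrite mulrCA mulr_ge0 ?sqrtr_ge0// /L mulrCA mulr_ge0 ?sqr_ge0//.
    exact: ltW (pos _ Bx).
  - have Bp : `|p - p| <= r by rewrite subrr normr0 ltW.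
    rewrite /rL /restrict_ball Bp mulrCA mulr_gt0 ?sqrtr_gt0 ?metric_det_sign//.
    by rewrite /L mulrCA mulr_gt0 ?pos// exprn_gt0// bump_center.
(* The quotient makes a times s [Irv rL] exceed the absolute value of the a-independent term; the
   final 1 gives a >= 1, so that a^2 does at least as well. *)
pose a := (`|s * Irv rA| + 1) / (s * Irv rL) + 1.
have a1 : 1 <= a by rewrite lerDr divr_ge0// ltW.
have aL : 0 < s * Irv rA + a ^+ 2 * (s * Irv rL).
  have H : a * (s * Irv rL) = `|s * Irv rA| + 1 + s * Irv rL.
    by rewrite /a mulrDl mul1r divfK// gt_eqF.
  have : a * (s * Irv rL) <= a ^+ 2 * (s * Irv rL).
    by rewrite ler_wpM2r ?(ltW sL)// expr2 ler_peMl// (le_trans ler01).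
  have := ler_norm (- (s * Irv rA)); rewrite normrN.
  by rewrite H; lra.
pose f1 := osc cos G l a; pose f2 := osc sin G l a.
have Cf1 j : Ck j setT f1 by apply: Ck_osc => //; case: (@Ck_sin_cos R j).
have Cf2 j : Ck j setT f2 by apply: Ck_osc => //; case: (@Ck_sin_cos R j).
have out1 x : r < `|x - p| -> f1 x = 0 by move=> /Gout Gx; rewrite /f1 /osc Gx mul0r.
have out2 x : r < `|x - p| -> f2 x = 0 by move=> /Gout Gx; rewrite /f2 /osc Gx mul0r.
have cc f : (forall j, Ck j setT f) -> (forall x, r < `|x - p| -> f x = 0) ->
    ccs (restrict_ball p r (fun x => density n psi c x * quad n psi f nu x)) (r + `|p|).
  move=> Cf fout; apply: (ccs_density_mul n oU Cpsi c BU) => [x Ux|x rx].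
    exact: (cvg_quad oU Cpsi Cf metric_det_sign Ux).
  exact: quad_out fout _ rx.
have c1 := cc f1 Cf1 out1; have c2 := cc f2 Cf2 out2.
set r1 := restrict_ball p r _ in c1; set r2 := restrict_ball p r _ in c2.
have E12 : Irv r1 + Irv r2 = Irv rA + a ^+ 2 * Irv rL.
  rewrite -(IrvD c1 c2) -(IrvDZ (a ^+ 2) cA cL); congr Irv; apply/funext => x.
  rewrite /r1 /r2 /rA /rL /restrict_ball; case: (leP `|x - p| r) => _; last by rewrite mulr0 addr0.
  have dG : differentiable G x := Ck_differentiable (CG 0) (I : setT x).
  have := qf_osc (invmx (g x)) l a dG.
  rewrite /quad -/f1 -/f2 /L => H.
  by rewrite -mulrDr -mulrDl H; ring.
have p12 : 0 < s * Irv r1 + s * Irv r2 by rewrite -mulrDr E12 mulrDr mulrCA.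
have dich (u v : R) : 0 < u + v -> 0 < u \/ 0 < v.
  move=> uv; have [u0|u0] := ltP 0 u; first by left.
  by right; rewrite (lt_le_trans uv)// gerDr.
have [p1|p2] := dich _ _ p12.
- by exists f1; exact: And3 Cf1 out1 p1.
- by exists f2; exact: And3 Cf2 out2 p2.
Qed.

(** The definite pair B, C is chosen once, at p. On a small closed ball, and then for all small t,
    the same pair still certifies the index of the varied metric. *)
Lemma chart_variation p s : U p -> s != 0 ->
  exists (f : 'rV[R]_m -> R^o) (nu : 'rV[R]_N) (r : R),
    [/\ 0 < r, forall j, Ck j setT f,
    forall x, `|x - p| <= r -> U x, forall x, r < `|x - p| -> f x = 0 &
    (\forall t \near (0 : R), forall x, `|x - p| <= r ->
       induced_metric n (vary psi f nu t) x \in unitmx /\ has_index (induced_metric n (vary psi f nu t) x) k) /\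
    \forall t \near (0 : R)^',
      0 < s * Irv (restrict_ball p r
        (fun x => vdensity n psi f nu c t x - density n psi c x))].
Proof.
move=> Up s0.
have [gU ik] := himm Up.
have [B [l0 [C [klm nB pC]]]] := index_split gU (metric_sym n psi p) ik.
have [nu [l sl]] := exists_normal_and_covector Up s0.
have cg : g y @[y --> p] --> g p by exact: (cvg_metric oU Cpsi Up).
have N1 : \forall x \near p, negdef_on (g x) B := cg _ (near_negdef_on nB).
have cgN : - g y @[y --> p] --> - g p by exact: (cvgN cg).
have N2 : \forall x \near p, negdef_on (- g x) C := cgN _ (near_negdef_on pC).
have N3 : \forall x \near p, 0 < s * (qf (invmx (g x)) l l * normal_norm n psi nu x).
  have H2 : qf (invmx (g y)) l l @[y --> p] --> qf (invmx (g p)) l l.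
    exact: (cvg_qf (cvg_invmx gU cg) (cvg_cst l) (cvg_cst l)).
  have H3 := cvg_normal_norm oU Cpsi (nu := nu) metric_det_sign Up.
  have H : s * (qf (invmx (g y)) l l * normal_norm n psi nu y) @[y --> p] -->
      s * (qf (invmx (g p)) l l * normal_norm n psi nu p).
    exact: (cvgM (cvg_cst s) (cvgM H2 H3)).
  exact: (cvgr_gt _ H _ sl).
have N4 : \forall x \near p, U x by exact: open_nbhs_nbhs.
have [e /= e0 He] := (nbhs_ballP _ _).1 (filterI (filterI N1 N2) (filterI N3 N4)).
pose r := e / 2.
have r0 : 0 < r by rewrite divr_gt0.
have {}He x : `|x - p| <= r -> [/\ negdef_on (g x) B, negdef_on (- g x) C,
    0 < s * (qf (invmx (g x)) l l * normal_norm n psi nu x) & U x].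
  move=> xr; have [] := He x; last by move=> [? ?] [? ?].
  rewrite -ball_normE /= distrC (le_lt_trans xr)// /r ltr_pdivrMr//.
  by rewrite ltr_pMr// ltr1n.
have BU x : `|x - p| <= r -> U x by case/He.
have pos x : `|x - p| <= r -> 0 < s * (qf (invmx (g x)) l l * normal_norm n psi nu x).
  by case/He.
have [f [Cf fout sQ]] := exists_profile Up r0 BU pos.
exists f, nu, r; split=> //; split; last first.
  exact: (volume_expansion oU Cpsi Cf metric_det_sign BU fout hmin sQ).
have cK := @compact_cball_rV R m p r.
(* Compactness of the ball turns the pointwise ranges of t into a common one. *)
move/compact_near_coveringP : cK => /(_ _ (nbhs (0 : R)) (fun t x =>
  negdef_on (perturbed n psi f nu t x) B /\ negdef_on (- perturbed n psi f nu t x) C) _) cK.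
have p0 x : perturbed n psi f nu 0 x = g x.
  by rewrite /perturbed scale0r addr0 expr0n mul0r scale0r addr0.
have {}cK : \forall t \near (0 : R), forall x, `|x - p| <= r ->
    negdef_on (perturbed n psi f nu t x) B /\ negdef_on (- perturbed n psi f nu t x) C.
  apply: cK => x Bx; have [nBx pCx _ Ux] := He x Bx.
  have cp := cvg_perturbed (n := n) (nu := nu) oU Cpsi Cf (t0 := 0) Ux.
  have cpN : - perturbed n psi f nu z.1 z.2 @[z --> ((0 : R), x)] -->
    - perturbed n psi f nu 0 x by exact: (cvgN cp).
  rewrite p0 in cp cpN.
  have W1 : \forall z \near ((0 : R), x),
    negdef_on (perturbed n psi f nu z.1 z.2) B := cp _ (near_negdef_on nBx).
  have W2 : \forall z \near ((0 : R), x),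
    negdef_on (- perturbed n psi f nu z.1 z.2) C := cpN _ (near_negdef_on pCx).
  have [[V1 V2] [/= nV1 nV2] V12] := filterI W1 W2.
  exists (V2, V1); first exact: (conj nV2 nV1).
  by move=> [x' t] [Vx Vt]; exact: (V12 (t, x') (conj Vt Vx)).
apply: filterS cK => t Ht x Bx; have [nBt pCt] := Ht x Bx.
rewrite (metric_vary n oU Cpsi Cf nu t (BU x Bx)); split.
  apply: (split_unit klm _ nBt pCt).
  by rewrite -(metric_vary n oU Cpsi Cf nu t (BU x Bx)) metric_sym.
exact: split_index klm nBt pCt.
Qed.

End ChooseVariation.

(** * Variation on the manifold *)

Section Jacobian.
Context {R : realType}.

Lemma row_jacobian m N (psi : 'rV[R]_m -> 'rV[R]_N) x i : differentiable psi x ->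
  row i ('J psi x) = 'd psi x (delta_mx 0 i).
Proof. by move=> d; rewrite rowE /jacobian mul_rV_lin1. Qed.

Lemma jacobian_near_eq m N (psi1 psi2 : 'rV[R]_m -> 'rV[R]_N) x :
  differentiable psi1 x -> (\near x, psi1 x = psi2 x) -> 'J psi1 x = 'J psi2 x.
Proof.
move=> d1 E; have d2 := differentiable_near_eq E d1.
apply: (row_matrixP _ _).1 => i.
apply: etrans (row_jacobian i d1) _; apply: etrans (esym (row_jacobian i d2)).
apply: etrans (esym (deriveE _ d1)) _; apply: etrans (deriveE _ d2).
exact: (near_eq_derive (delta_mx 0 i) E).
Qed.

Lemma metric_near_eq m N n (psi1 psi2 : 'rV[R]_m -> 'rV[R]_N) x :
  differentiable psi1 x -> (\near x, psi1 x = psi2 x) ->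
  induced_metric n psi1 x = induced_metric n psi2 x.
Proof. by move=> d E; rewrite /induced_metric (jacobian_near_eq d E). Qed.

Lemma jacobian_comp m p N (T : 'rV[R]_m -> 'rV[R]_p) (h : 'rV[R]_p -> 'rV[R]_N) x :
  differentiable T x -> differentiable h (T x) ->
  'J (h \o T) x = 'J T x *m 'J h (T x).
Proof.
move=> dT dh; have dc : differentiable (h \o T) x by exact: differentiable_comp.
apply: (row_matrixP _ _).1 => i; apply: etrans (row_jacobian i dc) _.
rewrite (diff_comp dT dh) row_mul (row_jacobian i dT).
by rewrite [in RHS]/jacobian mul_rV_lin1.
Qed.

Lemma jacobian_unit m (T S : 'rV[R]_m -> 'rV[R]_m) x :
  differentiable T x -> differentiable S (T x) -> (\near x, S (T x) = x) ->
  'J T x \in unitmx.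
Proof.
move=> dT dS ST.
have dST : differentiable (S \o T) x by exact: differentiable_comp.
have H : 'J (S \o T) x = 1%:M.
  have dI : differentiable (id : 'rV[R]_m -> 'rV[R]_m) x by exact: ex_diff.
  apply: etrans (jacobian_near_eq (psi2 := id) dST ST) _.
  apply: (row_matrixP _ _).1 => i.
  apply: etrans (row_jacobian i dI) _.
  rewrite rowE mulmx1; apply: etrans (esym (deriveE _ dI)) _.
  exact: derive_id.
have E := etrans (esym (jacobian_comp dT dS)) H.
exact: (mulmx1_unit E).1.
Qed.

Lemma metric_comp m N n (T : 'rV[R]_m -> 'rV[R]_m) (h : 'rV[R]_m -> 'rV[R]_N) x :
  differentiable T x -> differentiable h (T x) ->
  induced_metric n (h \o T) x =
  'J T x *m induced_metric n h (T x) *m ('J T x)^T.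
Proof. by move=> dT dh; rewrite /induced_metric jacobian_comp// trmx_mul !mulmxA. Qed.

End Jacobian.

Section Atlas.
Context {R : realType} {m : nat} {M : topologicalType} (A : smooth_atlas R m M).

Lemma chart_imgP j x : chart_img A j x ->
  chart_dom A j (param A j x) /\ Defs.coord A j (param A j x) = x.
Proof. by move=> [q dq <-]; rewrite Defs.coordK. Qed.

Lemma coord_img_open j (V : set M) : open V -> V `<=` chart_dom A j ->
  open (Defs.coord A j @` V).
Proof.
move=> oV Vj.
have -> : Defs.coord A j @` V = chart_img A j `&` param A j @^-1` V.
  apply/seteqP; split=> [_ [q Vq <-]|x [Ix /= Vx]].
    by split=> /=; [exists q => //; exact: Vj|rewrite Defs.coordK//; exact: Vj].
  by exists (param A j x) => //; have [] := chart_imgP Ix.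
rewrite openE => x [Ix /= Vx]; apply: filterI.
  by apply: open_nbhs_nbhs; split=> //; exact: chart_img_open.
by apply: (param_continuous Ix); exact: open_nbhs_nbhs.
Qed.

Lemma chart_img_nbhs j x : chart_img A j x -> \forall y \near x, chart_img A j y.
Proof. by move=> Ix; apply: open_nbhs_nbhs; split=> //; exact: chart_img_open. Qed.

Lemma compact_param j (B : set 'rV[R]_m) : B `<=` chart_img A j -> compact B ->
  compact (param A j @` B).
Proof.
move=> Bj; apply: continuous_compact; apply: continuous_in_subspaceT => x.
by move=> /set_mem /Bj; exact: param_continuous.
Qed.

(* On D the first chart meeting D exhausts its piece of the partition used by
   [volume], so that no change of variables is needed. *)
Lemma first_chart (D : set M) : D !=set0 -> exists i,
  D `&` chart_dom A i !=set0 /\ D `&` chart_dom A i `<=` chart_piece A i.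
Proof.
move=> [q Dq].
have exi : exists i, `[< D `&` chart_dom A i !=set0 >].
  have : (\bigcup_i chart_dom A i) q by rewrite chart_cover.
  by move=> [i _ iq]; exists i; apply/asboolP; exists q.
case: (ex_minnP exi) => i /asboolP Di imin; exists i; split=> // x [Dx ix].
split=> // -[j /= ji jx].
have : (i <= j)%N by apply: imin; apply/asboolP; exists x.
by rewrite leqNgt ji.
Qed.

End Atlas.

Section ProductProjections.
Context {R : realType} {m : nat}.

Definition fst_lin (z : R^o * 'rV[R]_m) : R^o := z.1.
Definition snd_lin (z : R^o * 'rV[R]_m) : 'rV[R]_m := z.2.

Lemma fst_lin_is_linear : linear fst_lin. Proof. by []. Qed.
Lemma snd_lin_is_linear : linear snd_lin. Proof. by []. Qed.

HB.instance Definition _ := GRing.isLinear.Build R (R^o * 'rV[R]_m)%type R^o _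
  fst_lin fst_lin_is_linear.
HB.instance Definition _ := GRing.isLinear.Build R (R^o * 'rV[R]_m)%type 'rV[R]_m _
  snd_lin snd_lin_is_linear.

Lemma fst_lin_continuous : continuous fst_lin.
Proof. by move=> z; exact: cvg_fst. Qed.

Lemma snd_lin_continuous : continuous snd_lin.
Proof. by move=> z; exact: cvg_snd. Qed.

End ProductProjections.

(** * Extension of the variation by zero and its effect on the volume *)

Section GlobalVariation.
Context {R : realType} {m n N k : nat} {M : topologicalType}.
Context (A : smooth_atlas R m M) (phi : M -> 'rV[R]_N).
Context (himm : indefinite_immersion n A k phi).
Context (i : nat) (W : set M) (Wi : W `<=` chart_dom A i).
Context (f : 'rV[R]_m -> R^o) (Cf : forall j, Ck j setT f) (nu : 'rV[R]_N).
Context (p : 'rV[R]_m) (r : R).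
Context (BW : forall x, `|x - p| <= r -> (Defs.coord A i @` W) x).
Context (fout : forall x, r < `|x - p| -> f x = 0).
Let psi := phi \o param A i.

Definition moved_set : set M := param A i @` [set x | `|x - p| <= r].
Let K := moved_set.

Definition extend (q : M) : R := if `[< K q >] then f (Defs.coord A i q) else 0.

Definition Phi (t : R) (q : M) : 'rV[R]_N := phi q + (t * extend q) *: nu.

Lemma moved_setE q : K q -> W q /\ `|Defs.coord A i q - p| <= r.
Proof.
move=> [x /= Bx <-]; have [q' Wq' qx] := BW Bx.
by rewrite -qx Defs.coordK; [split=> //; rewrite qx|exact: Wi].
Qed.

Lemma moved_set_compact : compact K.
Proof.
apply: compact_param (@compact_cball_rV R m p r) => x /= /BW[q /Wi iq <-].
by exists q.
Qed.

(** The Hausdorff property makes the compact K closed, so that extension by zero is smooth. *)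
Lemma moved_set_open : open (~` K).
Proof.
apply: closed_openC; exact: compact_closed (atlas_hausdorff A) moved_set_compact.
Qed.

Lemma extend_in q : chart_dom A i q -> extend q = f (Defs.coord A i q).
Proof.
move=> iq; rewrite /extend; case: asboolP => // nK; rewrite fout// ltNge.
apply/negP => Bq; apply: nK; exists (Defs.coord A i q) => //.
exact: Defs.coordK.
Qed.

Lemma extend_out q : ~ K q -> extend q = 0.
Proof. by move=> nK; rewrite /extend; case: asboolP. Qed.

Let overlap j := Defs.coord A j @` (chart_dom A j `&` chart_dom A i).

Lemma overlap_open j : open (overlap j).
Proof. by apply: coord_img_open => [|q []//]; apply: openI; exact: chart_dom_open. Qed.

Lemma Ck_transition l j1 j2 :
  Ck l (Defs.coord A j1 @` (chart_dom A j1 `&` chart_dom A j2))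
    (Defs.coord A j2 \o param A j1).
Proof. by have /smooth_onP := @transition_smooth R m M A j1 j2; exact. Qed.

Lemma Ck_chart l j : Ck l (chart_img A j) (phi \o param A j).
Proof. by have /smooth_onP := himm.1 j; exact. Qed.

(** Two open sets cover the chart: the overlap with chart i, where the function is f after a
    transition map, and the complement of K, where it is 0. *)
Lemma Ck_extend l j : Ck l (chart_img A j) (extend \o param A j : _ -> R^o).
Proof.
pose U2 := Defs.coord A j @` (chart_dom A j `\` K).
have oU2 : open U2.
  apply: coord_img_open => [|q []//].
  by apply: openI; [exact: chart_dom_open|exact: moved_set_open].
apply: (@Ck_sub R l _ _ (overlap j `|` U2)) => [x Ix|].
  have [jx xE] := chart_imgP Ix; have [Kx|nK] := pselect (K (param A j x)).
    left; exists (param A j x) => //; split=> //.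
    by apply: Wi; exact: (moved_setE Kx).1.
  by right; exists (param A j x).
apply: Ck_setU.
  refine (@Ck_eq R l 'rV[R]_m R^o (overlap j)
    (fun x => f ((Defs.coord A i \o param A j) x)) _ (@overlap_open j) _ _).
    by move=> _ [q [jq iq] <-]; rewrite /= Defs.coordK// extend_in.
  apply: (Ck_comp_rV (U := setT) openT (@overlap_open j)) => //.
  exact: Ck_transition.
apply: Ck_open_zero => // _ [q [jq nK] <-]; rewrite /= Defs.coordK//.
exact: extend_out.
Qed.

Lemma Phi_chart t j : Phi t \o param A j =
  vary (phi \o param A j) (extend \o param A j : _ -> R^o) nu t.
Proof. by []. Qed.

Lemma Ck_Phi l t j : Ck l (chart_img A j) (Phi t \o param A j).
Proof.
rewrite Phi_chart; apply: Ck_vary; first exact: chart_img_open.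
  exact: Ck_chart.
exact: Ck_extend.
Qed.

Lemma Phi_smooth j (delta : R) : smooth_on
  [set z : R^o * 'rV[R]_m | `|z.1| < delta /\ chart_img A j z.2]
  (fun z => Phi z.1 (param A j z.2)).
Proof.
apply/smooth_onP => l; set S := [set z | _].
pose U : set (R^o * 'rV[R]_m) := @snd_lin R m @^-1` chart_img A j.
have oI : open (chart_img A j) by exact: chart_img_open.
have oU : open U by apply: open_comp => // z _; exact: snd_lin_continuous.
apply: (@Ck_sub R l _ _ U) => [z [_ //]|].
have C1 : Ck l U (fun z => (phi \o param A j) (snd_lin z)).
  exact: (Ck_comp_lin (@snd_lin_continuous R m) (Ck_chart l j) oI).
have C2 : Ck l U (fun z => (extend \o param A j) (snd_lin z) : R^o).
  exact: (Ck_comp_lin (@snd_lin_continuous R m) (Ck_extend l j) oI).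
have C3 : Ck l U (fun z => fst_lin z : R^o).
  apply: (@Ck_sub R l _ _ (@fst_lin R m @^-1` setT)) => //.
  exact: (Ck_comp_lin (@fst_lin_continuous R m) (Ck_id l openT) openT).
apply: (@CkD R l _ _ U (fun z => (phi \o param A j) (snd_lin z))
  (fun z => scale_row nu (fst_lin z * (extend \o param A j) (snd_lin z)))) => //.
apply: (Ck_lin_comp oU (scale_row_continuous (nu := nu))).
exact: CkM.
Qed.

Lemma metric_off_moved t j x : chart_img A j x -> ~ K (param A j x) ->
  induced_metric n (Phi t \o param A j) x = induced_metric n (phi \o param A j) x.
Proof.
move=> Ix nK; apply/esym; apply: metric_near_eq.
  exact: (Ck_differentiable (Ck_chart 0 j) Ix).
have nbK : nbhs (param A j x) (~` K).
  by apply: open_nbhs_nbhs; split=> //; exact: moved_set_open.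
have H : \forall y \near x, ~ K (param A j y) := param_continuous Ix nbK.
apply: filterS H => y /= nKy.
by rewrite /Phi extend_out// mulr0 scale0r addr0.
Qed.

Lemma Ck_vary_psi l t : Ck l (chart_img A i) (vary psi f nu t).
Proof.
apply: Ck_vary; [exact: chart_img_open|exact: Ck_chart|exact: Ck_sub (Cf l)].
Qed.

Lemma metric_first t x : chart_img A i x ->
  induced_metric n (Phi t \o param A i) x = induced_metric n (vary psi f nu t) x.
Proof.
move=> Ix; apply: metric_near_eq; first exact: (Ck_differentiable (Ck_Phi 0 t i) Ix).
apply: filterS (chart_img_nbhs Ix) => y Iy; have [iy yE] := chart_imgP Iy.
by rewrite /vary /= /Phi extend_in// yE.
Qed.

(** The index is known in chart i only; congruence by the Jacobian of the transition carries it to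
    chart j. *)
Lemma metric_transition t j x : overlap j x ->
  let T := Defs.coord A i \o param A j in
  'J T x \in unitmx /\ induced_metric n (Phi t \o param A j) x =
  'J T x *m induced_metric n (vary psi f nu t) (T x) *m ('J T x)^T.
Proof.
move=> Ox T; have oO := @overlap_open j.
have nO : \forall y \near x, overlap j y by exact: open_nbhs_nbhs.
have dT : differentiable T x := Ck_differentiable (Ck_transition 0 j i) Ox.
have [q [jq iq] xE] := Ox.
have TE : T x = Defs.coord A i q by rewrite -xE /T /= Defs.coordK.
have dS : differentiable (Defs.coord A j \o param A i) (T x).
  apply: (Ck_differentiable (Ck_transition 0 i j)).
  by rewrite TE; exists q.
have dv : differentiable (vary psi f nu t) (T x).
  by apply: (Ck_differentiable (Ck_vary_psi 0 t)); rewrite TE; exists q.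
split.
  apply: (jacobian_unit dT dS); apply: filterS nO => _ [q' [jq' iq'] <-].
  by rewrite /T /= !Defs.coordK.
apply: etrans (metric_comp n dT dv).
apply: metric_near_eq.
  by apply: (Ck_differentiable (Ck_Phi 0 t j)); exists q.
apply: filterS nO => _ [q' [jq' iq'] <-].
by rewrite /vary /psi /T /= !Defs.coordK// /Phi extend_in.
Qed.

Lemma Phi_immersion t :
  (forall x, `|x - p| <= r -> induced_metric n (vary psi f nu t) x \in unitmx /\
     has_index (induced_metric n (vary psi f nu t) x) k) ->
  indefinite_immersion n A k (Phi t).
Proof.
move=> H; split=> [j|j x Ix].
  by apply/smooth_onP => l; exact: Ck_Phi.
have [Kx|nK] := pselect (K (param A j x)); last first.
  by rewrite /= (metric_off_moved t Ix nK); exact: himm.2.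
have [jx xE] := chart_imgP Ix; have [Wx Bx] := moved_setE Kx.
have Ox : overlap j x by exists (param A j x) => //; split=> //; exact: Wi.
have [uT ->] := metric_transition t Ox; have [uG iG] := H _ Bx.
by split; [exact: congr_unit|exact: congr_has_index].
Qed.

Lemma Phi_variation D (delta : R) : 0 < delta -> W `<=` D ->
  (forall t x, `|t| < delta -> `|x - p| <= r ->
     induced_metric n (vary psi f nu t) x \in unitmx /\
     has_index (induced_metric n (vary psi f nu t) x) k) ->
  fixed_boundary_variation n A k phi D K delta Phi.
Proof.
move=> d0 WD H; split; first exact: d0.
- exact: moved_set_compact.
- by move=> q /moved_setE[/WD].
- by move=> j; exact: Phi_smooth.
- by apply/funext => q; rewrite /Phi mul0r scale0r addr0.
- by move=> t td; apply: Phi_immersion => x Bx; exact: H.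
- by move=> t q _ nK; rewrite /Phi extend_out// mulr0 scale0r addr0.
Qed.

Let c : R := (-1) ^+ k.

Definition piece_volume (chi : M -> 'rV[R]_N) (O : set M) (j : nat) : \bar R :=
  integral_rV (fun x : 'rV[R]_m =>
    (Num.sqrt (c * \det (induced_metric n (chi \o param A j) x))
     * \1_(Defs.coord A j @` (O `&` chart_piece A j)) x)%:E).

Lemma piece_volume_ge0 chi O j : (0 <= piece_volume chi O j)%E.
Proof.
by apply: integral_rV_ge0 => x; rewrite lee_fin mulr_ge0// ?sqrtr_ge0// indicE.
Qed.

Context (Wpiece : W `<=` chart_piece A i).

(** Piece j misses K: for j > i it excludes the domain of chart i, which contains K; for j < i, K
    lies in piece i, which excludes the domain of chart j. *)
Lemma piece_volume_other t O j : j != i ->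
  piece_volume (Phi t) O j = piece_volume phi O j.
Proof.
move=> ji; apply: (congr1 (@integral_rV R m)); apply/funext => x.
apply: (congr1 EFin); rewrite indicE.
have [[q [Oq jq] qx]|nS] := pselect ((Defs.coord A j @` (O `&` chart_piece A j)) x);
  last by rewrite (memNset nS); exact: etrans (mulr0 _) (esym (mulr0 _)).
have [jdq jn] := jq.
have Ix : chart_img A j x by exists q.
have xq : param A j x = q by rewrite -qx Defs.coordK.
suff nK : ~ K (param A j x) by rewrite (metric_off_moved t Ix nK).
rewrite xq => /moved_setE[Wq _].
have [iq inn] := Wpiece Wq.
case: (ltngtP j i) ji => // lt _.
  by apply: inn; exists j.
by apply: jn; exists i.
Qed.

(** On the ball the indicator is 1, since K lies in O and W in the piece; off the ball the densities
    agree wherever the indicator is nonzero. The change does not depend on O. *)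
Lemma piece_volume_first t O : K `<=` O ->
  (forall x, chart_img A i x -> 0 < c * \det (induced_metric n psi x)) ->
  piece_volume (Phi t) O i = (piece_volume phi O i +
    (Irv (restrict_ball p r
       (fun x => vdensity n psi f nu c t x - density n psi c x)))%:E)%E.
Proof.
move=> KO cpos; pose S := Defs.coord A i @` (O `&` chart_piece A i).
pose F0 x : R := Num.sqrt (c * \det (induced_metric n psi x)) * \1_S x.
pose F1 x : R := Num.sqrt (c * \det (induced_metric n (Phi t \o param A i) x)) * \1_S x.
have BI x : `|x - p| <= r -> chart_img A i x.
  by move=> /BW[q Wq <-]; exists q => //; exact: Wi.
have E : (fun x => F1 x - F0 x) = restrict_ball p r
    (fun x => vdensity n psi f nu c t x - density n psi c x).
  apply/funext => x; rewrite /restrict_ball /F0 /F1 indicE; case: (leP _ r) => [Bx|rx].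
    have Sx : S x.
      have [q Wq qx] := BW Bx; exists q => //; split; last exact: Wpiece.
      by apply: KO; exists x => //; rewrite -qx Defs.coordK//; exact: Wi.
    rewrite (mem_set Sx) (metric_first t (BI _ Bx)).
    by congr (_ - _); exact: mulr1.
  have [[q [Oq [iq _]] qx]|nS] := pselect (S x); last first.
    rewrite (memNset nS); apply: etrans (subrr 0).
    by congr (_ - _); exact: mulr0.
  have Ix : chart_img A i x by exists q.
  have nK : ~ K (param A i x).
    rewrite -qx Defs.coordK// => /moved_setE[_].
    by rewrite qx leNgt rx.
  by rewrite (metric_off_moved t Ix nK) subrr.
have oI : open (chart_img A i) by exact: chart_img_open.
have cE := ccs_vdensity (n := n) oI (fun l => Ck_chart l i) Cf nu cpos BI fout t.
rewrite -E in cE *.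
apply: integral_rV_perturb cE => x;
  by rewrite mulr_ge0// ?sqrtr_ge0// indicE.
Qed.

Lemma volume_Phi t O : K `<=` O -> (volume n A k phi O < +oo)%E ->
  (forall x, chart_img A i x -> 0 < c * \det (induced_metric n psi x)) ->
  volume n A k phi O \is a fin_num /\
  volume n A k (Phi t) O = (volume n A k phi O +
    (Irv (restrict_ball p r
       (fun x => vdensity n psi f nu c t x - density n psi c x)))%:E)%E.
Proof.
move=> KO fin cpos.
(* The variation affects the i-th piece alone, so this term is taken out of the series. *)
have V chi : volume n A k chi O =
  (piece_volume chi O i + \sum_(0 <= j <oo | true && (j != i)) piece_volume chi O j)%E.
  by apply: (nneseriesD1 (P := xpredT)) => // j _; exact: piece_volume_ge0.
split.
  rewrite ge0_fin_numE// V; apply: adde_ge0; first exact: piece_volume_ge0.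
  by apply: nneseries_ge0 => j _ _; exact: piece_volume_ge0.
have rest : (\sum_(0 <= j <oo | true && (j != i)) piece_volume (Phi t) O j =
    \sum_(0 <= j <oo | true && (j != i)) piece_volume phi O j)%E.
  by apply: eq_eseriesr => j ji; exact: piece_volume_other.
apply: etrans (V (Phi t)) _.
rewrite rest (piece_volume_first t KO cpos) V.
exact: addeAC.
Qed.

End GlobalVariation.

(** Only the sign of s matters: 1 and -1 give the two halves of the theorem. The amount a is chosen
    before O, so one range of t serves all O, and finiteness of the volume makes the change
    strict. *)
Lemma exists_signed_variation (R : realType) (m n N k : nat) (M : topologicalType)
  (A : smooth_atlas R m M) (phi : M -> 'rV[R]_N) (D : set M) (s : R) :
  (m < N)%N -> (0 < k < m)%N -> indefinite_immersion n A k phi ->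
  minimal n A phi -> open D -> D !=set0 -> s != 0 ->
  exists (K : set M) (delta : R) (Phi : R -> M -> 'rV[R]_N),
    fixed_boundary_variation n A k phi D K delta Phi /\
    \forall t \near (0 : R)^', exists2 a : R, 0 < s * a & forall O : set M,
      K `<=` O -> (volume n A k phi O < +oo)%E ->
      volume n A k phi O \is a fin_num /\
      volume n A k (Phi t) O = (volume n A k phi O + a%:E)%E.
Proof.
move=> mN hk himm hmin oD D0 s0.
have [i [[q Wq] Wpiece]] := first_chart A D0.
set W := D `&` chart_dom A i in Wq Wpiece.
have oW : open W by apply: openI => //; exact: chart_dom_open.
have Wi : W `<=` chart_dom A i by move=> ? [].
pose psi := phi \o param A i.
have CI l : Ck l (chart_img A i) psi by exact: Ck_chart himm l i.
have oI : open (chart_img A i) by exact: chart_img_open.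
pose U := Defs.coord A i @` W.
have oU : open U by exact: coord_img_open.
have UI : U `<=` chart_img A i by move=> _ [q' /Wi ? <-]; exists q'.
have CU l : Ck l U psi by exact: Ck_sub (CI l).
have hi x : U x -> induced_metric n psi x \in unitmx /\
    has_index (induced_metric n psi x) k by move=> /UI; exact: himm.2.
have hm x : U x -> mean_curvature n psi x = 0 by move=> /UI; exact: hmin.
have hiI x : chart_img A i x -> induced_metric n psi x \in unitmx /\
    has_index (induced_metric n psi x) k by exact: himm.2.
have cpos x : chart_img A i x -> 0 < (-1) ^+ k * \det (induced_metric n psi x).
  exact: (metric_det_sign hiI).
have Uq : U (Defs.coord A i q) by exists q.
have [f [nu [r [r0 Cf BU fout [Hi Hv]]]]] :=
  chart_variation oU CU mN hk hi hm Uq s0.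
set p := Defs.coord A i q in BU fout Hi Hv.
have [delta /= d0 Hd] := (nbhs_ballP _ _).1 Hi.
exists (moved_set A i p r), delta, (Phi A phi i f nu p r); split.
  apply: (Phi_variation himm Wi Cf BU fout d0) => [? []//|t x td Bx].
  by apply: Hd => //; rewrite -ball_normE /= sub0r normrN.
apply: filterS Hv => t Ht; exists (Irv (restrict_ball p r
  (fun x => vdensity n psi f nu ((-1) ^+ k) t x - density n psi ((-1) ^+ k) x))) => //.
move=> O KO fin; exact: (volume_Phi himm Wi Cf nu BU fout Wpiece t KO fin cpos).
Qed.

Theorem theoremA (R : realType) (m n N k : nat) (M : topologicalType)
  (A : smooth_atlas R m M) (phi : M -> 'rV[R]_N)
  (hn : (n <= N)%N) (hmN : (m < N)%N) (hk : (0 < k < m)%N)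
  (himm : indefinite_immersion n A k phi) (hmin : minimal n A phi)
  (D : set M) (Dopen : open D) (Dconn : connected D) (Dne : D !=set0) :
  (exists (K : set M) (delta : R) (Phi : R -> M -> 'rV[R]_N),
     fixed_boundary_variation n A k phi D K delta Phi /\
     increases_volume n A k phi D K Phi) /\
  (exists (K : set M) (delta : R) (Phi : R -> M -> 'rV[R]_N),
     fixed_boundary_variation n A k phi D K delta Phi /\
     decreases_volume n A k phi D K Phi).
Proof.
split.
  have [K [delta [Phi [V near_V]]]] :=
    exists_signed_variation hmN hk himm hmin Dopen Dne (oner_neq0 R).
  exists K, delta, Phi; split=> //; apply: filterS near_V => t [a a0 Ha] O _ KO _ fin.
  have [fV ->] := Ha O KO fin.
  by rewrite lteDl// lte_fin -(mul1r a).
have N1 : (-1 : R) != 0 by rewrite oppr_eq0 oner_neq0.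
have [K [delta [Phi [V near_V]]]] :=
  exists_signed_variation hmN hk himm hmin Dopen Dne N1.
exists K, delta, Phi; split=> //; apply: filterS near_V => t [a a0 Ha] O _ KO _ fin.
have [fV ->] := Ha O KO fin.
by rewrite gteDl// lte_fin -oppr_gt0 -mulN1r.
Qed.
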